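(* Let $\mathcal L$: $u_t=A(t,x)u_{xx}+B(t,x)u_x+C(t,x)u$ be any equation with analytic $A,B,C$, $A\neq0$. Up to equivalence of operators and up to equivalence of solution families, there is a one-to-one correspondence between the one-parametric families of solutions of $\mathcal L$ and the reduction operators of $\mathcal L$ with zero coefficient of $\partial_t$. Namely, each such operator $Q$ corresponds to the family of all solutions of $\mathcal L$ that are invariant with respect to $Q$. (Thus the problems of constructing all one-parametric solution families of $\mathcal L$ and of exhaustively describing its reduction operators with zero coefficient of $\partial_t$ are completely equivalent.)
   Context: All considerations are local: functions are smooth (or analytic) on a suitable domain, which may be shrunk so that expressions not vanishing identically do not vanish. Write $Lu:=u_t-Au_{xx}-Bu_x-Cu$. A reduction operator (nonclassical symmetry) of $\mathcal L$ is an operator $Q=\tau\partial_t+\xi\partial_x+\eta\partial_u$ with coefficients depending on $(t,x,u)$, $(\tau,\xi)\ne(0,0)$, such that $Q_{(2)}(Lu)=0$ holds on the subset of the second-order jet space defined by $Lu=0$, $Q[u]=0$, $D_tQ[u]=0$, $D_xQ[u]=0$. Here $Q[u]=\eta-\tau u_t-\xi u_x$ is the characteristic of $Q$, $Q_{(2)}$ is the standard second prolongation of $Q$, and $D_t,D_x$ are total derivatives. Two operators are equivalent if they differ by a nonvanishing multiplier $\lambda(t,x,u)$. A function $u(t,x)$ is $Q$-invariant if it satisfies $Q[u]=0$. A one-parametric family of solutions is a family $u=f(t,x,\varkappa)$ with essential parameter, $f_\varkappa\neq0$, such that $f(\cdot,\cdot,\varkappa)$ solves $\mathcal L$ for each $\varkappa$.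 Families $f$ and $\tilde f$ are equivalent if they differ only by parameterization: $\tilde f(t,x,\zeta(\varkappa))=f(t,x,\varkappa)$ for some $\zeta=\zeta(\varkappa)$ with $\zeta_\varkappa\ne0$. *)

(* Defs.v *)
From Stdlib Require Import Reals.
From Coquelicot Require Import Coquelicot.
Open Scope R_scope.

(* Everything is local, so functions are total and only their germs at a base
   point matter: every hypothesis and conclusion is asserted on a neighbourhood
   of that point. *)

(* Derivatives of [f] are only evaluated on [D], which is open below. *)
Fixpoint Ck (n : nat) (D : R * R * R -> Prop) (f : R -> R -> R -> R) : Prop :=
  (forall t x u, D (t, x, u) -> continuous (fun '(t, x, u) => f t x u) (t, x, u)) /\
  match n with
  | O => True
  | S m =>
      (forall t x u, D (t, x, u) ->
         ex_derive (fun s => f s x u) t /\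
         ex_derive (fun s => f t s u) x /\
         ex_derive (fun s => f t x s) u) /\
      Ck m D (fun t x u => Derive (fun s => f s x u) t) /\
      Ck m D (fun t x u => Derive (fun s => f t s u) x) /\
      Ck m D (fun t x u => Derive (fun s => f t x s) u)
  end.

Definition smooth3 (f : R -> R -> R -> R) (p : R * R * R) : Prop :=
  exists D : R * R * R -> Prop, open D /\ D p /\ forall n, Ck n D f.

Definition smooth2 (f : R -> R -> R) (p : R * R) : Prop :=
  smooth3 (fun t x _ => f t x) (p, 0).

Definition smooth1 (f : R -> R) (k : R) : Prop :=
  locally k (fun s => forall n, ex_derive_n f n s).

Definition analytic2 (f : R -> R -> R) (t0 x0 : R) : Prop :=
  exists (a : nat -> nat -> R) (r : posreal), forall h k : R,
    Rabs h < r -> Rabs k < r ->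
    (forall i, ex_series (fun j => Rabs (a i j * h ^ i * k ^ j))) /\
    ex_series (fun i => Series (fun j => Rabs (a i j * h ^ i * k ^ j))) /\
    is_series (fun i => Series (fun j => a i j * h ^ i * k ^ j)) (f (t0 + h) (x0 + k)).

(* Coordinates t, x, u, u_t, u_x, u_tt, u_tx, u_xx of the second-order jet space. *)
Inductive coord := ct | cx | cu | cut | cux | cutt | cutx | cuxx.

Definition coord_eq_dec (c d : coord) : {c = d} + {c <> d}.
Proof. decide equality. Defined.

Definition jet := coord -> R.

Definition upd (j : jet) (c : coord) (s : R) : jet :=
  fun d => if coord_eq_dec c d then s else j d.

Definition pd (c : coord) (F : jet -> R) (j : jet) : R :=
  Derive (fun s => F (upd j c s)) (j c).

(* Total derivatives.  They are the correct ones on differential functions of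
   order at most one, the only functions they are applied to. *)
Definition total_t (F : jet -> R) (j : jet) : R :=
  pd ct F j + j cut * pd cu F j + j cutt * pd cut F j + j cutx * pd cux F j.

Definition total_x (F : jet -> R) (j : jet) : R :=
  pd cx F j + j cux * pd cu F j + j cutx * pd cut F j + j cuxx * pd cux F j.

Definition lift3 (f : R -> R -> R -> R) : jet -> R :=
  fun j => f (j ct) (j cx) (j cu).

Definition jet_of (u : R -> R -> R) (t x : R) : jet := fun c =>
  match c with
  | ct => t
  | cx => x
  | cu => u t x
  | cut => Derive (fun s => u s x) t
  | cux => Derive (fun y => u t y) x
  | cutt => Derive_n (fun s => u s x) 2 t
  | cutx => Derive (fun s => Derive (fun y => u s y) x) t
  | cuxx => Derive_n (fun y => u t y) 2 x
  end.

Definition Lop (A B C : R -> R -> R) (j : jet) : R :=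
  j cut - A (j ct) (j cx) * j cuxx - B (j ct) (j cx) * j cux - C (j ct) (j cx) * j cu.

(* tau * d/dt + xi * d/dx + eta * d/du *)
Record operator := Operator {
  tau : R -> R -> R -> R;
  xi : R -> R -> R -> R;
  eta : R -> R -> R -> R }.

Definition charact (Q : operator) (j : jet) : R :=
  lift3 (eta Q) j - lift3 (tau Q) j * j cut - lift3 (xi Q) j * j cux.

Definition eta_t (Q : operator) (j : jet) : R :=
  total_t (lift3 (eta Q)) j - j cut * total_t (lift3 (tau Q)) j - j cux * total_t (lift3 (xi Q)) j.

Definition eta_x (Q : operator) (j : jet) : R :=
  total_x (lift3 (eta Q)) j - j cut * total_x (lift3 (tau Q)) j - j cux * total_x (lift3 (xi Q)) j.

Definition eta_tt (Q : operator) (j : jet) : R :=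
  total_t (eta_t Q) j - j cutt * total_t (lift3 (tau Q)) j - j cutx * total_t (lift3 (xi Q)) j.

Definition eta_tx (Q : operator) (j : jet) : R :=
  total_x (eta_t Q) j - j cutt * total_x (lift3 (tau Q)) j - j cutx * total_x (lift3 (xi Q)) j.

Definition eta_xx (Q : operator) (j : jet) : R :=
  total_x (eta_x Q) j - j cutx * total_x (lift3 (tau Q)) j - j cuxx * total_x (lift3 (xi Q)) j.

Definition prolong2 (Q : operator) (F : jet -> R) (j : jet) : R :=
  lift3 (tau Q) j * pd ct F j + lift3 (xi Q) j * pd cx F j + lift3 (eta Q) j * pd cu F j
  + eta_t Q j * pd cut F j + eta_x Q j * pd cux F j
  + eta_tt Q j * pd cutt F j + eta_tx Q j * pd cutx F j + eta_xx Q j * pd cuxx F j.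

(* Germ at (t0,x0,u0); "not identically zero" for (tau, xi) becomes, after
   shrinking the domain, nonvanishing at the base point. *)
Definition reduction_operator (A B C : R -> R -> R) (t0 x0 u0 : R) (Q : operator) : Prop :=
  smooth3 (tau Q) (t0, x0, u0) /\
  smooth3 (xi Q) (t0, x0, u0) /\
  smooth3 (eta Q) (t0, x0, u0) /\
  (tau Q t0 x0 u0, xi Q t0 x0 u0) <> (0, 0) /\
  locally (t0, x0, u0) (fun '(t, x, u) =>
    forall j : jet, j ct = t -> j cx = x -> j cu = u ->
      Lop A B C j = 0 ->
      charact Q j = 0 -> total_t (charact Q) j = 0 -> total_x (charact Q) j = 0 ->
      prolong2 Q (Lop A B C) j = 0).

Definition zero_tau (t0 x0 u0 : R) (Q : operator) : Prop :=
  locally (t0, x0, u0) (fun '(t, x, u) => tau Q t x u = 0).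

Definition operator_equiv (t0 x0 u0 : R) (Q Q' : operator) : Prop :=
  exists lambda : R -> R -> R -> R,
    smooth3 lambda (t0, x0, u0) /\
    lambda t0 x0 u0 <> 0 /\
    locally (t0, x0, u0) (fun '(t, x, u) =>
      tau Q' t x u = lambda t x u * tau Q t x u /\
      xi Q' t x u = lambda t x u * xi Q t x u /\
      eta Q' t x u = lambda t x u * eta Q t x u).

(* The family u = fam t x k, for (t,x,k) near (t0,x0,k0).  The base value k0 of
   the parameter is part of the data, as it is not preserved by
   reparameterization. *)
Record one_param_family := Family {
  fam_k0 : R;
  fam :> R -> R -> R -> R }.

Definition solution_family (A B C : R -> R -> R) (t0 x0 u0 : R) (F : one_param_family) : Prop :=
  smooth3 F (t0, x0, fam_k0 F) /\
  F t0 x0 (fam_k0 F) = u0 /\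
  Derive (fun k => F t0 x0 k) (fam_k0 F) <> 0 /\
  locally (t0, x0, fam_k0 F) (fun '(t, x, k) =>
    Lop A B C (jet_of (fun s y => F s y k) t x) = 0).

Definition family_equiv (t0 x0 : R) (F F' : one_param_family) : Prop :=
  exists zeta : R -> R,
    smooth1 zeta (fam_k0 F) /\
    zeta (fam_k0 F) = fam_k0 F' /\
    Derive zeta (fam_k0 F) <> 0 /\
    locally (t0, x0, fam_k0 F) (fun '(t, x, k) => F' t x (zeta k) = F t x k).

(* [F] is the family of all Q-invariant solutions: its members are Q-invariant,
   and the germ at (t1,x1) of any Q-invariant solution [u] whose value there is
   such that (t1,x1,u t1 x1) is close to (t0,x0,u0) is a member of [F], for a
   parameter value close to fam_k0. *)
Definition family_of_invariant_solutions (A B C : R -> R -> R) (t0 x0 u0 : R)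
    (Q : operator) (F : one_param_family) : Prop :=
  locally (t0, x0, fam_k0 F) (fun '(t, x, k) =>
    charact Q (jet_of (fun s y => F s y k) t x) = 0) /\
  forall eps : posreal, locally (t0, x0, u0) (fun '(t1, x1, u1) =>
    forall u : R -> R -> R,
      u t1 x1 = u1 ->
      smooth2 u (t1, x1) ->
      locally (t1, x1) (fun '(t, x) =>
        Lop A B C (jet_of u t x) = 0 /\ charact Q (jet_of u t x) = 0) ->
      exists k : R, Rabs (k - fam_k0 F) < eps /\
        locally (t1, x1) (fun '(t, x) => u t x = F t x k)).

(* Main.v *)
Require Import Defs.
From Stdlib Require Import Reals Lra Lia ClassicalEpsilon Ranalysis5.
From Coquelicot Require Import Coquelicot.
Open Scope R_scope.

(** An operator with [tau = 0] is equivalent to [d/dx + g(t,x,u) d/du], and its invariant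
    solutions satisfy [u_x = g] and hence [u_t = h] with [h = A (g_x + g g_u) + B g + C u].
    A direct computation shows that the conditional invariance criterion is equivalent to
    [h_x + g h_u = g_t + h g_u], the integrability condition of this overdetermined system.
    By the Frobenius theorem its solutions form a one-parameter family [u = F(t,x,k)]; solving
    for [k] gives a first integral [Phi(t,x,u)], so that every solution of the system is locally
    a member of the family.  Conversely, a family with [F_k <> 0] determines
    [g(t,x,u) = F_x(t,x,Phi(t,x,u))], and [F_xt = F_tx] is the integrability condition. *)

(** * Functions of three variables and the chain rule *)

(** The main obstacle is regularity: [solution_family] demands smoothness jointly in [(t, x, k)],
    whereas Picard iteration yields one differentiable function for each parameter value. The remedy
    is that every function constructed here has explicit partial derivatives: those of [Phi] are
    rational in the derivatives of [F] along [Phi], and those of the Frobenius family are [h] and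
    [g] along [F] and, in [k], an exponential of an integral, because the linearization of a scalar
    equation is solved by quadrature. Estimates give Lipschitz continuity, and induction through
    [Ck_S_intro] then gains one order at a time.

    The slope [g = eta / xi] is exactly what survives multiplication of an operator by a function,
    so operators are compared through [g], and families through [Phi]. The member through
    [(t, x, u)] has parameter [Phi t x u]; hence invariance of the members already captures all
    invariant solutions nearby, and a change of parameter is one family composed with the first
    integral of the other. *)

Ltac triangle := first
  [eapply Rle_trans; [apply Rabs_triang |] | eapply Rle_lt_trans; [apply Rabs_triang |]].

Lemma lt_Rmin (x a b : R) : x < Rmin a b -> x < a /\ x < b.
Proof. intros H. apply Rmin_Rgt_l in H. lra. Qed.

Lemma Rabs_sub_same (x : R) : Rabs (x - x) = 0.
Proof. rewrite Rminus_eq_0. apply Rabs_R0. Qed.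

Ltac box := repeat split; first [assumption | rewrite Rabs_sub_same; assumption | lra | tauto].

Ltac split_Rmin :=
  repeat match goal with H : _ < Rmin _ _ |- _ => apply lt_Rmin in H; destruct H end.

(** Balls of a product uniform space are cubes, so one radius serves all three coordinates. *)
Lemma locally3 (a b c : R) (P : R * R * R -> Prop) :
  locally (a, b, c) P <->
  exists e, 0 < e /\ forall t x u,
    Rabs (t - a) < e -> Rabs (x - b) < e -> Rabs (u - c) < e -> P (t, x, u).
Proof.
  split.
  - intros [e He]. exists e. split. apply cond_pos.
    intros t x u h1 h2 h3. apply He. box.
  - intros [e [He H]]. exists (mkposreal e He). intros [[t x] u] [[h1 h2] h3].
    apply H; assumption.
Qed.

Lemma locally2 (a b : R) (P : R * R -> Prop) :
  locally (a, b) P <->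
  exists e, 0 < e /\ forall t x, Rabs (t - a) < e -> Rabs (x - b) < e -> P (t, x).
Proof.
  split.
  - intros [e He]. exists e. split. apply cond_pos.
    intros t x h1 h2. apply He. split; assumption.
  - intros [e [He H]]. exists (mkposreal e He). intros [t x] [h1 h2].
    apply H; assumption.
Qed.

Lemma locally1 (a : R) (P : R -> Prop) :
  locally a P <-> exists e, 0 < e /\ forall t, Rabs (t - a) < e -> P t.
Proof.
  split.
  - intros [e He]. exists e. split. apply cond_pos. intros t h1. apply He. exact h1.
  - intros [e [He H]]. exists (mkposreal e He). intros t h1. apply H; assumption.
Qed.

Lemma Rabs_shift (x y z e : R) : Rabs (x - y) < e - Rabs (y - z) -> Rabs (x - z) < e.
Proof.
  intros H. replace (x - z) with ((x - y) + (y - z)) by ring.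
  triangle; lra.
Qed.

(** A predicate on triples, hence directly a domain for [Ck]. Having a single radius, boxes with a
    common centre are nested, and shrinking a germ amounts to a minimum of reals. *)
Definition Box (a b c e : R) : R * R * R -> Prop :=
  fun '(t, x, u) => Rabs (t - a) < e /\ Rabs (x - b) < e /\ Rabs (u - c) < e.

Lemma open_Box (a b c e : R) : open (Box a b c e).
Proof.
  intros [[t x] u] [h1 [h2 h3]]. apply locally3.
  pose (m := Rmin (e - Rabs (t - a)) (Rmin (e - Rabs (x - b)) (e - Rabs (u - c)))).
  exists m.
  assert (K1 : m <= e - Rabs (t - a)) by apply Rmin_l.
  assert (K2 : m <= e - Rabs (x - b)) by (eapply Rle_trans; [apply Rmin_r | apply Rmin_l]).
  assert (K3 : m <= e - Rabs (u - c)) by (eapply Rle_trans; [apply Rmin_r | apply Rmin_r]).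
  split. unfold m. repeat apply Rmin_glb_lt; lra.
  intros t' x' u' k1 k2 k3. repeat split.
  - apply (Rabs_shift _ t); lra.
  - apply (Rabs_shift _ x); lra.
  - apply (Rabs_shift _ u); lra.
Qed.

Lemma Box_center (a b c e : R) : 0 < e -> Box a b c e (a, b, c).
Proof. intros He. repeat split; rewrite Rminus_eq_0, Rabs_R0; exact He. Qed.

Lemma Box_mono (a b c e e' : R) p : e <= e' -> Box a b c e p -> Box a b c e' p.
Proof. destruct p as [[t x] u]. intros H [h1 [h2 h3]]. box. Qed.

Definition cont3 (f : R -> R -> R -> R) (t x u : R) : Prop :=
  continuous (fun '(t, x, u) => f t x u) (t, x, u).

Lemma cont3_eps (f : R -> R -> R -> R) (a b c : R) :
  cont3 f a b c <->
  forall eps, 0 < eps -> exists d, 0 < d /\ forall t x u,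
    Rabs (t - a) < d -> Rabs (x - b) < d -> Rabs (u - c) < d ->
    Rabs (f t x u - f a b c) < eps.
Proof.
  split.
  - intros H eps He.
    destruct (proj1 (locally3 a b c _) (H (ball (f a b c) (mkposreal eps He)) (locally_ball _ _)))
      as [d [Hd K]].
    exists d. split; [exact Hd |]. intros t x u h1 h2 h3. exact (K t x u h1 h2 h3).
  - intros H P [eps HP].
    destruct (H eps (cond_pos eps)) as [d [Hd K]].
    apply locally3. exists d. split; [exact Hd |].
    intros t x u h1 h2 h3. apply HP. exact (K t x u h1 h2 h3).
Qed.

Lemma cont3_elim {f : R -> R -> R -> R} {a b c : R} : cont3 f a b c ->
  forall eps, 0 < eps -> exists d, 0 < d /\ forall t x u,
    Rabs (t - a) < d -> Rabs (x - b) < d -> Rabs (u - c) < d ->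
    Rabs (f t x u - f a b c) < eps.
Proof. apply cont3_eps. Qed.

Lemma is_derive_eps (f : R -> R) (x l : R) :
  is_derive f x l <->
  forall eps, 0 < eps -> exists d, 0 < d /\ forall y,
    Rabs (y - x) < d -> Rabs (f y - f x - l * (y - x)) <= eps * Rabs (y - x).
Proof.
  split.
  - intros [_ H] eps He.
    destruct (H x (fun P h => h) (mkposreal eps He)) as [d Hd].
    exists d. split; [apply cond_pos |]. intros y hy.
    specialize (Hd y hy).
    unfold norm, minus, scal, plus, opp in Hd; simpl in Hd.
    unfold abs, mult in Hd; simpl in Hd.
    replace (f y - f x - l * (y - x)) with (f y + - f x + - ((y + - x) * l)) by ring.
    exact Hd.
  - intros H. split; [apply is_linear_scal_l |].
    (* [is_derive] quantifies over all limits of the neighbourhood filter of [x]; in [R] the limit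
       is unique. *)
    intros x' Hx'. assert (x' = x) as ->.
    { symmetry. apply (is_filter_lim_locally_unique _ _ Hx'). }
    intros eps. destruct (H eps (cond_pos eps)) as [d [Hd K]].
    exists (mkposreal d Hd). intros y hy. specialize (K y hy).
    unfold norm, minus, scal, plus, opp; simpl. unfold abs, mult; simpl.
    replace (f y + - f x + - ((y + - x) * l)) with (f y - f x - l * (y - x)) by ring.
    exact K.
Qed.

(** A quadratic remainder is the form in which Taylor estimates deliver derivatives below. [K] may
    have any sign, and [Rabs K + 1] is a positive replacement for it. *)
Lemma is_derive_quad (f : R -> R) (x l K d : R) :
  0 < d -> (forall y, Rabs (y - x) < d ->
    Rabs (f y - f x - l * (y - x)) <= K * (Rabs (y - x) * Rabs (y - x))) ->
  is_derive f x l.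
Proof.
  intros Hd H. apply is_derive_eps. intros eps He.
  assert (HK : 0 < Rabs K + 1) by (pose proof (Rabs_pos K); lra).
  exists (Rmin d (eps / (Rabs K + 1))). split.
  - apply Rmin_glb_lt; [exact Hd |]. apply Rdiv_lt_0_compat; assumption.
  - intros y hy.
    assert (h1 : Rabs (y - x) < d) by (eapply Rlt_le_trans; [exact hy | apply Rmin_l]).
    assert (h2 : Rabs (y - x) < eps / (Rabs K + 1))
      by (eapply Rlt_le_trans; [exact hy | apply Rmin_r]).
    eapply Rle_trans; [apply H; exact h1 |].
    rewrite <- Rmult_assoc. apply Rmult_le_compat_r; [apply Rabs_pos |].
    apply Rmult_lt_compat_r with (r := Rabs K + 1) in h2; [| exact HK].
    unfold Rdiv in h2. rewrite Rmult_assoc, Rinv_l, Rmult_1_r in h2 by lra.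
    pose proof (Rle_abs K). pose proof (Rabs_pos (y - x)). nra.
Qed.

Lemma mvt1 (f : R -> R) (a b : R) :
  (forall x, Rmin a b <= x <= Rmax a b -> ex_derive f x) ->
  exists c, Rmin a b <= c <= Rmax a b /\ f b - f a = Derive f c * (b - a).
Proof.
  intros H. apply MVT_gen.
  - intros x Hx. apply Derive_correct, H. lra.
  - intros x Hx. apply continuity_pt_filterlim, (ex_derive_continuous f x), H, Hx.
Qed.

Lemma between_abs (a b c : R) :
  Rmin a b <= c <= Rmax a b -> Rabs (c - a) <= Rabs (b - a).
Proof.
  unfold Rmin, Rmax. destruct (Rle_dec a b); intros; unfold Rabs;
  repeat destruct Rcase_abs; lra.
Qed.

Lemma between_ball (a b c o e : R) :
  Rabs (a - o) < e -> Rabs (b - o) < e -> Rmin a b <= c <= Rmax a b -> Rabs (c - o) < e.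
Proof.
  intros h1 h2. apply Rabs_def2 in h1. apply Rabs_def2 in h2.
  unfold Rmin, Rmax. destruct (Rle_dec a b); intros; apply Rabs_def1; lra.
Qed.

Definition dt (f : R -> R -> R -> R) (t x u : R) : R := Derive (fun s => f s x u) t.
Definition dx (f : R -> R -> R -> R) (t x u : R) : R := Derive (fun s => f t s u) x.
Definition du (f : R -> R -> R -> R) (t x u : R) : R := Derive (fun s => f t x s) u.

Definition ex_d3 (f : R -> R -> R -> R) (t x u : R) : Prop :=
  ex_derive (fun s => f s x u) t /\ ex_derive (fun s => f t s u) x /\
  ex_derive (fun s => f t x s) u.

(** The increment telescopes along three edges parallel to the axes: [u] moves first, then [x], then
    [t]. The mean value theorem on each edge uses partial derivatives alone, and the intermediate
    points stay in the box. *)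
Lemma mvt3 (f : R -> R -> R -> R) (a b c e : R) :
  (forall t x u, Box a b c e (t, x, u) -> ex_d3 f t x u) ->
  forall t x u t' x' u', Box a b c e (t, x, u) -> Box a b c e (t', x', u') ->
  exists p q r,
    (Box a b c e (p, x', u') /\ Rabs (p - t) <= Rabs (t' - t)) /\
    (Box a b c e (t, q, u') /\ Rabs (q - x) <= Rabs (x' - x)) /\
    (Box a b c e (t, x, r) /\ Rabs (r - u) <= Rabs (u' - u)) /\
    f t' x' u' - f t x u =
      dt f p x' u' * (t' - t) + dx f t q u' * (x' - x) + du f t x r * (u' - u).
Proof.
  intros H t x u t' x' u' (h1 & h2 & h3) (k1 & k2 & k3).
  destruct (mvt1 (fun s => f s x' u') t t') as [p [Hp Ep]].
  { intros s Hs. refine (proj1 (H s x' u' _)). repeat split; try assumption.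
    apply (between_ball t t'); assumption. }
  destruct (mvt1 (fun s => f t s u') x x') as [q [Hq Eq]].
  { intros s Hs. refine (proj1 (proj2 (H t s u' _))). repeat split; try assumption.
    apply (between_ball x x'); assumption. }
  destruct (mvt1 (fun s => f t x s) u u') as [r [Hr Er]].
  { intros s Hs. refine (proj2 (proj2 (H t x s _))). repeat split; try assumption.
    apply (between_ball u u'); assumption. }
  exists p, q, r. repeat split; try assumption; try (apply between_abs; assumption).
  - apply (between_ball t t'); assumption.
  - apply (between_ball x x'); assumption.
  - apply (between_ball u u'); assumption.
  - unfold dt, dx, du. rewrite <- Ep, <- Eq, <- Er. ring.
Qed.

(** Partial derivatives continuous at a point give total differentiability there: in a small box the
    three mean-value slopes differ from those at the centre by at most [eps]. *)
Lemma diff3 (f : R -> R -> R -> R) (a b c e : R) :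
  0 < e -> (forall t x u, Box a b c e (t, x, u) -> ex_d3 f t x u) ->
  cont3 (dt f) a b c -> cont3 (dx f) a b c -> cont3 (du f) a b c ->
  forall eps, 0 < eps -> exists d, 0 < d /\ forall t x u, Box a b c d (t, x, u) ->
    Rabs (f t x u - f a b c - (dt f a b c * (t - a) + dx f a b c * (x - b) + du f a b c * (u - c)))
    <= eps * (Rabs (t - a) + Rabs (x - b) + Rabs (u - c)).
Proof.
  intros He H C1 C2 C3 eps Heps.
  destruct (cont3_elim C1 eps Heps) as [d1 [P1 K1]].
  destruct (cont3_elim C2 eps Heps) as [d2 [P2 K2]].
  destruct (cont3_elim C3 eps Heps) as [d3 [P3 K3]].
  pose (d := Rmin (Rmin d1 d2) (Rmin d3 e)).
  assert (Q1 : d <= d1) by (unfold d; eapply Rle_trans; apply Rmin_l).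
  assert (Q2 : d <= d2) by (unfold d; eapply Rle_trans; [apply Rmin_l | apply Rmin_r]).
  assert (Q3 : d <= d3) by (unfold d; eapply Rle_trans; [apply Rmin_r | apply Rmin_l]).
  assert (Q4 : d <= e) by (unfold d; eapply Rle_trans; apply Rmin_r).
  assert (Hd : 0 < d) by (unfold d; repeat apply Rmin_glb_lt; assumption).
  exists d. split; [exact Hd |]. intros t x u B.
  destruct (mvt3 f a b c d) with (t := a) (x := b) (u := c) (t' := t) (x' := x) (u' := u)
    as (p & q & r & [B1 _] & [B2 _] & [B3 _] & E).
  { intros; apply H. eapply Box_mono; eassumption. }
  { apply Box_center, Hd. }
  { exact B. }
  rewrite E.
  destruct B1 as (b1 & b2 & b3). destruct B2 as (c1 & c2 & c3). destruct B3 as (e1 & e2 & e3).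
  assert (T1 : Rabs (dt f p x u - dt f a b c) < eps) by (apply K1; lra).
  assert (T2 : Rabs (dx f a q u - dx f a b c) < eps) by (apply K2; lra).
  assert (T3 : Rabs (du f a b r - du f a b c) < eps) by (apply K3; lra).
  replace (_ - _) with ((dt f p x u - dt f a b c) * (t - a) + (dx f a q u - dx f a b c) * (x - b)
    + (du f a b r - du f a b c) * (u - c)) by ring.
  triangle.
  eapply Rle_trans; [apply Rplus_le_compat_r, Rabs_triang |].
  rewrite !Rabs_mult, !Rmult_plus_distr_l.
  repeat apply Rplus_le_compat; apply Rmult_le_compat_r; try apply Rabs_pos; lra.
Qed.

Lemma is_derive_Lip (f : R -> R) (x l : R) :
  is_derive f x l -> exists d, 0 < d /\ forall y, Rabs (y - x) < d ->
    Rabs (f y - f x) <= (Rabs l + 1) * Rabs (y - x).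
Proof.
  intros H. destruct (proj1 (is_derive_eps _ _ _) H 1 Rlt_0_1) as [d [Hd K]].
  exists d; split; [exact Hd |]. intros y hy. specialize (K y hy).
  replace (f y - f x) with ((f y - f x - l * (y - x)) + l * (y - x)) by ring.
  triangle. rewrite Rabs_mult. lra.
Qed.

(** The error splits into the remainder of [f] along the curve and the gradient applied to the
    remainders of [a], [b], [c]; each part receives [eps / 2]. *)
Lemma chain3 (f : R -> R -> R -> R) (a b c : R -> R) (s la lb lc e : R) :
  0 < e -> (forall t x u, Box (a s) (b s) (c s) e (t, x, u) -> ex_d3 f t x u) ->
  cont3 (dt f) (a s) (b s) (c s) -> cont3 (dx f) (a s) (b s) (c s) ->
  cont3 (du f) (a s) (b s) (c s) ->
  is_derive a s la -> is_derive b s lb -> is_derive c s lc ->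
  is_derive (fun s => f (a s) (b s) (c s)) s
    (dt f (a s) (b s) (c s) * la + dx f (a s) (b s) (c s) * lb + du f (a s) (b s) (c s) * lc).
Proof.
  intros He H C1 C2 C3 Da Db Dc. apply is_derive_eps. intros eps Heps.
  set (ft := dt f (a s) (b s) (c s)). set (fx := dx f (a s) (b s) (c s)).
  set (fu := du f (a s) (b s) (c s)).
  (* [M] is a Lipschitz constant of the curve near [s], which turns the remainder of [f] into a
     multiple of [y - s]; [N] exceeds the sum of the absolute partial derivatives and is positive,
     so it can be divided by. *)
  pose (M := (Rabs la + 1) + (Rabs lb + 1) + (Rabs lc + 1)).
  pose (N := Rabs ft + Rabs fx + Rabs fu + 1).
  pose proof (Rabs_pos la). pose proof (Rabs_pos lb). pose proof (Rabs_pos lc).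
  pose proof (Rabs_pos ft). pose proof (Rabs_pos fx). pose proof (Rabs_pos fu).
  assert (HM : 0 < M) by (unfold M; lra). assert (HN : 0 < N) by (unfold N; lra).
  destruct (diff3 f _ _ _ e He H C1 C2 C3 (eps / (2 * M))) as [d0 [P0 K0]].
  { apply Rdiv_lt_0_compat; lra. }
  destruct (is_derive_Lip _ _ _ Da) as [d1 [P1 K1]].
  destruct (is_derive_Lip _ _ _ Db) as [d2 [P2 K2]].
  destruct (is_derive_Lip _ _ _ Dc) as [d3 [P3 K3]].
  assert (He2 : 0 < eps / (2 * N)) by (apply Rdiv_lt_0_compat; lra).
  destruct (proj1 (is_derive_eps _ _ _) Da _ He2) as [d4 [P4 K4]].
  destruct (proj1 (is_derive_eps _ _ _) Db _ He2) as [d5 [P5 K5]].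
  destruct (proj1 (is_derive_eps _ _ _) Dc _ He2) as [d6 [P6 K6]].
  pose (d := Rmin (d0 / M) (Rmin (Rmin d1 (Rmin d2 d3)) (Rmin d4 (Rmin d5 d6)))).
  assert (Hd : 0 < d).
  { unfold d; repeat apply Rmin_glb_lt; try assumption. apply Rdiv_lt_0_compat; lra. }
  exists d. split; [exact Hd |]. intros y hy.
  assert (Hy : Rabs (y - s) < d0 / M /\ Rabs (y - s) < d1 /\ Rabs (y - s) < d2 /\ Rabs (y - s) < d3
    /\ Rabs (y - s) < d4 /\ Rabs (y - s) < d5 /\ Rabs (y - s) < d6).
  { unfold d in hy.
    apply lt_Rmin in hy. destruct hy as [y0 hy]. apply lt_Rmin in hy. destruct hy as [hy hz].
    apply lt_Rmin in hy. destruct hy as [y1 hy]. apply lt_Rmin in hy. destruct hy as [y2 y3].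
    apply lt_Rmin in hz. destruct hz as [y4 hz]. apply lt_Rmin in hz. destruct hz as [y5 y6].
    box. }
  destruct Hy as (y0 & y1 & y2 & y3 & y4 & y5 & y6).
  specialize (K1 y y1). specialize (K2 y y2). specialize (K3 y y3).
  specialize (K4 y y4). specialize (K5 y y5). specialize (K6 y y6).
  set (D := Rabs (y - s)) in *. assert (HD : 0 <= D) by apply Rabs_pos.
  assert (y0' : M * D < d0).
  { apply Rmult_lt_compat_r with (r := M) in y0; [| exact HM].
    unfold Rdiv in y0. rewrite Rmult_assoc, Rinv_l in y0 by lra. lra. }
  assert (S : Rabs (a y - a s) + Rabs (b y - b s) + Rabs (c y - c s) <= M * D).
  { unfold M. lra. }
  pose proof (Rabs_pos (a y - a s)). pose proof (Rabs_pos (b y - b s)).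
  pose proof (Rabs_pos (c y - c s)).
  assert (B : Box (a s) (b s) (c s) d0 (a y, b y, c y)) by (box).
  specialize (K0 _ _ _ B). fold ft fx fu in K0.
  replace (f (a y) (b y) (c y) - f (a s) (b s) (c s) - (ft * la + fx * lb + fu * lc) * (y - s))
    with ((f (a y) (b y) (c y) - f (a s) (b s) (c s) -
       (ft * (a y - a s) + fx * (b y - b s) + fu * (c y - c s)))
       + (ft * (a y - a s - la * (y - s)) + fx * (b y - b s - lb * (y - s))
          + fu * (c y - c s - lc * (y - s)))) by ring.
  triangle.
  apply Rle_trans with (eps / 2 * D + eps / 2 * D); [| lra]. apply Rplus_le_compat.
  - eapply Rle_trans; [exact K0 |].
    apply Rle_trans with (eps / (2 * M) * (M * D)).
    + apply Rmult_le_compat_l; [| exact S]. left; apply Rdiv_lt_0_compat; lra.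
    + right. field. lra.
  - triangle.
    eapply Rle_trans; [apply Rplus_le_compat_r, Rabs_triang |].
    rewrite !Rabs_mult.
    apply Rle_trans with (N * (eps / (2 * N) * D)); [| right; field; lra].
    assert (0 <= eps / (2 * N) * D) by (apply Rmult_le_pos; lra).
    unfold N at 1. rewrite !Rmult_plus_distr_r.
    apply Rle_trans with (Rabs ft * (eps / (2 * N) * D) + Rabs fx * (eps / (2 * N) * D)
      + Rabs fu * (eps / (2 * N) * D)); [| lra].
    repeat apply Rplus_le_compat; apply Rmult_le_compat_l; try apply Rabs_pos; assumption.
Qed.

(** * Calculus of the classes Ck *)

Lemma open3 (D : R * R * R -> Prop) (t x u : R) :
  open D -> D (t, x, u) ->
  exists e, 0 < e /\ forall t' x' u', Box t x u e (t', x', u') -> D (t', x', u').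
Proof.
  intros HD H. destruct (proj1 (locally3 t x u D) (HD _ H)) as [e [He K]].
  exists e. split; [exact He |]. intros t' x' u' (h1 & h2 & h3). apply K; assumption.
Qed.

Lemma open3_slices (D : R * R * R -> Prop) (t x u : R) :
  open D -> D (t, x, u) ->
  locally t (fun s => D (s, x, u)) /\ locally x (fun s => D (t, s, u)) /\
  locally u (fun s => D (t, x, s)).
Proof.
  intros HD H. destruct (open3 D t x u HD H) as [e [He K]].
  repeat split; apply locally1; exists e; (split; [exact He |]); intros s hs; apply K;
    repeat split; try assumption; rewrite Rminus_eq_0, Rabs_R0; exact He.
Qed.

Definition is_d3 (f ft fx fu : R -> R -> R -> R) (t x u : R) : Prop :=
  is_derive (fun s => f s x u) t (ft t x u) /\
  is_derive (fun s => f t s u) x (fx t x u) /\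
  is_derive (fun s => f t x s) u (fu t x u).

Lemma ex_d3_is_d3 f t x u : ex_d3 f t x u -> is_d3 f (dt f) (dx f) (du f) t x u.
Proof. intros (h1 & h2 & h3). split; [| split]; apply Derive_correct; assumption. Qed.

Lemma is_d3_unique {f ft fx fu : R -> R -> R -> R} {t x u : R} : is_d3 f ft fx fu t x u ->
  dt f t x u = ft t x u /\ dx f t x u = fx t x u /\ du f t x u = fu t x u.
Proof. intros (h1 & h2 & h3). split; [| split]; apply is_derive_unique; assumption. Qed.

Section CkCalculus.

Variable D : R * R * R -> Prop.
Hypothesis HD : open D.

Lemma Ck_cont n f t x u : Ck n D f -> D (t, x, u) -> cont3 f t x u.
Proof. destruct n; intros [H _]; apply H. Qed.

Lemma Ck_ex n f t x u : Ck (S n) D f -> D (t, x, u) -> ex_d3 f t x u.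
Proof. intros (_ & H & _). apply H. Qed.

Lemma Ck_dt n f : Ck (S n) D f -> Ck n D (dt f).
Proof. intros (_ & _ & H & _). exact H. Qed.

Lemma Ck_dx n f : Ck (S n) D f -> Ck n D (dx f).
Proof. intros (_ & _ & _ & H & _). exact H. Qed.

Lemma Ck_du n f : Ck (S n) D f -> Ck n D (du f).
Proof. intros (_ & _ & _ & _ & H). exact H. Qed.

Lemma Ck_0 f : (forall t x u, D (t, x, u) -> cont3 f t x u) -> Ck 0 D f.
Proof. intros H. split; [exact H | exact I]. Qed.

Lemma Ck_pred n f : Ck (S n) D f -> Ck n D f.
Proof.
  revert f; induction n as [| n IH]; intros f H.
  - apply Ck_0. apply H.
  - destruct H as (h0 & h1 & h2 & h3 & h4).
    exact (conj h0 (conj h1 (conj (IH _ h2) (conj (IH _ h3) (IH _ h4))))).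
Qed.

(** Openness of [D] makes equality on [D] an equality of germs at each of its points, so all
    derivatives evaluated there agree. *)
Lemma Ck_ext n f g :
  (forall t x u, D (t, x, u) -> f t x u = g t x u) -> Ck n D f -> Ck n D g.
Proof.
  revert f g; induction n as [| n IH]; intros f g E H;
  assert (C : forall t x u, D (t, x, u) -> cont3 g t x u).
  1, 3: intros t x u d; apply (continuous_ext_loc _ (fun '(t, x, u) => f t x u));
    [apply (filter_imp D); [intros [[t' x'] u'] d'; apply E, d' | apply HD, d]
    | apply H, d].
  - apply Ck_0, C.
  - destruct H as (h0 & h1 & h2 & h3 & h4).
    assert (L : forall t x u, D (t, x, u) ->
       locally t (fun s => f s x u = g s x u) /\ locally x (fun s => f t s u = g t s u) /\
       locally u (fun s => f t x s = g t x s)).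
    { intros t x u d. destruct (open3_slices D t x u HD d) as (l1 & l2 & l3).
      refine (conj (filter_imp _ _ _ l1) (conj (filter_imp _ _ _ l2) (filter_imp _ _ _ l3)));
      intros s; apply E. }
    refine (conj C (conj _ (conj _ (conj _ _)))).
    + intros t x u d. destruct (L t x u d) as (l1 & l2 & l3).
      destruct (h1 t x u d) as (e1 & e2 & e3).
      exact (conj (ex_derive_ext_loc _ _ _ l1 e1)
        (conj (ex_derive_ext_loc _ _ _ l2 e2) (ex_derive_ext_loc _ _ _ l3 e3))).
    + eapply IH; [| exact h2]. intros t x u d. apply Derive_ext_loc. apply (L t x u d).
    + eapply IH; [| exact h3]. intros t x u d. apply Derive_ext_loc. apply (L t x u d).
    + eapply IH; [| exact h4]. intros t x u d. apply Derive_ext_loc. apply (L t x u d).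
Qed.

(** The entry point for explicit derivatives: when [ft], [fx], [fu] are written in terms of [f]
    itself, induction on [n] yields all orders. *)
Lemma Ck_S_intro n f ft fx fu :
  Ck n D f -> (forall t x u, D (t, x, u) -> is_d3 f ft fx fu t x u) ->
  Ck n D ft -> Ck n D fx -> Ck n D fu -> Ck (S n) D f.
Proof.
  intros H0 Hd H1 H2 H3.
  refine (conj _ (conj _ (conj _ (conj _ _)))).
  - intros t x u. apply (Ck_cont n); assumption.
  - intros t x u d. destruct (Hd t x u d) as (e1 & e2 & e3).
    split; [exists (ft t x u) | split; [exists (fx t x u) | exists (fu t x u)]]; assumption.
  - eapply Ck_ext; [| exact H1]. intros t x u d. symmetry. apply is_derive_unique, (Hd t x u d).
  - eapply Ck_ext; [| exact H2]. intros t x u d. symmetry. apply is_derive_unique, (Hd t x u d).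
  - eapply Ck_ext; [| exact H3]. intros t x u d. symmetry. apply is_derive_unique, (Hd t x u d).
Qed.

Lemma Ck_is_d3 n f t x u :
  Ck (S n) D f -> D (t, x, u) -> is_d3 f (dt f) (dx f) (du f) t x u.
Proof. intros H d. apply ex_d3_is_d3, (Ck_ex n); assumption. Qed.

Lemma Ck_const n c : Ck n D (fun _ _ _ => c).
Proof.
  revert c; induction n as [| n IH]; intros c.
  - apply Ck_0. intros t x u _. apply (continuous_ext (fun _ => c)).
    intros [[? ?] ?]; reflexivity. apply continuous_const.
  - apply (Ck_S_intro n _ (fun _ _ _ => 0) (fun _ _ _ => 0) (fun _ _ _ => 0)); try apply IH.
    intros t x u _. split; [| split]; apply @is_derive_const.
Qed.

Ltac Ck_coordinate n ft fx fu :=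
  induction n as [| n IHn];
  [ apply Ck_0; intros t x u _; apply cont3_eps; intros e He; exists e; auto
  | apply (Ck_S_intro n _ ft fx fu IHn); try apply Ck_const;
    intros t x u _; split; [| split]; first [apply @is_derive_const | apply @is_derive_id]].

Lemma Ck_t n : Ck n D (fun t _ _ => t).
Proof. Ck_coordinate n (fun _ _ _ : R => 1) (fun _ _ _ : R => 0) (fun _ _ _ : R => 0). Qed.

Lemma Ck_x n : Ck n D (fun _ x _ => x).
Proof. Ck_coordinate n (fun _ _ _ : R => 0) (fun _ _ _ : R => 1) (fun _ _ _ : R => 0). Qed.

Lemma Ck_u n : Ck n D (fun _ _ u => u).
Proof. Ck_coordinate n (fun _ _ _ : R => 0) (fun _ _ _ : R => 0) (fun _ _ _ : R => 1). Qed.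

Lemma cont3_op (op : R -> R -> R) f g t x u :
  (forall a b, continuous (fun p : R * R => op (fst p) (snd p)) (a, b)) ->
  cont3 f t x u -> cont3 g t x u -> cont3 (fun t x u => op (f t x u) (g t x u)) t x u.
Proof.
  intros Hop Hf Hg.
  apply (continuous_ext (fun p => op ((fun '(t, x, u) => f t x u) p) ((fun '(t, x, u) => g t x u) p))).
  { intros [[? ?] ?]; reflexivity. }
  apply (continuous_comp_2 (fun '(t, x, u) => f t x u) (fun '(t, x, u) => g t x u) op).
  - exact Hf.
  - exact Hg.
  - apply Hop.
Qed.

Lemma Ck_plus n f g : Ck n D f -> Ck n D g -> Ck n D (fun t x u => f t x u + g t x u).
Proof.
  revert f g; induction n as [| n IH]; intros f g Hf Hg.
  - apply Ck_0. intros t x u d. apply (cont3_op Rplus).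
    + intros a b. apply (continuous_plus (V := R_NormedModule)); [apply continuous_fst | apply continuous_snd].
    + apply Hf, d.
    + apply Hg, d.
  - apply (Ck_S_intro n _ (fun t x u => dt f t x u + dt g t x u)
      (fun t x u => dx f t x u + dx g t x u) (fun t x u => du f t x u + du g t x u)).
    + apply IH; apply Ck_pred; assumption.
    + intros t x u d.
      destruct (Ck_is_d3 n f t x u Hf d) as (f1 & f2 & f3).
      destruct (Ck_is_d3 n g t x u Hg d) as (g1 & g2 & g3).
      exact (conj (is_derive_plus (V := R_NormedModule) _ _ _ _ _ f1 g1)
        (conj (is_derive_plus (V := R_NormedModule) _ _ _ _ _ f2 g2)
          (is_derive_plus (V := R_NormedModule) _ _ _ _ _ f3 g3))).
    + apply IH; apply Ck_dt; assumption.
    + apply IH; apply Ck_dx; assumption.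
    + apply IH; apply Ck_du; assumption.
Qed.

Lemma Ck_mult n f g : Ck n D f -> Ck n D g -> Ck n D (fun t x u => f t x u * g t x u).
Proof.
  revert f g; induction n as [| n IH]; intros f g Hf Hg.
  - apply Ck_0. intros t x u d. apply (cont3_op Rmult).
    + intros a b. apply (continuous_mult (K := R_AbsRing)); [apply continuous_fst | apply continuous_snd].
    + apply Hf, d.
    + apply Hg, d.
  - apply (Ck_S_intro n _ (fun t x u => dt f t x u * g t x u + f t x u * dt g t x u)
      (fun t x u => dx f t x u * g t x u + f t x u * dx g t x u)
      (fun t x u => du f t x u * g t x u + f t x u * du g t x u)).
    + apply IH; apply Ck_pred; assumption.
    + intros t x u d.
      destruct (Ck_is_d3 n f t x u Hf d) as (f1 & f2 & f3).
      destruct (Ck_is_d3 n g t x u Hg d) as (g1 & g2 & g3).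
      exact (conj (is_derive_mult _ _ _ _ _ f1 g1 Rmult_comm)
        (conj (is_derive_mult _ _ _ _ _ f2 g2 Rmult_comm)
          (is_derive_mult _ _ _ _ _ f3 g3 Rmult_comm))).
    + apply Ck_plus; apply IH; first [apply Ck_dt; assumption | apply Ck_pred; assumption].
    + apply Ck_plus; apply IH; first [apply Ck_dx; assumption | apply Ck_pred; assumption].
    + apply Ck_plus; apply IH; first [apply Ck_du; assumption | apply Ck_pred; assumption].
Qed.

Lemma Ck_opp n f : Ck n D f -> Ck n D (fun t x u => - f t x u).
Proof.
  intros H. apply (Ck_ext n (fun t x u => (-1) * f t x u)).
  - intros; ring.
  - apply Ck_mult; [apply Ck_const | exact H].
Qed.

End CkCalculus.

(** * Restriction, composition, exponential and reciprocal *)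

Lemma Ck_mono n (D D' : R * R * R -> Prop) f :
  (forall p, D p -> D' p) -> Ck n D' f -> Ck n D f.
Proof.
  intros S. revert f; induction n as [| n IH]; intros f H.
  - apply Ck_0. intros t x u d. apply H, S, d.
  - destruct H as (h0 & h1 & h2 & h3 & h4).
    refine (conj _ (conj _ (conj _ (conj _ _)))).
    + intros t x u d. apply h0, S, d.
    + intros t x u d. apply h1, S, d.
    + apply IH, h2.
    + apply IH, h3.
    + apply IH, h4.
Qed.

Lemma Ck_le m n D f : (m <= n)%nat -> Ck n D f -> Ck m D f.
Proof. intros H. induction H; intros K; [exact K |]. apply IHle, Ck_pred, K. Qed.

Lemma cont3_comp f a b c t x u :
  cont3 f (a t x u) (b t x u) (c t x u) -> cont3 a t x u -> cont3 b t x u -> cont3 c t x u ->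
  cont3 (fun t x u => f (a t x u) (b t x u) (c t x u)) t x u.
Proof.
  intros Hf Ha Hb Hc. apply cont3_eps. intros e He.
  destruct (cont3_elim Hf e He) as [d [Hd Kf]].
  destruct (cont3_elim Ha d Hd) as [d1 [Hd1 Ka]].
  destruct (cont3_elim Hb d Hd) as [d2 [Hd2 Kb]].
  destruct (cont3_elim Hc d Hd) as [d3 [Hd3 Kc]].
  exists (Rmin d1 (Rmin d2 d3)). split; [repeat apply Rmin_glb_lt; assumption |].
  intros t' x' u' h1 h2 h3.
  split_Rmin.
  apply Kf; [apply Ka | apply Kb | apply Kc]; tauto.
Qed.

Lemma C1_chain D f (a b c : R -> R) s la lb lc :
  open D -> Ck 1 D f -> D (a s, b s, c s) ->
  is_derive a s la -> is_derive b s lb -> is_derive c s lc ->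
  is_derive (fun s => f (a s) (b s) (c s)) s
    (dt f (a s) (b s) (c s) * la + dx f (a s) (b s) (c s) * lb + du f (a s) (b s) (c s) * lc).
Proof.
  intros HD Hf d Ha Hb Hc. destruct (open3 D _ _ _ HD d) as [e [He K]].
  apply (chain3 f a b c s la lb lc e); try assumption.
  - intros t x u B. apply (Ck_ex D 0); [exact Hf |]. apply K, B.
  - apply (Ck_cont D 0); [apply Ck_dt, Hf | exact d].
  - apply (Ck_cont D 0); [apply Ck_dx, Hf | exact d].
  - apply (Ck_cont D 0); [apply Ck_du, Hf | exact d].
Qed.

(** The induction must vary [f] together with the inner maps: the chain rule produces composites of
    [dt f], [dx f], [du f] with inner maps known to one order more than required. *)
Lemma Ck_comp n (D D' : R * R * R -> Prop) f a b c :
  open D -> open D' -> Ck n D' f -> Ck n D a -> Ck n D b -> Ck n D c ->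
  (forall t x u, D (t, x, u) -> D' (a t x u, b t x u, c t x u)) ->
  Ck n D (fun t x u => f (a t x u) (b t x u) (c t x u)).
Proof.
  intros HD HD'. revert f a b c. induction n as [| n IH]; intros f a b c Hf Ha Hb Hc HS.
  - apply Ck_0. intros t x u d. apply cont3_comp; [apply Hf, HS, d | apply Ha, d | apply Hb, d | apply Hc, d].
  - assert (Ht := Ck_dt D' n f Hf). assert (Hx := Ck_dx D' n f Hf). assert (Hu := Ck_du D' n f Hf).
    assert (Ha' := Ck_pred D n a Ha). assert (Hb' := Ck_pred D n b Hb). assert (Hc' := Ck_pred D n c Hc).
    assert (P : forall p q r p' q' r', Ck n D p -> Ck n D q -> Ck n D r ->
      Ck n D p' -> Ck n D q' -> Ck n D r' ->
      Ck n D (fun t x u => p t x u * p' t x u + q t x u * q' t x u + r t x u * r' t x u)).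
    { intros. repeat apply Ck_plus; try exact HD; apply Ck_mult; assumption. }
    assert (H1 : Ck 1 D' f) by (apply (Ck_le 1 (S n)); [lia | exact Hf]).
    apply (Ck_S_intro D HD n _
      (fun t x u => dt f (a t x u) (b t x u) (c t x u) * dt a t x u +
         dx f (a t x u) (b t x u) (c t x u) * dt b t x u + du f (a t x u) (b t x u) (c t x u) * dt c t x u)
      (fun t x u => dt f (a t x u) (b t x u) (c t x u) * dx a t x u +
         dx f (a t x u) (b t x u) (c t x u) * dx b t x u + du f (a t x u) (b t x u) (c t x u) * dx c t x u)
      (fun t x u => dt f (a t x u) (b t x u) (c t x u) * du a t x u +
         dx f (a t x u) (b t x u) (c t x u) * du b t x u + du f (a t x u) (b t x u) (c t x u) * du c t x u)).
    + apply IH; try apply Ck_pred; assumption.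
    + intros t x u d.
      destruct (Ck_is_d3 D n a t x u Ha d) as (a1 & a2 & a3).
      destruct (Ck_is_d3 D n b t x u Hb d) as (b1 & b2 & b3).
      destruct (Ck_is_d3 D n c t x u Hc d) as (c1 & c2 & c3).
      split; [| split].
      * apply (C1_chain D' f (fun s => a s x u) (fun s => b s x u) (fun s => c s x u)); auto.
      * apply (C1_chain D' f (fun s => a t s u) (fun s => b t s u) (fun s => c t s u)); auto.
      * apply (C1_chain D' f (fun s => a t x s) (fun s => b t x s) (fun s => c t x s)); auto.
    + apply P; [apply IH; auto | apply IH; auto | apply IH; auto | apply Ck_dt; assumption ..].
    + apply P; [apply IH; auto | apply IH; auto | apply IH; auto | apply Ck_dx; assumption ..].
    + apply P; [apply IH; auto | apply IH; auto | apply IH; auto | apply Ck_du; assumption ..].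
Qed.

Lemma cont3_fun1 (h : R -> R) t x u : continuous h t -> cont3 (fun t _ _ => h t) t x u.
Proof.
  intros H.
  apply (continuous_ext (fun p : R * R * R => h (fst (fst p)))).
  { intros [[? ?] ?]; reflexivity. }
  apply (continuous_comp (fun p : R * R * R => fst (fst p)) h).
  - apply (continuous_comp (fun p : R * R * R => fst p) (fun p : R * R => fst p)); apply continuous_fst.
  - exact H.
Qed.

Lemma Ck_exp n D f : open D -> Ck n D f -> Ck n D (fun t x u => exp (f t x u)).
Proof.
  intros HD Hf.
  (* A function of one variable is treated as a function of the first of three variables, so that
     [Ck_comp] applies; the other two slots are filled with [f] as dummies. *)
  assert (E : forall n, Ck n (fun _ => True) (fun t _ _ => exp t)).
  { intros m; induction m as [| m IH].
    - apply Ck_0. intros t x u _. apply cont3_fun1, (ex_derive_continuous exp). exists (exp t). apply is_derive_exp.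
    - apply (Ck_S_intro _ open_true m _ (fun t _ _ => exp t) (fun _ _ _ => 0) (fun _ _ _ => 0)).
      + exact IH.
      + intros t x u _. split; [apply is_derive_exp | split; apply @is_derive_const].
      + exact IH.
      + apply Ck_const, open_true.
      + apply Ck_const, open_true. }
  apply (Ck_comp n D (fun _ => True) (fun t _ _ => exp t) f f f); auto. apply open_true.
Qed.

Lemma open_neq0 : open (fun '((t, _, _) : R * R * R) => t <> 0).
Proof.
  intros [[t x] u] H. apply locally3. exists (Rabs t). split.
  - apply Rabs_pos_lt, H.
  - intros t' x' u' h _ _ E. rewrite E in h.
    replace (0 - t) with (- t) in h by ring. rewrite Rabs_Ropp in h. lra.
Qed.

Lemma Ck_inv n D f : open D -> Ck n D f -> (forall t x u, D (t, x, u) -> f t x u <> 0) ->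
  Ck n D (fun t x u => / f t x u).
Proof.
  intros HD Hf H0.
  assert (E : forall n, Ck n (fun '(t, _, _) => t <> 0) (fun t _ _ => / t)).
  { intros m; induction m as [| m IH].
    - apply Ck_0. intros t x u ht. apply cont3_fun1, (ex_derive_continuous Rinv).
      apply ex_derive_Reals_1. apply derivable_pt_inv. exact ht. apply derivable_pt_id.
    - apply (Ck_S_intro _ open_neq0 m _ (fun t _ _ => - (/ t * / t)) (fun _ _ _ => 0) (fun _ _ _ => 0)).
      + exact IH.
      + intros t x u ht. split; [| split; apply @is_derive_const].
        auto_derive. exact ht. field. exact ht.
      + apply Ck_opp, Ck_mult; try exact IH; apply open_neq0.
      + apply Ck_const, open_neq0.
      + apply Ck_const, open_neq0. }
  apply (Ck_comp n D (fun '(t, _, _) => t <> 0) (fun t _ _ => / t) f f f); auto. apply open_neq0.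
Qed.

Lemma Ck_div n D f g : open D -> Ck n D f -> Ck n D g ->
  (forall t x u, D (t, x, u) -> g t x u <> 0) -> Ck n D (fun t x u => f t x u / g t x u).
Proof. intros HD Hf Hg H0. apply Ck_mult; [| | apply Ck_inv]; assumption. Qed.

(** * Implicit functions *)

(** [bd1] and [bd2] are C^1 and C^2 bounds with one constant for everything. They feed the Lipschitz
    and Taylor estimates, and all later radii are chosen from this constant. *)
Definition bd1 (K : R) (f : R -> R -> R -> R) (t x u : R) : Prop :=
  ex_d3 f t x u /\ Rabs (dt f t x u) <= K /\ Rabs (dx f t x u) <= K /\ Rabs (du f t x u) <= K.

Definition bd2 (K : R) (f : R -> R -> R -> R) (t x u : R) : Prop :=
  Rabs (f t x u) <= K /\ bd1 K f t x u /\
  bd1 K (dt f) t x u /\ bd1 K (dx f) t x u /\ bd1 K (du f) t x u.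

Lemma bd1_mono K K' f t x u : K <= K' -> bd1 K f t x u -> bd1 K' f t x u.
Proof.
  intros H (h & h1 & h2 & h3). refine (conj h (conj _ (conj _ _))); lra.
Qed.

Lemma is_d3_bd1 K f ft fx fu t x u : is_d3 f ft fx fu t x u ->
  Rabs (ft t x u) <= K -> Rabs (fx t x u) <= K -> Rabs (fu t x u) <= K -> bd1 K f t x u.
Proof.
  intros H h1 h2 h3. destruct (is_d3_unique H) as (E1 & E2 & E3). destruct H as (e1 & e2 & e3).
  rewrite <- E1 in h1. rewrite <- E2 in h2. rewrite <- E3 in h3.
  exact (conj (conj (ex_intro _ _ e1) (conj (ex_intro _ _ e2) (ex_intro _ _ e3))) (conj h1 (conj h2 h3))).
Qed.

Lemma bd2_mono K K' f t x u : K <= K' -> bd2 K f t x u -> bd2 K' f t x u.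
Proof.
  intros H (h & h1 & h2 & h3 & h4).
  refine (conj _ (conj _ (conj _ (conj _ _)))); try (eapply bd1_mono; eassumption). lra.
Qed.

Lemma bd2_1 K f t x u : bd2 K f t x u -> bd1 K f t x u.
Proof. exact (fun h => proj1 (proj2 h)). Qed.

Lemma bd2_t K f t x u : bd2 K f t x u -> bd1 K (dt f) t x u.
Proof. exact (fun h => proj1 (proj2 (proj2 h))). Qed.

Lemma bd2_x K f t x u : bd2 K f t x u -> bd1 K (dx f) t x u.
Proof. exact (fun h => proj1 (proj2 (proj2 (proj2 h)))). Qed.

Lemma bd2_u K f t x u : bd2 K f t x u -> bd1 K (du f) t x u.
Proof. exact (fun h => proj2 (proj2 (proj2 (proj2 h)))). Qed.

Lemma cont3_bound f a b c : cont3 f a b c ->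
  exists K, 0 <= K /\ locally (a, b, c) (fun '(t, x, u) => Rabs (f t x u) <= K).
Proof.
  intros H. exists (Rabs (f a b c) + 1). split. pose proof (Rabs_pos (f a b c)); lra.
  apply locally3. destruct (cont3_elim H 1 Rlt_0_1) as [d [Hd K]].
  exists d. split; [exact Hd |]. intros t x u h1 h2 h3. specialize (K t x u h1 h2 h3).
  replace (f t x u) with (f a b c + (f t x u - f a b c)) by ring.
  triangle. lra.
Qed.

Lemma bd1_near D f a b c : open D -> Ck 1 D f -> D (a, b, c) ->
  exists K, 0 <= K /\ locally (a, b, c) (fun '(t, x, u) => bd1 K f t x u).
Proof.
  intros HD Hf d.
  destruct (cont3_bound (dt f) a b c) as [K1 [P1 L1]]. { apply (Ck_cont D 0); [apply Ck_dt, Hf | exact d]. }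
  destruct (cont3_bound (dx f) a b c) as [K2 [P2 L2]]. { apply (Ck_cont D 0); [apply Ck_dx, Hf | exact d]. }
  destruct (cont3_bound (du f) a b c) as [K3 [P3 L3]]. { apply (Ck_cont D 0); [apply Ck_du, Hf | exact d]. }
  exists (K1 + K2 + K3). split; [lra |].
  generalize (filter_and _ _ (HD _ d) (filter_and _ _ L1 (filter_and _ _ L2 L3))).
  apply filter_imp. intros [[t x] u] (h0 & h1 & h2 & h3).
  refine (conj (Ck_ex D 0 f t x u Hf h0) (conj _ (conj _ _))); lra.
Qed.

Lemma bd2_near D f a b c : open D -> Ck 2 D f -> D (a, b, c) ->
  exists K e, 0 <= K /\ 0 < e /\ forall t x u, Box a b c e (t, x, u) -> D (t, x, u) /\ bd2 K f t x u.
Proof.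
  intros HD Hf d.
  destruct (cont3_bound f a b c) as [K0 [P0 L0]]. { apply (Ck_cont D 2); assumption. }
  destruct (bd1_near D f a b c HD (Ck_pred D 1 f Hf) d) as [K1 [P1 L1]].
  destruct (bd1_near D (dt f) a b c HD (Ck_dt D 1 f Hf) d) as [K2 [P2 L2]].
  destruct (bd1_near D (dx f) a b c HD (Ck_dx D 1 f Hf) d) as [K3 [P3 L3]].
  destruct (bd1_near D (du f) a b c HD (Ck_du D 1 f Hf) d) as [K4 [P4 L4]].
  exists (K0 + K1 + K2 + K3 + K4).
  destruct (proj1 (locally3 a b c _)
    (filter_and _ _ (HD _ d) (filter_and _ _ L0 (filter_and _ _ L1
      (filter_and _ _ L2 (filter_and _ _ L3 L4)))))) as [e [He H]].
  exists e. split; [lra | split; [exact He |]].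
  intros t x u (h1 & h2 & h3). destruct (H t x u h1 h2 h3) as (k & k0 & k1 & k2 & k3 & k4).
  split; [exact k |]. refine (conj _ (conj _ (conj _ (conj _ _)))).
  - lra.
  - eapply bd1_mono; [| exact k1]; lra.
  - eapply bd1_mono; [| exact k2]; lra.
  - eapply bd1_mono; [| exact k3]; lra.
  - eapply bd1_mono; [| exact k4]; lra.
Qed.

Lemma lip3 a b c e K f t x u t' x' u' :
  (forall t x u, Box a b c e (t, x, u) -> bd1 K f t x u) ->
  Box a b c e (t, x, u) -> Box a b c e (t', x', u') ->
  Rabs (f t' x' u' - f t x u) <= K * (Rabs (t' - t) + Rabs (x' - x) + Rabs (u' - u)).
Proof.
  intros H B B'.
  destruct (mvt3 f a b c e (fun t x u h => proj1 (H t x u h)) t x u t' x' u' B B')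
    as (p & q & r & [B1 _] & [B2 _] & [B3 _] & ->).
  triangle.
  eapply Rle_trans; [apply Rplus_le_compat_r, Rabs_triang |].
  rewrite !Rabs_mult, !Rmult_plus_distr_l.
  repeat apply Rplus_le_compat; apply Rmult_le_compat_r; try apply Rabs_pos.
  - apply (H _ _ _ B1).
  - apply (H _ _ _ B2).
  - apply (H _ _ _ B3).
Qed.

(** In the formula of [mvt3] each slope differs from its value at [(t, x, u)] by at most [K] times
    the distance, since the first derivatives are themselves [K]-Lipschitz. The constant is cruder
    than the sharp one, but independent of the points. *)
Lemma taylor3 a b c e K f t x u t' x' u' :
  0 <= K -> (forall t x u, Box a b c e (t, x, u) -> bd2 K f t x u) ->
  Box a b c e (t, x, u) -> Box a b c e (t', x', u') ->
  Rabs (f t' x' u' - f t x u -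
     (dt f t x u * (t' - t) + dx f t x u * (x' - x) + du f t x u * (u' - u)))
  <= K * ((Rabs (t' - t) + Rabs (x' - x) + Rabs (u' - u)) * (Rabs (t' - t) + Rabs (x' - x) + Rabs (u' - u))).
Proof.
  intros HK H B B'.
  destruct (mvt3 f a b c e (fun t x u h => proj1 (proj1 (proj2 (H t x u h)))) t x u t' x' u' B B')
    as (p & q & r & [B1 e1] & [B2 e2] & [B3 e3] & ->).
  set (S := Rabs (t' - t) + Rabs (x' - x) + Rabs (u' - u)).
  pose proof (Rabs_pos (t' - t)). pose proof (Rabs_pos (x' - x)). pose proof (Rabs_pos (u' - u)).
  assert (T1 : Rabs (dt f p x' u' - dt f t x u) <= K * S).
  { eapply Rle_trans; [apply (lip3 a b c e K); [| exact B | exact B1] |].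
    - intros; apply bd2_t, H; assumption.
    - apply Rmult_le_compat_l; [exact HK |]. unfold S. lra. }
  assert (T2 : Rabs (dx f t q u' - dx f t x u) <= K * S).
  { eapply Rle_trans; [apply (lip3 a b c e K); [| exact B | exact B2] |].
    - intros; apply bd2_x, H; assumption.
    - apply Rmult_le_compat_l; [exact HK |]. rewrite Rminus_eq_0, Rabs_R0. unfold S. lra. }
  assert (T3 : Rabs (du f t x r - du f t x u) <= K * S).
  { eapply Rle_trans; [apply (lip3 a b c e K); [| exact B | exact B3] |].
    - intros; apply bd2_u, H; assumption.
    - apply Rmult_le_compat_l; [exact HK |]. rewrite !Rminus_eq_0, Rabs_R0. unfold S. lra. }
  replace (_ - _) with ((dt f p x' u' - dt f t x u) * (t' - t) + (dx f t q u' - dx f t x u) * (x' - x)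
    + (du f t x r - du f t x u) * (u' - u)) by ring.
  triangle.
  eapply Rle_trans; [apply Rplus_le_compat_r, Rabs_triang |].
  rewrite !Rabs_mult, <- Rmult_assoc. unfold S at 2. rewrite !Rmult_plus_distr_l.
  repeat apply Rplus_le_compat; apply Rmult_le_compat_r; assumption.
Qed.

(** The formulas found by differentiating the identity [F t x (Phi t x u) = u]. *)
Definition implicit_d3 (F Phi : R -> R -> R -> R) (t x u : R) : Prop :=
  is_d3 Phi (fun t x u => - dt F t x (Phi t x u) / du F t x (Phi t x u))
    (fun t x u => - dx F t x (Phi t x u) / du F t x (Phi t x u))
    (fun t x u => / du F t x (Phi t x u)) t x u.

(** The equation is solved for one real unknown, so existence comes from the intermediate value
    theorem on each line in direction [k] and uniqueness from monotonicity there. The box in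
    [(t, x, k)] is returned together with the one in [(t, x, u)], because later arguments pass
    between both sets of coordinates. *)
Lemma implicit_function (F : R -> R -> R -> R) (t0 x0 k0 u0 : R) (D : R * R * R -> Prop) :
  open D -> D (t0, x0, k0) -> (forall n, Ck n D F) -> F t0 x0 k0 = u0 ->
  du F t0 x0 k0 <> 0 ->
  exists (Phi : R -> R -> R -> R) (e b : R), 0 < e /\ 0 < b /\
    (forall p, Box t0 x0 k0 b p -> D p) /\
    (forall t x k, Box t0 x0 k0 b (t, x, k) -> du F t x k <> 0) /\
    (forall t x k k', Box t0 x0 k0 b (t, x, k) -> Box t0 x0 k0 b (t, x, k') ->
       F t x k = F t x k' -> k = k') /\
    (forall t x u, Box t0 x0 u0 e (t, x, u) ->
       Box t0 x0 k0 b (t, x, Phi t x u) /\ F t x (Phi t x u) = u) /\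
    (forall n, Ck n (Box t0 x0 u0 e) Phi) /\
    (forall t x u, Box t0 x0 u0 e (t, x, u) ->
       implicit_d3 F Phi t x u).
Proof.
  intros HD d HF E0 Hc. set (c := du F t0 x0 k0) in *.
  assert (Hc2 : 0 < c * c) by nra.
  destruct (bd2_near D F t0 x0 k0 HD (HF 2%nat) d) as (K & b1 & HK & Hb1 & HB).
  assert (Cu : cont3 (du F) t0 x0 k0) by (apply (Ck_cont D 0); [apply Ck_du, HF | exact d]).
  (* Multiplication by [c] treats both signs of the derivative at once: [c * du F] stays above
     [m = c * c / 2]. The tolerance is [Rabs c / 2], written so that the factor [Rabs c] turns it
     into [m]. *)
  assert (Hm : 0 < c * c / 2 / Rabs c).
  { apply Rdiv_lt_0_compat; [lra |]. apply Rabs_pos_lt, Hc. }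
  destruct (cont3_elim Cu _ Hm) as (b2 & Hb2 & HB2).
  pose (b := Rmin b1 b2).
  assert (Hb : 0 < b) by (apply Rmin_glb_lt; assumption).
  assert (Hbb1 : b <= b1) by apply Rmin_l. assert (Hbb2 : b <= b2) by apply Rmin_r.
  set (m := c * c / 2) in *. assert (Hm0 : 0 < m) by (unfold m; lra).
  assert (Hbd : forall t x k, Box t0 x0 k0 b (t, x, k) -> bd2 K F t x k).
  { intros t x k B. apply HB. eapply Box_mono; eassumption. }
  assert (Hdu : forall t x k, Box t0 x0 k0 b (t, x, k) -> m <= c * du F t x k).
  { intros t x k (h1 & h2 & h3). specialize (HB2 t x k). fold c in HB2.
    assert (T : Rabs (du F t x k - c) < m / Rabs c) by (apply HB2; lra).
    assert (T' : Rabs (c * (du F t x k - c)) < m).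
    { rewrite Rabs_mult. apply Rmult_lt_compat_l with (r := Rabs c) in T; [| apply Rabs_pos_lt, Hc].
      replace (Rabs c * (m / Rabs c)) with m in T; [exact T |]. field. apply Rabs_no_R0, Hc. }
    apply Rabs_def2 in T'. unfold m in *. nra. }
  assert (Hne : forall t x k, Box t0 x0 k0 b (t, x, k) -> du F t x k <> 0).
  { intros t x k B E. specialize (Hdu t x k B). rewrite E in Hdu. lra. }
  assert (Hmono : forall t x k k', Box t0 x0 k0 b (t, x, k) -> Box t0 x0 k0 b (t, x, k') ->
    exists w, m <= w /\ c * (F t x k' - F t x k) = w * (k' - k)).
  { intros t x k k' B B'.
    destruct (mvt1 (fun s => F t x s) k k') as [z [Hz Ez]].
    { intros s Hs. refine (proj2 (proj2 (proj1 (bd2_1 _ _ _ _ _ (Hbd t x s _))))). destruct B as (B1 & B2 & B3). destruct B' as (_ & _ & B3').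
      repeat split; try assumption. apply (between_ball k k'); assumption. }
    exists (c * Derive (fun s => F t x s) z). split.
    - apply (Hdu t x z). destruct B as (B1 & B2 & B3). destruct B' as (_ & _ & B3').
      repeat split; try assumption. apply (between_ball k k'); assumption.
    - rewrite Ez. ring. }
  assert (Hinj : forall t x k k', Box t0 x0 k0 b (t, x, k) -> Box t0 x0 k0 b (t, x, k') ->
       F t x k = F t x k' -> k = k').
  { intros t x k k' B B' E. destruct (Hmono t x k k' B B') as [w [Hw Ew]].
    rewrite E, Rminus_eq_0, Rmult_0_r in Ew. nra. }
  pose (hb := b / 2). assert (Hhb : 0 < hb < b) by (unfold hb; lra).
  (* Moving [k] from [k0] to [k0 + hb] or [k0 - hb] changes [c * F] by at least [m * hb]. Replacing
     [(t0, x0, u0)] by a point within [e] changes [c * (F - u)] by less than [e * N0], hence by less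
     than [m * hb], so opposite signs at the two ends persist. Halving [b] keeps both ends inside
     the box. *)
  pose (N0 := Rabs c * (2 * K + 1) + 1).
  assert (HN0 : 0 < N0).
  { unfold N0. pose proof (Rabs_pos c). nra. }
  pose (e := Rmin b (m * hb / N0)).
  assert (He : 0 < e).
  { unfold e. apply Rmin_glb_lt; [exact Hb |]. apply Rdiv_lt_0_compat; nra. }
  assert (Heb : e <= b) by apply Rmin_l.
  assert (HeN : e * N0 <= m * hb).
  { assert (h : e <= m * hb / N0) by apply Rmin_r.
    apply Rmult_le_compat_r with (r := N0) in h; [| lra].
    unfold Rdiv in h. rewrite Rmult_assoc, Rinv_l, Rmult_1_r in h by lra. exact h. }
  assert (Hcen : forall k, Rabs (k - k0) < b -> Box t0 x0 k0 b (t0, x0, k)).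
  { intros k hk. box. }
  assert (Hex : forall t x u, Box t0 x0 u0 e (t, x, u) ->
    exists k, Rabs (k - k0) < b /\ F t x k = u).
  { intros t x u (h1 & h2 & h3).
    assert (Hdiff : forall k, Rabs (k - k0) < b ->
      Rabs (c * ((F t x k - u) - (F t0 x0 k - u0))) < m * hb).
    { intros k hk.
      assert (L : Rabs (F t x k - F t0 x0 k) <= K * (Rabs (t - t0) + Rabs (x - x0) + Rabs (k - k))).
      { apply (lip3 t0 x0 k0 b K).
        - intros; apply bd2_1, Hbd; assumption.
        - apply Hcen, hk.
        - box. }
      rewrite Rabs_sub_same in L. rewrite Rabs_mult.
      assert (T : Rabs ((F t x k - u) - (F t0 x0 k - u0)) <= (2 * K + 1) * e).
      { replace ((F t x k - u) - (F t0 x0 k - u0)) with ((F t x k - F t0 x0 k) + (- (u - u0))) by ring.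
        triangle. rewrite Rabs_Ropp.
        assert (K * (Rabs (t - t0) + Rabs (x - x0) + 0) <= K * (2 * e)) by (apply Rmult_le_compat_l; lra).
        lra. }
      apply Rmult_le_compat_l with (r := Rabs c) in T; [| apply Rabs_pos].
      unfold N0 in HeN. nra. }
    destruct (IVT_interv (fun k => c * (F t x k - u)) (k0 - hb) (k0 + hb)) as [z [Hz Ez]].
    - intros s Hs. apply continuity_pt_filterlim.
      apply (ex_derive_continuous (fun k => c * (F t x k - u))).
      assert (ex_derive (fun k => F t x k) s).
      { refine (proj2 (proj2 (proj1 (bd2_1 _ _ _ _ _ (Hbd t x s _))))). repeat split; try lra. apply Rabs_def1; lra. }
      auto_derive. exact H.
    - lra.
    - assert (B1 : Rabs (k0 - hb - k0) < b) by (apply Rabs_def1; lra).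
      specialize (Hdiff _ B1). apply Rabs_def2 in Hdiff.
      destruct (Hmono t0 x0 k0 (k0 - hb)) as [w [Hw Ew]]; try apply Hcen; try assumption.
      { rewrite Rabs_sub_same; lra. }
      rewrite E0 in Ew. nra.
    - assert (B1 : Rabs (k0 + hb - k0) < b) by (apply Rabs_def1; lra).
      specialize (Hdiff _ B1). apply Rabs_def2 in Hdiff.
      destruct (Hmono t0 x0 k0 (k0 + hb)) as [w [Hw Ew]]; try apply Hcen; try assumption.
      { rewrite Rabs_sub_same; lra. }
      rewrite E0 in Ew. nra.
    - exists z. split. apply Rabs_def1; lra.
      apply Rmult_integral in Ez. destruct Ez; [contradiction | lra]. }
  (* Outside the box, [epsilon] returns an arbitrary value. *)
  pose (Phi := fun t x u => epsilon (inhabits 0) (fun k => Rabs (k - k0) < b /\ F t x k = u)).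
  assert (HPhi : forall t x u, Box t0 x0 u0 e (t, x, u) ->
    Box t0 x0 k0 b (t, x, Phi t x u) /\ F t x (Phi t x u) = u).
  { intros t x u B.
    destruct (epsilon_spec (inhabits 0) (fun k => Rabs (k - k0) < b /\ F t x k = u) (Hex t x u B))
      as [h1 h2].
    split; [| exact h2]. destruct B as (B1 & B2 & _). repeat split; try exact h1; lra. }
  (* Lipschitz constant of [Phi]: [K + 1] collects the variation of [F] in [(t, x)] and that of [u],
     and dividing by [m] inverts the lower bound on the slope in [k]. *)
  pose (N := Rabs c * (K + 1) / m).
  assert (HN : 0 <= N).
  { unfold N. apply Rmult_le_pos. apply Rmult_le_pos. apply Rabs_pos. lra. left. apply Rinv_0_lt_compat, Hm0. }
  assert (HPL : forall t x u t' x' u', Box t0 x0 u0 e (t, x, u) -> Box t0 x0 u0 e (t', x', u') ->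
    Rabs (Phi t' x' u' - Phi t x u) <= N * (Rabs (t' - t) + Rabs (x' - x) + Rabs (u' - u))).
  { intros t x u t' x' u' B B'.
    destruct (HPhi _ _ _ B) as [P1 P2]. destruct (HPhi _ _ _ B') as [P1' P2'].
    set (k := Phi t x u) in *. set (k' := Phi t' x' u') in *.
    assert (B1 : Box t0 x0 k0 b (t', x', k)).
    { destruct P1 as (_ & _ & P). destruct P1' as (Q1 & Q2 & _). box. }
    destruct (Hmono t' x' k k' B1 P1') as [w [Hw Ew]].
    assert (L : Rabs (F t' x' k - F t x k) <= K * (Rabs (t' - t) + Rabs (x' - x) + Rabs (k - k))).
    { apply (lip3 t0 x0 k0 b K); try assumption. intros; apply bd2_1, Hbd; assumption. }
    rewrite Rabs_sub_same, P2 in L. rewrite P2' in Ew.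
    assert (T : m * Rabs (k' - k) <= Rabs c * ((K + 1) * (Rabs (t' - t) + Rabs (x' - x) + Rabs (u' - u)))).
    { apply Rle_trans with (Rabs (w * (k' - k))).
      - rewrite Rabs_mult. apply Rmult_le_compat_r; [apply Rabs_pos |]. rewrite Rabs_pos_eq; lra.
      - rewrite <- Ew, Rabs_mult. apply Rmult_le_compat_l; [apply Rabs_pos |].
        replace (u' - F t' x' k) with ((u' - u) + - (F t' x' k - u)) by ring.
        triangle. rewrite Rabs_Ropp.
        pose proof (Rabs_pos (t' - t)). pose proof (Rabs_pos (x' - x)). pose proof (Rabs_pos (u' - u)).
        nra. }
    unfold N. apply Rmult_le_reg_l with m; [exact Hm0 |].
    replace (m * (Rabs c * (K + 1) / m * (Rabs (t' - t) + Rabs (x' - x) + Rabs (u' - u))))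
      with (Rabs c * ((K + 1) * (Rabs (t' - t) + Rabs (x' - x) + Rabs (u' - u)))) by (field; lra).
    exact T. }
  (* Taylor expansion of [F] at order one, solved for the increment of [Phi]; all partial
     derivatives of [Phi] are read off from it. *)
  assert (HPT : forall t x u t' x' u', Box t0 x0 u0 e (t, x, u) -> Box t0 x0 u0 e (t', x', u') ->
    Rabs (Phi t' x' u' - Phi t x u -
      ((u' - u) - dt F t x (Phi t x u) * (t' - t) - dx F t x (Phi t x u) * (x' - x)) / du F t x (Phi t x u))
    <= K * ((1 + N) * (1 + N)) / Rabs (du F t x (Phi t x u)) *
      ((Rabs (t' - t) + Rabs (x' - x) + Rabs (u' - u)) * (Rabs (t' - t) + Rabs (x' - x) + Rabs (u' - u)))).
  { intros t x u t' x' u' B B'.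
    destruct (HPhi _ _ _ B) as [P1 P2]. destruct (HPhi _ _ _ B') as [P1' P2'].
    pose proof (HPL _ _ _ _ _ _ B B') as L.
    set (k := Phi t x u) in *. set (k' := Phi t' x' u') in *.
    pose proof (taylor3 t0 x0 k0 b K F t x k t' x' k' HK Hbd P1 P1') as T.
    rewrite P2, P2' in T.
    pose proof (Hne _ _ _ P1) as Hn. pose proof (Rabs_pos_lt _ Hn) as Hn'.
    set (S := Rabs (t' - t) + Rabs (x' - x) + Rabs (u' - u)) in *.
    assert (T2 : Rabs (t' - t) + Rabs (x' - x) + Rabs (k' - k) <= (1 + N) * S).
    { unfold S in *. pose proof (Rabs_pos (u' - u)). lra. }
    assert (T3 : 0 <= Rabs (t' - t) + Rabs (x' - x) + Rabs (k' - k)).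
    { pose proof (Rabs_pos (t' - t)). pose proof (Rabs_pos (x' - x)). pose proof (Rabs_pos (k' - k)). lra. }
    replace (k' - k - (u' - u - dt F t x k * (t' - t) - dx F t x k * (x' - x)) / du F t x k)
      with (- (u' - u - (dt F t x k * (t' - t) + dx F t x k * (x' - x) + du F t x k * (k' - k))) / du F t x k)
      by (field; exact Hn).
    unfold Rdiv. rewrite Rabs_mult, Rabs_Ropp, Rabs_inv.
    replace (K * ((1 + N) * (1 + N)) * / Rabs (du F t x k) * (S * S)) with
      (K * (((1 + N) * S) * ((1 + N) * S)) * / Rabs (du F t x k)) by ring.
    apply Rmult_le_compat_r; [left; apply Rinv_0_lt_compat, Hn' |].
    eapply Rle_trans; [exact T |]. apply Rmult_le_compat_l; [exact HK |].
    apply Rmult_le_compat; assumption. }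
  assert (HPd : forall t x u, Box t0 x0 u0 e (t, x, u) ->
       implicit_d3 F Phi t x u).
  { intros t x u B. pose proof (Hne _ _ _ (proj1 (HPhi _ _ _ B))) as Hn.
    destruct (open3 _ _ _ _ (open_Box t0 x0 u0 e) B) as [r [Hr HrB]].
    split; [| split]; (apply is_derive_quad with
      (d := r) (K := K * ((1 + N) * (1 + N)) / Rabs (du F t x (Phi t x u))); [exact Hr |]);
      intros s hs;
      match goal with |- Rabs (Phi ?p ?q ?w - _ - _) <= _ =>
        assert (B' : Box t0 x0 u0 e (p, q, w)) by (apply HrB; box);
        pose proof (HPT _ _ _ _ _ _ B B') as T
      end;
      rewrite !Rabs_sub_same, ?Rplus_0_r, ?Rplus_0_l in T;
      (eapply Rle_trans; [| exact T]); right; f_equal; field; exact Hn. }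
  assert (HbD : forall p, Box t0 x0 k0 b p -> D p).
  { intros [[t x] k] B. apply HB. eapply Box_mono; eassumption. }
  exists Phi, e, b.
  refine (conj He (conj Hb (conj HbD (conj Hne (conj Hinj (conj HPhi (conj _ HPd))))))).
  assert (HO : open (Box t0 x0 u0 e)) by apply open_Box.
  (* By [HPd] the derivatives of [Phi] are rational in those of [F] along [Phi], with nonvanishing
     denominator, so order [n] of [Phi] gives order [S n]. *)
  induction n as [| n IH].
  - apply Ck_0. intros t x u B. apply cont3_eps. intros ee Hee.
    destruct (open3 _ _ _ _ HO B) as [r [Hr HrB]].
    exists (Rmin r (ee / (3 * N + 1))). split.
    { apply Rmin_glb_lt; [exact Hr |]. apply Rdiv_lt_0_compat; lra. }
    intros t' x' u' h1 h2 h3.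
    split_Rmin.
    assert (B' : Box t0 x0 u0 e (t', x', u')) by (apply HrB; box).
    eapply Rle_lt_trans; [apply HPL; assumption |].
    assert (Hq : ee / (3 * N + 1) * (3 * N + 1) = ee) by (field; lra).
    assert (0 < ee / (3 * N + 1)) by (apply Rdiv_lt_0_compat; lra).
    apply Rle_lt_trans with (N * (3 * (ee / (3 * N + 1)))); [apply Rmult_le_compat_l; lra | lra].
  - assert (HG : forall f, (Ck n D f) -> Ck n (Box t0 x0 u0 e) (fun t x u => f t x (Phi t x u))).
    { intros f Hf. apply (Ck_comp n (Box t0 x0 u0 e) D f (fun t _ _ => t) (fun _ x _ => x) Phi); try assumption.
      - apply Ck_t, HO.
      - apply Ck_x, HO.
      - intros t x u B. apply HbD, HPhi, B. }
    assert (Hd1 := HG _ (Ck_dt D n F (HF (S n)))).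
    assert (Hd2 := HG _ (Ck_dx D n F (HF (S n)))).
    assert (Hd3 := HG _ (Ck_du D n F (HF (S n)))).
    apply (Ck_S_intro _ HO n Phi _ _ _ IH HPd).
    + apply Ck_div; try assumption. apply Ck_opp; assumption.
      intros t x u B. apply Hne, HPhi, B.
    + apply Ck_div; try assumption. apply Ck_opp; assumption.
      intros t x u B. apply Hne, HPhi, B.
    + apply Ck_inv; try assumption. intros t x u B. apply Hne, HPhi, B.
Qed.

(** * Ordinary differential equations *)

Lemma between_self (s0 a s r : R) :
  Rabs (s - s0) < a -> Rmin s0 s <= r <= Rmax s0 s -> Rabs (r - s0) < a.
Proof.
  intros H. apply between_ball; [| exact H].
  rewrite Rabs_sub_same. eapply Rle_lt_trans; [apply Rabs_pos | exact H].
Qed.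

Lemma mvt_bound (D D' : R -> R) (s0 a M : R) :
  (forall s, Rabs (s - s0) < a -> is_derive D s (D' s)) ->
  (forall s, Rabs (s - s0) < a -> Rabs (D' s) <= M) ->
  forall s s', Rabs (s - s0) < a -> Rabs (s' - s0) < a -> Rabs (D s' - D s) <= M * Rabs (s' - s).
Proof.
  intros H1 H2 s s' hs hs'.
  destruct (mvt1 D s s') as [z [Hz Ez]].
  - intros r hr. exists (D' r). apply H1. apply (between_ball s s'); assumption.
  - rewrite Ez, Rabs_mult. apply Rmult_le_compat_r; [apply Rabs_pos |].
    assert (hz : Rabs (z - s0) < a) by (apply (between_ball s s'); assumption).
    rewrite (is_derive_unique _ _ _ (H1 z hz)). apply H2, hz.
Qed.

(* The smallness of [a] makes the maximum of [|D|] absorb the term [L * |D|]. *)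
Lemma gronwall (D D' : R -> R) (s0 a L e : R) :
  0 <= L -> L * a <= 1 / 2 -> 0 <= e ->
  (forall s, Rabs (s - s0) < a -> is_derive D s (D' s)) ->
  (forall s, Rabs (s - s0) < a -> Rabs (D' s) <= L * Rabs (D s) + e) ->
  forall s, Rabs (s - s0) < a -> Rabs (D s) <= 2 * (Rabs (D s0) + a * e).
Proof.
  intros HL HLa He H1 H2 s hs.
  destruct (continuity_ab_maj (fun s => Rabs (D s)) (Rmin s0 s) (Rmax s0 s)) as [m [Hm Im]].
  - apply Rminmax.
  - intros r hr. apply (continuity_pt_comp D Rabs).
    + apply continuity_pt_filterlim, (ex_derive_continuous D). exists (D' r). apply H1.
      apply (between_self s0 a s); assumption.
    + apply Rcontinuity_abs.
  - assert (Is : Rmin s0 s <= s <= Rmax s0 s) by (split; [apply Rmin_r | apply Rmax_r]).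
    specialize (Hm s Is) as Hs. cbv beta in Hs.
    assert (hm : Rabs (m - s0) < a) by (apply (between_self s0 a s); assumption).
    destruct (mvt1 D s0 m) as [z [Hz Ez]].
    { intros r hr. exists (D' r). apply H1. apply (between_self s0 a m); assumption. }
    assert (hz : Rabs (z - s0) < a) by (apply (between_self s0 a m); assumption).
    rewrite (is_derive_unique _ _ _ (H1 z hz)) in Ez.
    assert (Iz : Rmin s0 s <= z <= Rmax s0 s).
    { revert Hz Im. unfold Rmin, Rmax. repeat destruct Rle_dec; lra. }
    specialize (Hm z Iz). cbv beta in Hm. specialize (H2 z hz).
    assert (T : Rabs (D m) <= Rabs (D s0) + Rabs (D' z) * Rabs (m - s0)).
    { rewrite <- Rabs_mult, <- Ez. replace (D m) with (D s0 + (D m - D s0)) at 1 by ring. apply Rabs_triang. }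
    assert (T2 : Rabs (D' z) * Rabs (m - s0) <= (L * Rabs (D m) + e) * a).
    { apply Rmult_le_compat; try apply Rabs_pos; [| lra].
      eapply Rle_trans; [exact H2 |]. apply Rplus_le_compat_r, Rmult_le_compat_l; assumption. }
    pose proof (Rabs_pos (D m)). nra.
Qed.

Lemma cont1_eps (f : R -> R) (a : R) :
  continuous f a <->
  forall eps, 0 < eps -> exists d, 0 < d /\ forall t, Rabs (t - a) < d -> Rabs (f t - f a) < eps.
Proof.
  split.
  - intros H eps He.
    exact (proj1 (locally1 a _) (H (ball (f a) (mkposreal eps He)) (locally_ball _ _))).
  - intros H P [eps HP]. destruct (H eps (cond_pos eps)) as [d [Hd K]].
    apply locally1. exists d. split; [exact Hd |]. intros t h. apply HP. exact (K t h).
Qed.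

(** Passes to the limit in an estimate proved for every Picard iterate with a geometrically small
    error. *)
Lemma le_half_pow (x A B : R) : (forall n : nat, x <= A + B * (1 / 2) ^ n) -> x <= A.
Proof.
  intros H. apply le_epsilon. intros e He.
  assert (h : Rabs (1 / 2) < 1) by (rewrite Rabs_pos_eq; lra).
  assert (Hq : 0 < e / (Rabs B + 1)).
  { apply Rdiv_lt_0_compat; [exact He |]. pose proof (Rabs_pos B). lra. }
  destruct (pow_lt_1_zero (1 / 2) h (e / (Rabs B + 1)) Hq) as [N HN].
  specialize (HN N (Nat.le_refl _)). specialize (H N).
  rewrite Rabs_pos_eq in HN by (apply pow_le; lra).
  assert (0 <= (1 / 2) ^ N) by (apply pow_le; lra).
  assert (e / (Rabs B + 1) * (Rabs B + 1) = e).
  { field. pose proof (Rabs_pos B). lra. }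
  pose proof (Rle_abs B). pose proof (Rabs_pos B). nra.
Qed.

Fixpoint picard_iter (G : R -> R -> R) (s0 c : R) (n : nat) (s : R) : R :=
  match n with
  | O => c
  | S m => c + RInt (fun r => G r (picard_iter G s0 c m r)) s0 s
  end.

(** [G] is bounded and Lipschitz on the whole line, so the iterates are defined everywhere and never
    have to be kept inside a ball. [L * a <= 1 / 2] makes the iteration contract by one half. *)
Lemma picard (G : R -> R -> R) (s0 a M L : R) :
  0 < a -> 0 <= L -> L * a <= 1 / 2 -> 0 <= M ->
  (forall y s, continuous y s -> continuous (fun r => G r (y r)) s) ->
  (forall s y, Rabs (G s y) <= M) ->
  (forall s y y', Rabs (G s y' - G s y) <= L * Rabs (y' - y)) ->
  forall c, exists y, y s0 = c /\ forall s, Rabs (s - s0) < a -> is_derive y s (G s (y s)).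
Proof.
  intros Ha HL HLa HM HC HB HLip c.
  set (Y := picard_iter G s0 c).
  assert (YS : forall n s, continuous (Y n) s /\ is_derive (Y (S n)) s (G s (Y n s))).
  { assert (Z : forall n, (forall s, continuous (Y n) s) -> forall s, is_derive (Y (S n)) s (G s (Y n s))).
    { intros n Hn s. unfold Y; simpl; fold Y.
      rewrite <- (Rplus_0_l (G s (Y n s))).
      apply (is_derive_plus (V := R_NormedModule) (fun _ => c)
        (fun s => RInt (fun r => G r (Y n r)) s0 s)); [apply @is_derive_const |].
      apply (is_derive_RInt (fun r => G r (Y n r)) _ s0).
      - apply filter_forall. intros z. apply @RInt_correct.
        apply @ex_RInt_continuous. intros r _. apply HC, Hn.
      - apply HC, Hn. }
    assert (C : forall n s, continuous (Y n) s).
    { induction n as [| n IH]; intros s. apply continuous_const.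
      apply (ex_derive_continuous (Y (S n))). exists (G s (Y n s)). apply Z, IH. }
    intros n s. split; [apply C | apply Z, C]. }
  assert (Y0 : forall n, Y n s0 = c).
  { intros [| n]; unfold Y; simpl; [reflexivity |]. rewrite RInt_point. unfold zero; simpl. ring. }
  (* The first step is at most [M * a]; each further one multiplies the bound by [L * a], hence at
     least halves it. *)
  assert (C0 : forall n s, Rabs (s - s0) < a -> Rabs (Y (S n) s - Y n s) <= M * a * (1 / 2) ^ n).
  { induction n as [| n IH]; intros s hs.
    - assert (T : Rabs (Y 1%nat s - Y 1%nat s0) <= M * Rabs (s - s0)).
      { apply (mvt_bound (Y 1%nat) (fun s => G s (Y O s)) s0 a M).
        - intros r _. apply YS.
        - intros r _. apply HB.
        - rewrite Rabs_sub_same; exact Ha.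
        - exact hs. }
      rewrite Y0 in T. simpl pow. change (Y O s) with c. rewrite Rmult_1_r.
      eapply Rle_trans; [exact T |]. apply Rmult_le_compat_l; lra.
    - assert (T : Rabs ((fun s => Y (S (S n)) s - Y (S n) s) s - (fun s => Y (S (S n)) s - Y (S n) s) s0)
        <= L * (M * a * (1 / 2) ^ n) * Rabs (s - s0)).
      { apply (mvt_bound (fun s => Y (S (S n)) s - Y (S n) s) (fun s => G s (Y (S n) s) - G s (Y n s)) s0 a).
        - intros r _. apply (is_derive_minus (V := R_NormedModule)); apply YS.
        - intros r hr. eapply Rle_trans; [apply HLip |]. apply Rmult_le_compat_l; [exact HL |]. apply IH, hr.
        - rewrite Rabs_sub_same; exact Ha.
        - exact hs. }
      cbv beta in T. rewrite !Y0 in T. rewrite Rminus_eq_0, Rminus_0_r in T.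
      eapply Rle_trans; [exact T |].
      assert (Hp : 0 <= M * a * (1 / 2) ^ n).
      { apply Rmult_le_pos; [apply Rmult_le_pos; lra | apply pow_le; lra]. }
      simpl pow. set (q := M * a * (1 / 2) ^ n) in *.
      apply Rle_trans with (L * q * a).
      { apply Rmult_le_compat_l; [apply Rmult_le_pos; assumption | lra]. }
      replace (M * a * (1 / 2 * (1 / 2) ^ n)) with (1 / 2 * q) by (unfold q; ring). nra. }
  (* The factor [1 - (1 / 2) ^ k] is the partial sum of the geometric series; keeping it makes the
     induction on [k] close, and [C2] then drops it. *)
  assert (C1 : forall n k s, Rabs (s - s0) < a ->
    Rabs (Y (n + k)%nat s - Y n s) <= 2 * (M * a) * (1 / 2) ^ n * (1 - (1 / 2) ^ k)).
  { intros n k s hs. induction k as [| k IH].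
    - rewrite Nat.add_0_r, Rabs_sub_same. simpl. lra.
    - rewrite Nat.add_succ_r.
      replace (Y (S (n + k)) s - Y n s) with ((Y (S (n + k)) s - Y (n + k)%nat s) + (Y (n + k)%nat s - Y n s)) by ring.
      triangle. specialize (C0 (n + k)%nat s hs).
      rewrite pow_add in C0. simpl pow. nra. }
  assert (C2 : forall n k s, Rabs (s - s0) < a ->
    Rabs (Y (n + k)%nat s - Y n s) <= 2 * (M * a) * (1 / 2) ^ n).
  { intros n k s hs. eapply Rle_trans; [apply C1, hs |].
    assert (0 <= 2 * (M * a) * (1 / 2) ^ n).
    { apply Rmult_le_pos; [nra | apply pow_le; lra]. }
    assert (0 <= (1 / 2) ^ k) by (apply pow_le; lra). nra. }
  assert (HMa : 0 <= M * a) by nra.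
  assert (CL : forall s, Rabs (s - s0) < a -> ex_finite_lim_seq (fun n => Y n s)).
  { intros s hs. apply ex_lim_seq_cauchy_corr. intros eps.
    assert (h : Rabs (1 / 2) < 1) by (rewrite Rabs_pos_eq; lra).
    assert (Hq : 0 < eps / (4 * (M * a) + 1)).
    { apply Rdiv_lt_0_compat; [apply cond_pos | lra]. }
    destruct (pow_lt_1_zero (1 / 2) h _ Hq) as [N HN].
    specialize (HN N (Nat.le_refl _)). rewrite Rabs_pos_eq in HN by (apply pow_le; lra).
    exists N. intros n m hn hm.
    pose proof (C2 N (n - N)%nat s hs) as T1. pose proof (C2 N (m - N)%nat s hs) as T2.
    replace (N + (n - N))%nat with n in T1 by lia. replace (N + (m - N))%nat with m in T2 by lia.
    replace (Y n s - Y m s) with ((Y n s - Y N s) + - (Y m s - Y N s)) by ring.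
    triangle. rewrite Rabs_Ropp.
    assert (eps / (4 * (M * a) + 1) * (4 * (M * a) + 1) = eps) by (field; lra).
    assert (0 <= (1 / 2) ^ N) by (apply pow_le; lra). pose proof (cond_pos eps). nra. }
  set (y := fun s => real (Lim_seq (fun n => Y n s))).
  assert (CY : forall n s, Rabs (s - s0) < a -> Rabs (y s - Y n s) <= 2 * (M * a) * (1 / 2) ^ n).
  { intros n s hs.
    assert (HL1 : is_lim_seq (fun k => Rabs (Y (n + k)%nat s - Y n s)) (Rabs (y s - Y n s))).
    { apply (is_lim_seq_abs _ (Finite (y s - Y n s))).
      apply (is_lim_seq_minus' _ _ (y s) (Y n s)); [| apply is_lim_seq_const].
      apply (is_lim_seq_ext (fun k => Y (k + n)%nat s)).
      { intros k. f_equal. apply Nat.add_comm. }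
      apply (is_lim_seq_incr_n (fun k => Y k s) n).
      apply Lim_seq_correct', CL, hs. }
    refine (is_lim_seq_le _ (fun _ => 2 * (M * a) * (1 / 2) ^ n) _ _ _ HL1 (is_lim_seq_const _)).
    intros k. apply C2, hs. }
  (* The limit inherits the Lipschitz constant [M] of its iterates. This provides the continuity of
     [y] to which [HC] is applied. *)
  assert (CLip : forall s s', Rabs (s - s0) < a -> Rabs (s' - s0) < a -> Rabs (y s' - y s) <= M * Rabs (s' - s)).
  { intros s s' hs hs'. apply le_half_pow with (B := 4 * (M * a)). intros n.
    pose proof (CY (S n) s hs) as T1. pose proof (CY (S n) s' hs') as T2.
    assert (T3 : Rabs (Y (S n) s' - Y (S n) s) <= M * Rabs (s' - s)).
    { apply (mvt_bound (Y (S n)) (fun s => G s (Y n s)) s0 a M); try assumption.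
      - intros r _. apply YS.
      - intros r _. apply HB. }
    replace (y s' - y s) with ((Y (S n) s' - Y (S n) s) + ((y s' - Y (S n) s') + - (y s - Y (S n) s))) by ring.
    triangle. apply Rplus_le_compat; [exact T3 |].
    triangle. rewrite Rabs_Ropp. simpl pow in *.
    assert (0 <= (1 / 2) ^ n) by (apply pow_le; lra). nra. }
  exists y. split.
  { unfold y. rewrite (Lim_seq_ext _ (fun _ => c)). rewrite Lim_seq_const; reflexivity. exact Y0. }
  intros s hs. apply is_derive_eps. intros eps Heps.
  pose (r := a - Rabs (s - s0)). assert (Hr : 0 < r) by (unfold r; lra).
  assert (Hrs : forall s', Rabs (s' - s) < r -> Rabs (s' - s0) < a).
  { intros s' h. apply (Rabs_shift _ s), h. }
  assert (Cy : continuous y s).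
  { apply cont1_eps. intros e He. exists (Rmin r (e / (M + 1))). split.
    { apply Rmin_glb_lt; [exact Hr | apply Rdiv_lt_0_compat; lra]. }
    intros t ht. apply lt_Rmin in ht. destruct ht as [h1 h2].
    eapply Rle_lt_trans; [apply CLip; [exact hs | apply Hrs, h1] |].
    assert (e / (M + 1) * (M + 1) = e) by (field; lra). pose proof (Rabs_pos (t - s)). nra. }
  destruct (proj1 (cont1_eps _ _) (HC y s Cy) eps Heps) as [d [Hd Kd]].
  exists (Rmin d r). split; [apply Rmin_glb_lt; assumption |].
  intros s' h'. apply lt_Rmin in h'. destruct h' as [h1 h2].
  assert (hs' := Hrs s' h2).
  (* The derivative is found without an integral equation for the limit. The mean value theorem is
     applied to each iterate; the point [z] varies with [n], but the slope [G z (Y n z)] is compared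
     first with [G z (y z)], at geometric cost, and then with [G s (y s)], at cost [eps]. *)
  apply le_half_pow with (B := L * (2 * (M * a)) * Rabs (s' - s) + 4 * (M * a)). intros n.
  destruct (mvt1 (Y (S n)) s s') as [z [Hz Ez]].
  { intros t _. exists (G t (Y n t)). apply YS. }
  rewrite (is_derive_unique _ _ _ (proj2 (YS n z))) in Ez.
  assert (hz : Rabs (z - s0) < a) by (apply (between_ball s s'); assumption).
  assert (hz' : Rabs (z - s) < d).
  { eapply Rle_lt_trans; [apply between_abs, Hz | exact h1]. }
  specialize (Kd z hz').
  pose proof (CY (S n) s hs) as T1. pose proof (CY (S n) s' hs') as T2.
  pose proof (HLip z (y z) (Y n z)) as T3. pose proof (CY n z hz) as T4. rewrite Rabs_minus_sym in T4.
  replace (y s' - y s - G s (y s) * (s' - s)) with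
    (((G z (Y n z) - G z (y z)) + (G z (y z) - G s (y s))) * (s' - s)
     + ((y s' - Y (S n) s') + - (y s - Y (S n) s))) by lra.
  assert (Hp : 0 <= (1 / 2) ^ n) by (apply pow_le; lra).
  pose proof (Rabs_pos (s' - s)) as Hds.
  triangle.
  apply Rle_trans with ((L * (2 * (M * a) * (1 / 2) ^ n) + eps) * Rabs (s' - s) + 4 * (M * a) * (1 / 2) ^ n).
  2: { right; ring. }
  apply Rplus_le_compat.
  - rewrite Rabs_mult. apply Rmult_le_compat_r; [exact Hds |].
    triangle. apply Rplus_le_compat; [| lra].
    eapply Rle_trans; [exact T3 |]. apply Rmult_le_compat_l; assumption.
  - triangle. rewrite Rabs_Ropp. simpl pow in *. nra.
Qed.

(** * Local solutions and their dependence on parameters *)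

Definition clamp (o r s : R) : R := Rmax (o - r) (Rmin (o + r) s).

Lemma clamp_bound o r s : 0 <= r -> Rabs (clamp o r s - o) <= r.
Proof. intros H. unfold clamp, Rmax, Rmin, Rabs. repeat destruct Rle_dec; destruct Rcase_abs; lra. Qed.

Lemma clamp_id o r s : Rabs (s - o) <= r -> clamp o r s = s.
Proof. unfold clamp, Rmax, Rmin, Rabs. repeat destruct Rle_dec; destruct Rcase_abs; lra. Qed.

Lemma clamp_lip o r s s' : Rabs (clamp o r s' - clamp o r s) <= Rabs (s' - s).
Proof. unfold clamp, Rmax, Rmin, Rabs. repeat destruct Rle_dec; repeat destruct Rcase_abs; lra. Qed.

(* Clamping both arguments of [G] reduces the local problem to a globally bounded one. *)
Lemma ode_rect (G : R -> R -> R) (s0 y0 r K a c : R) :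
  0 < r -> 0 <= K ->
  (forall s y, Rabs (s - s0) < r -> Rabs (y - y0) < r ->
     forall eps, 0 < eps -> exists d, 0 < d /\ forall s' y',
       Rabs (s' - s) < d -> Rabs (y' - y) < d -> Rabs (G s' y' - G s y) < eps) ->
  (forall s y, Rabs (s - s0) < r -> Rabs (y - y0) < r -> Rabs (G s y) <= K) ->
  (forall s y y', Rabs (s - s0) < r -> Rabs (y - y0) < r -> Rabs (y' - y0) < r ->
     Rabs (G s y' - G s y) <= K * Rabs (y' - y)) ->
  0 < a -> a <= r / 2 -> K * a <= 1 / 2 -> Rabs (c - y0) + K * a <= r / 2 ->
  exists y, y s0 = c /\ forall s, Rabs (s - s0) < a ->
    Rabs (y s - c) <= K * Rabs (s - s0) /\ is_derive y s (G s (y s)).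
Proof.
  intros Hr HK HC HB HL Ha Har HKa Hc.
  assert (Cb : forall o s, Rabs (clamp o (r / 2) s - o) < r).
  { intros o s. eapply Rle_lt_trans; [apply clamp_bound; lra | lra]. }
  destruct (picard (fun s y => G (clamp s0 (r / 2) s) (clamp y0 (r / 2) y)) s0 a K K Ha HK HKa HK) with (c := c)
    as [y [Y0 Y1]].
  - intros y s Cy. apply cont1_eps. intros e He.
    destruct (HC (clamp s0 (r / 2) s) (clamp y0 (r / 2) (y s)) (Cb _ _) (Cb _ _) e He) as [d [Hd Kd]].
    destruct (proj1 (cont1_eps _ _) Cy d Hd) as [d' [Hd' Kd']].
    exists (Rmin d d'). split; [apply Rmin_glb_lt; assumption |].
    intros t ht. apply lt_Rmin in ht. destruct ht as [h1 h2].
    apply Kd; (eapply Rle_lt_trans; [apply clamp_lip |]). exact h1. apply Kd', h2.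
  - intros s y. apply HB; apply Cb.
  - intros s y y'. eapply Rle_trans; [apply HL; apply Cb |].
    apply Rmult_le_compat_l; [exact HK | apply clamp_lip].
  - exists y. split; [exact Y0 |]. intros s hs.
    assert (T : Rabs (y s - c) <= K * Rabs (s - s0)).
    { rewrite <- Y0. refine (mvt_bound y _ s0 a K Y1 _ s0 s _ hs).
      - intros z _. apply HB; apply Cb.
      - rewrite Rabs_sub_same; exact Ha. }
    split; [exact T |]. specialize (Y1 s hs). cbv beta in Y1.
    (* The solution moves at most [K * a] away from [c], so it remains within [r / 2] of [y0], where
       clamping changes nothing. *)
    rewrite (clamp_id s0), (clamp_id y0) in Y1; [exact Y1 | | lra].
    replace (y s - y0) with ((y s - c) + (c - y0)) by ring.
    triangle.
    assert (K * Rabs (s - s0) <= K * a) by (apply Rmult_le_compat_l; lra). lra.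
Qed.

(* [Z] solves the variational equation, so [Y p1 + (p - p1) * Z] solves the equation of [Y p]
   up to a quadratic error, which Gronwall's inequality transfers to the difference. *)
Lemma ode_param_derive (G : R -> R -> R -> R) (Gp Gy Z : R -> R) (Y : R -> R -> R) (p1 s0 a L K d : R) :
  0 < a -> 0 <= L -> L * a <= 1 / 2 -> 0 <= K -> 0 < d ->
  (forall p s, Rabs (p - p1) < d -> Rabs (s - s0) < a -> is_derive (Y p) s (G p s (Y p s))) ->
  (forall s, Rabs (s - s0) < a -> is_derive Z s (Gp s + Gy s * Z s)) ->
  (forall p s, Rabs (p - p1) < d -> Rabs (s - s0) < a ->
     Rabs (G p s (Y p1 s + (p - p1) * Z s) - G p1 s (Y p1 s) - (p - p1) * (Gp s + Gy s * Z s))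
       <= K * (Rabs (p - p1) * Rabs (p - p1))) ->
  (forall p s, Rabs (p - p1) < d -> Rabs (s - s0) < a ->
     Rabs (G p s (Y p s) - G p s (Y p1 s + (p - p1) * Z s)) <= L * Rabs (Y p s - Y p1 s - (p - p1) * Z s)) ->
  is_derive (fun p => Y p s0) p1 (Z s0) ->
  forall s, Rabs (s - s0) < a -> is_derive (fun p => Y p s) p1 (Z s).
Proof.
  intros Ha HL HLa HK Hd HY HZ HT HLip H0 s hs.
  apply is_derive_eps. intros e He.
  (* Gronwall's inequality doubles the sum of the initial error and the quadratic one, so each may
     take [e / 4]. *)
  assert (He4 : 0 < e / 4) by lra.
  destruct (proj1 (is_derive_eps _ _ _) H0 (e / 4) He4) as [d1 [Hd1 K1]].
  assert (HaK : 0 <= a * K) by (apply Rmult_le_pos; lra).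
  exists (Rmin d (Rmin d1 (e / (4 * (a * K) + 1)))). split.
  { repeat apply Rmin_glb_lt; try assumption. apply Rdiv_lt_0_compat; lra. }
  intros p hp. apply lt_Rmin in hp. destruct hp as [hp hp']. apply lt_Rmin in hp'. destruct hp' as [hp1 hp2].
  specialize (K1 p hp1).
  assert (h1 : Rabs (p1 - p1) < d) by (rewrite Rabs_sub_same; exact Hd).
  pose proof (gronwall (fun s => Y p s - Y p1 s - (p - p1) * Z s)
    (fun s => G p s (Y p s) - G p1 s (Y p1 s) - (p - p1) * (Gp s + Gy s * Z s)) s0 a L
    (K * (Rabs (p - p1) * Rabs (p - p1))) HL HLa) as Gr.
  cbv beta in Gr.
  assert (He' : 0 <= K * (Rabs (p - p1) * Rabs (p - p1))).
  { repeat apply Rmult_le_pos; try apply Rabs_pos; exact HK. }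
  specialize (Gr He'). 
  assert (T : Rabs (Y p s - Y p1 s - (p - p1) * Z s) <=
    2 * (Rabs (Y p s0 - Y p1 s0 - (p - p1) * Z s0) + a * (K * (Rabs (p - p1) * Rabs (p - p1))))).
  { apply Gr; [| | exact hs].
    - intros z hz.
      apply (is_derive_minus (V := R_NormedModule) (fun s => Y p s - Y p1 s) (fun s => (p - p1) * Z s)).
      + apply (is_derive_minus (V := R_NormedModule)); apply HY; assumption.
      + apply is_derive_scal, HZ, hz.
    - intros z hz. specialize (HT p z hp hz). specialize (HLip p z hp hz).
      replace (G p z (Y p z) - G p1 z (Y p1 z) - (p - p1) * (Gp z + Gy z * Z z)) with
       ((G p z (Y p z) - G p z (Y p1 z + (p - p1) * Z z)) +
        (G p z (Y p1 z + (p - p1) * Z z) - G p1 z (Y p1 z) - (p - p1) * (Gp z + Gy z * Z z))) by ring.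
      triangle. lra. }
  rewrite (Rmult_comm (Z s)). eapply Rle_trans; [exact T |].
  rewrite (Rmult_comm (Z s0)) in K1.
  assert (E : e / (4 * (a * K) + 1) * (4 * (a * K) + 1) = e) by (field; lra).
  set (q := Rabs (p - p1)) in *. assert (Hq : 0 <= q) by apply Rabs_pos.
  assert (T2 : 4 * (a * K) * q <= e) by nra.
  assert (T3 : a * (K * (q * q)) <= e / 4 * q).
  { replace (a * (K * (q * q))) with (a * K * q * q) by ring. apply Rmult_le_compat_r; lra. }
  lra.
Qed.

(** * Integrals depending on parameters *)

Section IntegralInX.

Variables a b c e : R.
Hypothesis He : 0 < e.
Let D := Box a b c e.
Let HD : open D := open_Box a b c e.

Lemma box_between t x u s : D (t, x, u) -> Rmin b x <= s <= Rmax b x -> D (t, s, u).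
Proof.
  intros (h1 & h2 & h3) hs. repeat split; try assumption. apply (between_self b e x); assumption.
Qed.

Lemma cont3_slice f t x u : cont3 f t x u -> continuous (fun s => f t s u) x.
Proof.
  intros H. apply cont1_eps. intros eps Heps.
  destruct (cont3_elim H eps Heps) as [d [Hd K]].
  exists d. split; [exact Hd |]. intros s hs. apply K; try assumption; rewrite Rabs_sub_same; exact Hd.
Qed.

Lemma slice_ex_RInt f t u x1 x2 : Ck 0 D f -> D (t, x1, u) -> D (t, x2, u) ->
  ex_RInt (fun s => f t s u) x1 x2.
Proof.
  intros Hf d1 d2. apply @ex_RInt_continuous.
  intros s hs. apply (cont3_slice f). apply (Ck_cont D 0); [exact Hf |].
  destruct d1 as (h1 & h2 & h3). destruct d2 as (_ & h2' & _).
  repeat split; try assumption. apply (between_ball x1 x2); assumption.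
Qed.

(** Compactness of the segment from [b] to [x] makes continuity in [(t, u)] uniform along it. *)
Lemma tube f t x u : Ck 0 D f -> D (t, x, u) ->
  forall eps, 0 < eps -> exists d, 0 < d /\ forall t' u' s,
    Rabs (t' - t) < d -> Rabs (u' - u) < d -> Rmin b x <= s <= Rmax b x ->
    Rabs (f t' s u' - f t s u) < eps.
Proof.
  intros Hf d eps Heps.
  assert (H : forall s, exists r : posreal, Rmin b x <= s <= Rmax b x ->
    forall t' s' u', Rabs (t' - t) < r -> Rabs (s' - s) < r -> Rabs (u' - u) < r ->
      Rabs (f t' s' u' - f t s u) < eps / 2).
  { intros s. destruct (classic (Rmin b x <= s <= Rmax b x)) as [hs | hs].
    - assert (C : cont3 f t s u).
      { apply (Ck_cont D 0); [exact Hf |]. apply (box_between t x); assumption. }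
      assert (Heps2 : 0 < eps / 2) by lra.
      destruct (cont3_elim C _ Heps2) as [r [Hr K]].
      exists (mkposreal r Hr). intros _. exact K.
    (* A gauge has to be defined on all reals; its value off the segment is arbitrary. *)
    - exists (mkposreal 1 Rlt_0_1). intros h; contradiction. }
  pose (delta := fun s => proj1_sig (constructive_indefinite_description _ (H s))).
  assert (Hdelta : forall s, Rmin b x <= s <= Rmax b x ->
    forall t' s' u', Rabs (t' - t) < delta s -> Rabs (s' - s) < delta s -> Rabs (u' - u) < delta s ->
      Rabs (f t' s' u' - f t s u) < eps / 2).
  { intros s. exact (proj2_sig (constructive_indefinite_description _ (H s))). }
  destruct (compactness_value_1d (Rmin b x) (Rmax b x) delta) as [r Hr].
  exists r. split; [apply cond_pos |]. intros t' u' s ht hu hs.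
  (* [compactness_value_1d] gives the nearby gauge point only under a double negation. *)
  apply NNPP. intros N. apply (Hr s hs). intros (s1 & I1 & h1 & h2). apply N.
  assert (T1 : Rabs (f t' s u' - f t s1 u) < eps / 2) by (apply Hdelta; lra).
  assert (T2 : Rabs (f t s u - f t s1 u) < eps / 2).
  { apply Hdelta; try assumption; rewrite Rabs_sub_same; apply cond_pos. }
  replace (f t' s u' - f t s u) with ((f t' s u' - f t s1 u) + - (f t s u - f t s1 u)) by ring.
  triangle. rewrite Rabs_Ropp. lra.
Qed.

Lemma abs_RInt_bound (f : R -> R) (x1 x2 M : R) :
  ex_RInt f x1 x2 -> (forall s, Rmin x1 x2 <= s <= Rmax x1 x2 -> Rabs (f s) <= M) ->
  Rabs (RInt f x1 x2) <= M * Rabs (x2 - x1).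
Proof.
  intros Hf HM. destruct (Rle_dec x1 x2) as [h | h].
  - rewrite (Rabs_pos_eq (x2 - x1)), Rmult_comm by lra. apply abs_RInt_le_const; try assumption.
    intros s hs. apply HM. rewrite Rmin_left, Rmax_right; assumption.
  - assert (h' : x2 <= x1) by lra.
    rewrite <- (opp_RInt_swap f x2 x1) by (apply ex_RInt_swap; exact Hf).
    unfold opp; simpl. rewrite Rabs_Ropp, (Rabs_minus_sym x2 x1), (Rabs_pos_eq (x1 - x2)), Rmult_comm by lra.
    apply abs_RInt_le_const; [exact h' | apply ex_RInt_swap; exact Hf |].
    intros s hs. apply HM. rewrite Rmin_right, Rmax_left; assumption.
Qed.

(** The change splits into an integral over the fixed segment from [b] to [x], small by [tube], and
    one over the short segment from [x] to [x'], where the integrand is bounded by [M]. *)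
Lemma RInt_cont3 f t x u : Ck 0 D f -> D (t, x, u) ->
  cont3 (fun t x u => RInt (fun s => f t s u) b x) t x u.
Proof.
  intros Hf d. apply cont3_eps. intros eps Heps.
  assert (Hb : forall t x u, D (t, x, u) -> D (t, b, u)).
  { intros t' x' u' (h1 & h2 & h3). box. }
  destruct (open3 D t x u HD d) as [r [Hr HrD]].
  destruct (cont3_elim (Ck_cont D 0 f t x u Hf d) 1 Rlt_0_1) as [d1 [Hd1 K1]].
  pose (M := Rabs (f t x u) + 1). assert (HM : 0 < M) by (unfold M; pose proof (Rabs_pos (f t x u)); lra).
  assert (Heps2 : 0 < eps / 2 / e) by (apply Rdiv_lt_0_compat; lra).
  destruct (tube f t x u Hf d _ Heps2) as [d2 [Hd2 K2]].
  exists (Rmin (Rmin r d1) (Rmin d2 (eps / 2 / M))). split.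
  { repeat apply Rmin_glb_lt; try assumption. apply Rdiv_lt_0_compat; lra. }
  intros t' x' u' h1 h2 h3.
  split_Rmin.
  assert (d' : D (t', x', u')) by (apply HrD; box).
  assert (d'' : D (t', x, u')).
  { destruct d' as (? & ? & ?). destruct d as (? & ? & ?). box. }
  assert (E1 : ex_RInt (fun s => f t' s u') b x) by (apply (slice_ex_RInt f t'); eauto).
  assert (E2 : ex_RInt (fun s => f t' s u') x x') by (apply (slice_ex_RInt f t'); eauto).
  assert (E3 : ex_RInt (fun s => f t s u) b x) by (apply (slice_ex_RInt f t); eauto).
  rewrite <- (RInt_Chasles (fun s => f t' s u') b x x' E1 E2). unfold plus; simpl.
  replace (RInt (fun s => f t' s u') b x + RInt (fun s => f t' s u') x x' - RInt (fun s => f t s u) b x)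
   with (RInt (fun s => f t' s u' - f t s u) b x + RInt (fun s => f t' s u') x x').
  2: { rewrite (RInt_minus (fun s => f t' s u') (fun s => f t s u)) by assumption.
       unfold minus, plus, opp; simpl. ring. }
  triangle.
  assert (T1 : Rabs (RInt (fun s => f t' s u' - f t s u) b x) <= eps / 2 / e * Rabs (x - b)).
  { apply abs_RInt_bound.
    - apply (ex_RInt_minus (fun s => f t' s u') (fun s => f t s u)); assumption.
    - intros s hs. left. apply K2; tauto. }
  assert (T2 : Rabs (RInt (fun s => f t' s u') x x') <= M * Rabs (x' - x)).
  { apply abs_RInt_bound; [exact E2 |]. intros s hs.
    assert (T : Rabs (f t' s u' - f t x u) < 1).
    { apply K1; try tauto. eapply Rle_lt_trans; [apply between_abs, hs | tauto]. }
    replace (f t' s u') with (f t x u + (f t' s u' - f t x u)) by ring.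
    triangle. unfold M; lra. }
  assert (Q1 : eps / 2 / e * Rabs (x - b) < eps / 2 / e * e).
  { apply Rmult_lt_compat_l; [exact Heps2 |]. apply d. }
  assert (Q2 : M * Rabs (x' - x) < M * (eps / 2 / M)) by (apply Rmult_lt_compat_l; tauto).
  replace (eps / 2 / e * e) with (eps / 2) in Q1 by (field; lra).
  replace (M * (eps / 2 / M)) with (eps / 2) in Q2 by (field; lra). lra.
Qed.

Lemma cont3_cont2 f t x u : cont3 f t x u ->
  continuity_2d_pt (fun p s => f p s u) t x /\ continuity_2d_pt (fun p s => f t s p) u x.
Proof.
  intros H. split; intros eps; destruct (cont3_elim H eps (cond_pos eps)) as [d [Hd K]];
  exists (mkposreal d Hd); intros p s hp hs; apply K; try assumption; rewrite Rabs_sub_same; exact Hd.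
Qed.

(** In [x] this is the fundamental theorem of calculus, in [t] and [u] differentiation under the
    integral sign. Since the lower limit is the centre [b], the segment of integration never leaves
    the box. *)
Lemma RInt_is_d3 f t x u : Ck 1 D f -> D (t, x, u) ->
  is_d3 (fun t x u => RInt (fun s => f t s u) b x) (fun t x u => RInt (fun s => dt f t s u) b x) f
    (fun t x u => RInt (fun s => du f t s u) b x) t x u.
Proof.
  intros Hf d.
  assert (Hb : forall t x u, D (t, x, u) -> D (t, b, u)).
  { intros t' x' u' (h1 & h2 & h3). box. }
  assert (Hf0 := Ck_pred D 0 f Hf).
  destruct (open3_slices D t x u HD d) as (l1 & l2 & l3).
  split; [| split].
  - apply (is_derive_RInt_param (fun t s => f t s u) b x t).
    + generalize l1. apply filter_imp. intros t' d' s hs.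
      refine (proj1 (Ck_ex D 0 f t' s u Hf _)). apply (box_between t' x); assumption.
    + intros s hs. refine (proj1 (cont3_cont2 (dt f) t s u _)). apply (Ck_cont D 0); [apply Ck_dt, Hf |].
      apply (box_between t x); assumption.
    + generalize l1. apply filter_imp. intros t' d'. apply (slice_ex_RInt f t'); eauto.
  - apply (is_derive_RInt (fun s => f t s u) _ b).
    + generalize l2. apply filter_imp. intros x' d'. apply @RInt_correct.
      apply (slice_ex_RInt f t); eauto.
    + apply (cont3_slice f). apply (Ck_cont D 0); assumption.
  - apply (is_derive_RInt_param (fun u s => f t s u) b x u).
    + generalize l3. apply filter_imp. intros u' d' s hs.
      refine (proj2 (proj2 (Ck_ex D 0 f t s u' Hf _))). apply (box_between t x); assumption.
    + intros s hs. refine (proj2 (cont3_cont2 (du f) t s u _)). apply (Ck_cont D 0); [apply Ck_du, Hf |].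
      apply (box_between t x); assumption.
    + generalize l3. apply filter_imp. intros u' d'. apply (slice_ex_RInt f t); eauto.
Qed.

Lemma Ck_RInt n f : Ck n D f -> Ck n D (fun t x u => RInt (fun s => f t s u) b x).
Proof.
  revert f. induction n as [| n IH]; intros f Hf.
  - apply Ck_0. intros t x u d. apply RInt_cont3; assumption.
  - apply (Ck_S_intro D HD n _ (fun t x u => RInt (fun s => dt f t s u) b x) f
      (fun t x u => RInt (fun s => du f t s u) b x)).
    + apply IH, Ck_pred, Hf.
    + intros t x u d. apply RInt_is_d3; [| exact d]. apply (Ck_le 1 (S n)); [lia | exact Hf].
    + apply IH, Ck_dt, Hf.
    + apply Ck_pred, Hf.
    + apply IH, Ck_du, Hf.
Qed.

End IntegralInX.

(** * Frobenius theorem *)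

Lemma choice_fun (A B : Type) (P : A -> B -> Prop) :
  (forall x, exists y, P x y) -> exists f, forall x, P x (f x).
Proof.
  intros H. exists (fun x => proj1_sig (constructive_indefinite_description _ (H x))).
  intros x. exact (proj2_sig (constructive_indefinite_description _ (H x))).
Qed.

(** The variational equation of a scalar equation is linear and homogeneous in the initial value.
    Its explicit solution lets [Ck_RInt] and [Ck_exp] supply the regularity of the derivative in
    [k]. *)
Lemma exp_linear_ode (q : R -> R) (s0 a K z0 : R) :
  0 < a -> 0 <= K -> (forall s, Rabs (s - s0) < a -> continuous q s /\ Rabs (q s) <= K) ->
  forall s, Rabs (s - s0) < a ->
    is_derive (fun s => z0 * exp (RInt q s0 s)) s (q s * (z0 * exp (RInt q s0 s))) /\
    Rabs (z0 * exp (RInt q s0 s)) <= Rabs z0 * exp (K * a).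
Proof.
  intros Ha HK Hq.
  assert (Hex : forall s, Rabs (s - s0) < a -> ex_RInt q s0 s).
  { intros s hs. apply @ex_RInt_continuous.
    intros r hr. apply Hq. apply (between_self s0 a s); assumption. }
  intros s hs. split.
  - assert (D : is_derive (RInt q s0) s (q s)).
    { apply (is_derive_RInt q _ s0).
      - apply locally1. exists (a - Rabs (s - s0)). split; [lra |]. intros r hr.
        apply @RInt_correct, Hex.
        apply (Rabs_shift _ s), hr.
      - apply Hq, hs. }
    replace (q s * (z0 * exp (RInt q s0 s))) with (z0 * (q s * exp (RInt q s0 s))) by ring.
    apply (is_derive_scal (fun s => exp (RInt q s0 s))).
    apply (is_derive_comp exp (RInt q s0)); [apply is_derive_exp | exact D].
  - rewrite Rabs_mult. apply Rmult_le_compat_l; [apply Rabs_pos |].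
    rewrite Rabs_pos_eq by (left; apply exp_pos).
    assert (T : RInt q s0 s <= K * a).
    { eapply Rle_trans; [apply Rle_abs |]. eapply Rle_trans.
      - apply (abs_RInt_bound q s0 s K); [apply Hex, hs |].
        intros r hr. apply Hq. apply (between_self s0 a s); assumption.
      - apply Rmult_le_compat_l; lra. }
    destruct T as [T | T]; [left; apply exp_increasing, T | right; f_equal; exact T].
Qed.

(** Exchanges [t] and [x], so that the results about equations in the middle variable also serve the
    equation in [t]. *)
Lemma bd2_swap K f t x u : bd2 K f t x u -> bd2 K (fun x t u => f t x u) x t u.
Proof.
  intros (h & h0 & h1 & h2 & h3).
  assert (S : forall g t x u, bd1 K g t x u -> bd1 K (fun x t u => g t x u) x t u).
  { intros g t' x' u' ((d1 & d2 & d3) & b1 & b2 & b3).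
    exact (conj (conj d2 (conj d1 d3)) (conj b2 (conj b1 b3))). }
  refine (conj h (conj (S _ _ _ _ h0) (conj (S _ _ _ _ h2) (conj (S _ _ _ _ h1) (S _ _ _ _ h3))))).
Qed.

(* [m = 1] varies the parameter [t] of [f], [m = 0] only the initial value. *)
Lemma ode_param3 (f : R -> R -> R -> R) (t0 s0 y0 r K a t m p1 d N : R) (Y : R -> R -> R) (Z : R -> R) :
  0 < a -> a <= r -> 0 <= K -> K * a <= 1 / 2 -> 0 < d -> 0 <= N ->
  (forall t s y, Box t0 s0 y0 r (t, s, y) -> bd2 K f t s y) ->
  (forall p, Rabs (p - p1) < d -> Rabs (t + m * (p - p1) - t0) < r) ->
  (forall p s, Rabs (p - p1) < d -> Rabs (s - s0) < a ->
     Rabs (Y p s - y0) <= r / 2 /\ is_derive (Y p) s (f (t + m * (p - p1)) s (Y p s))) ->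
  (forall s, Rabs (s - s0) < a ->
     is_derive Z s (m * dt f t s (Y p1 s) + du f t s (Y p1 s) * Z s) /\ Rabs (Z s) <= N) ->
  is_derive (fun p => Y p s0) p1 (Z s0) ->
  forall s, Rabs (s - s0) < a -> is_derive (fun p => Y p s) p1 (Z s).
Proof.
  intros Ha Har HK HKa Hd HN Hf Ht HY HZ H0.
  assert (Hr : 0 < r) by lra.
  assert (Hpp : Rabs (p1 - p1) < d) by (rewrite Rabs_sub_same; exact Hd).
  assert (Ep : t + m * (p1 - p1) = t) by ring.
  (* The linear approximation [Y p1 + (p - p1) * Z] must stay in the box: [Y p1] is within [r / 2]
     of [y0], and the correction is below [r / 2] for this [d']. *)
  pose (d' := Rmin d (r / 2 / (N + 1))).
  assert (Hd' : 0 < d') by (apply Rmin_glb_lt; [exact Hd |]; repeat apply Rdiv_lt_0_compat; lra).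
  assert (HB : forall p s, Rabs (p - p1) < d' -> Rabs (s - s0) < a ->
     Rabs (p - p1) < d /\ Box t0 s0 y0 r (t, s, Y p1 s) /\
     Box t0 s0 y0 r (t + m * (p - p1), s, Y p s) /\
     Box t0 s0 y0 r (t + m * (p - p1), s, Y p1 s + (p - p1) * Z s)).
  { intros p s hp hs. apply lt_Rmin in hp. destruct hp as [hp hp'].
    pose proof (Ht p hp) as T1. pose proof (Ht p1 Hpp) as T2. rewrite Ep in T2.
    pose proof (proj1 (HY p s hp hs)) as T3. pose proof (proj1 (HY p1 s Hpp hs)) as T4.
    split; [exact hp |]. repeat split; try assumption; try lra.
    replace (Y p1 s + (p - p1) * Z s - y0) with ((Y p1 s - y0) + (p - p1) * Z s) by ring.
    triangle. rewrite Rabs_mult.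
    pose proof (proj2 (HZ s hs)) as T5.
    assert (E : r / 2 / (N + 1) * (N + 1) = r / 2) by (field; lra).
    pose proof (Rabs_pos (p - p1)). pose proof (Rabs_pos (Z s)). nra. }
  apply (ode_param_derive (fun p s y => f (t + m * (p - p1)) s y) (fun s => m * dt f t s (Y p1 s))
    (fun s => du f t s (Y p1 s)) Z Y p1 s0 a K (K * ((Rabs m + N) * (Rabs m + N))) d'); try assumption.
  - apply Rmult_le_pos; [exact HK |]. pose proof (Rabs_pos m). apply Rmult_le_pos; lra.
  - intros p s hp hs. apply HY; [| exact hs]. apply (HB p s hp hs).
  - intros s hs. apply (HZ s hs).
  (* Taylor's estimate along a displacement of length at most [(Rabs m + N) * Rabs (p - p1)]; this
     is the origin of the constant passed to [ode_param_derive]. *)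
  - intros p s hp hs. destruct (HB p s hp hs) as (_ & B1 & _ & B3).
    pose proof (taylor3 t0 s0 y0 r K f _ _ _ _ _ _ HK Hf B1 B3) as T.
    rewrite Ep. rewrite Rabs_sub_same in T.
    replace (t + m * (p - p1) - t) with (m * (p - p1)) in T by ring.
    replace (Y p1 s + (p - p1) * Z s - Y p1 s) with ((p - p1) * Z s) in T by ring.
    replace (dt f t s (Y p1 s) * (m * (p - p1)) + dx f t s (Y p1 s) * (s - s) +
      du f t s (Y p1 s) * ((p - p1) * Z s)) with
      ((p - p1) * (m * dt f t s (Y p1 s) + du f t s (Y p1 s) * Z s)) in T by ring.
    eapply Rle_trans; [exact T |]. rewrite !Rabs_mult.
    set (q := Rabs (p - p1)). assert (Hq : 0 <= q) by apply Rabs_pos.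
    pose proof (proj2 (HZ s hs)) as T5. pose proof (Rabs_pos m). pose proof (Rabs_pos (Z s)).
    rewrite Rmult_assoc. apply Rmult_le_compat_l; [exact HK |].
    assert (S : 0 <= Rabs m * q + 0 + q * Rabs (Z s) <= (Rabs m + N) * q).
    { split; [| nra]. assert (0 <= Rabs m * q) by (apply Rmult_le_pos; assumption).
      assert (0 <= q * Rabs (Z s)) by (apply Rmult_le_pos; assumption). lra. }
    replace ((Rabs m + N) * (Rabs m + N) * (q * q)) with (((Rabs m + N) * q) * ((Rabs m + N) * q)) by ring.
    apply Rmult_le_compat; apply S.
  - intros p s hp hs. destruct (HB p s hp hs) as (_ & _ & B2 & B3).
    pose proof (lip3 t0 s0 y0 r K f _ _ _ _ _ _ (fun t x u h => bd2_1 _ _ _ _ _ (Hf t x u h)) B3 B2) as T.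
    rewrite !Rabs_sub_same in T.
    replace (Y p s - Y p1 s - (p - p1) * Z s) with (Y p s - (Y p1 s + (p - p1) * Z s)) by ring.
    eapply Rle_trans; [exact T |]. apply Rmult_le_compat_l; lra.
Qed.

Lemma bd1_Ck0 a b c e K f : 0 <= K ->
  (forall t x u, Box a b c e (t, x, u) -> bd1 K f t x u) -> Ck 0 (Box a b c e) f.
Proof.
  intros HK H. apply Ck_0. intros t x u B. apply cont3_eps. intros eps Heps.
  destruct (open3 _ _ _ _ (open_Box a b c e) B) as [r [Hr HrB]].
  exists (Rmin r (eps / (3 * K + 1))). split.
  { apply Rmin_glb_lt; [exact Hr |]. apply Rdiv_lt_0_compat; lra. }
  intros t' x' u' h1 h2 h3.
  split_Rmin.
  assert (B' : Box a b c e (t', x', u')) by (apply HrB; box).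
  eapply Rle_lt_trans; [apply (lip3 a b c e K); assumption |].
  assert (Hq : eps / (3 * K + 1) * (3 * K + 1) = eps) by (field; lra).
  assert (0 < eps / (3 * K + 1)) by (apply Rdiv_lt_0_compat; lra).
  apply Rle_lt_trans with (K * (3 * (eps / (3 * K + 1)))); [apply Rmult_le_compat_l; lra | lra].
Qed.

Lemma cont3_curve f (a b c : R -> R) s : cont3 f (a s) (b s) (c s) ->
  continuous a s -> continuous b s -> continuous c s -> continuous (fun s => f (a s) (b s) (c s)) s.
Proof.
  intros Hf Ha Hb Hc.
  apply (continuous_comp (fun s => (a s, b s, c s)) (fun '(t, x, u) => f t x u)); [| exact Hf].
  pose proof (proj1 (cont1_eps _ _) Ha) as Ha'. pose proof (proj1 (cont1_eps _ _) Hb) as Hb'.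
  pose proof (proj1 (cont1_eps _ _) Hc) as Hc'.
  intros P HP. apply locally3 in HP. destruct HP as [e [He K]].
  destruct (Ha' e He) as [d1 [Hd1 K1]]. destruct (Hb' e He) as [d2 [Hd2 K2]].
  destruct (Hc' e He) as [d3 [Hd3 K3]].
  apply locally1. exists (Rmin d1 (Rmin d2 d3)). split; [repeat apply Rmin_glb_lt; assumption |].
  intros t h. apply lt_Rmin in h. destruct h as [h1 h]. apply lt_Rmin in h. destruct h as [h2 h3].
  apply K; [apply K1 | apply K2 | apply K3]; assumption.
Qed.

(** A solution is merely chosen for each pair of parameter and initial value; regularity in these
    two is recovered afterwards from [ode_param3]. *)
Lemma ode_flow (f : R -> R -> R -> R) (t0 s0 y0 r K a : R) : 0 < r -> 0 <= K ->
  (forall t s y, Box t0 s0 y0 r (t, s, y) -> bd2 K f t s y) ->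
  0 < a -> a <= r / 2 -> K * a <= 1 / 2 ->
  exists Y : R -> R -> R -> R, forall t c, Rabs (t - t0) < r -> Rabs (c - y0) + K * a <= r / 2 ->
    Y t c s0 = c /\ forall s, Rabs (s - s0) < a ->
      Rabs (Y t c s - c) <= K * Rabs (s - s0) /\ is_derive (Y t c) s (f t s (Y t c s)).
Proof.
  intros Hr HK Hf Ha Har HKa.
  assert (Hf1 := fun t x u H => bd2_1 _ _ _ _ _ (Hf t x u H)).
  pose proof (bd1_Ck0 t0 s0 y0 r K f HK Hf1) as Cf.
  destruct (choice_fun (R * R) (R -> R) (fun p y => Rabs (fst p - t0) < r ->
    Rabs (snd p - y0) + K * a <= r / 2 -> y s0 = snd p /\
      forall s, Rabs (s - s0) < a -> Rabs (y s - snd p) <= K * Rabs (s - s0) /\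
        is_derive y s (f (fst p) s (y s)))) as [Y HY].
  - intros [t c]. simpl fst; simpl snd.
    destruct (Rlt_dec (Rabs (t - t0)) r) as [ht | ht].
    (* Default value outside the admissible range, where nothing is claimed. *)
    2: { exists (fun _ => 0). intros; contradiction. }
    destruct (Rle_dec (Rabs (c - y0) + K * a) (r / 2)) as [hc | hc].
    2: { exists (fun _ => 0). intros; contradiction. }
    assert (Bx : forall s y, Rabs (s - s0) < r -> Rabs (y - y0) < r -> Box t0 s0 y0 r (t, s, y)).
    { intros s y hs hy. exact (conj ht (conj hs hy)). }
    destruct (ode_rect (f t) s0 y0 r K a c) as [y Hy]; try assumption.
    + intros s y hs hy eps Heps.
      destruct (cont3_elim (Ck_cont _ 0 f t s y Cf (Bx s y hs hy)) eps Heps) as [d [Hd Kd]].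
      exists d. split; [exact Hd |]. intros s' y'. apply Kd. rewrite Rabs_sub_same; exact Hd.
    + intros s y hs hy. exact (proj1 (Hf _ _ _ (Bx s y hs hy))).
    + intros s y y' hs hy hy'.
      pose proof (lip3 t0 s0 y0 r K f _ _ _ _ _ _ Hf1 (Bx s y hs hy) (Bx s y' hs hy')) as T.
      rewrite !Rabs_sub_same in T. eapply Rle_trans; [exact T |]. apply Rmult_le_compat_l; lra.
    + exists y. intros _ _. exact Hy.
  - exists (fun t c => Y (t, c)). intros t c. exact (HY (t, c)).
Qed.

(** A solution with value [k] at [(t0, x0)] is forced to follow the equation in [t] on the line
    [x = x0] and then the equation in [x] at fixed [t]; this dictates [F]. The equation in [x] holds
    by construction, and compatibility carries the one in [t] from the line to the box. *)
Lemma frobenius (g h : R -> R -> R -> R) (t0 x0 u0 : R) (D : R * R * R -> Prop) :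
  open D -> D (t0, x0, u0) -> (forall n, Ck n D g) -> (forall n, Ck n D h) ->
  (forall t x u, D (t, x, u) -> dx h t x u + du h t x u * g t x u = dt g t x u + du g t x u * h t x u) ->
  exists (F : R -> R -> R -> R) (a : R), 0 < a /\
    (forall t x k, Box t0 x0 u0 a (t, x, k) -> D (t, x, F t x k) /\
       is_derive (fun s => F s x k) t (h t x (F t x k)) /\
       is_derive (fun s => F t s k) x (g t x (F t x k))) /\
    (forall k, Rabs (k - u0) < a -> F t0 x0 k = k) /\
    (forall n, Ck n (Box t0 x0 u0 a) F).
Proof.
  intros HD d0 Hg Hh Hcompat.
  destruct (bd2_near D g t0 x0 u0 HD (Hg 2%nat) d0) as (K1 & r1 & HK1 & Hr1 & B1).
  destruct (bd2_near D h t0 x0 u0 HD (Hh 2%nat) d0) as (K2 & r2 & HK2 & Hr2 & B2).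
  pose (r := Rmin r1 r2). assert (Hr : 0 < r) by (apply Rmin_glb_lt; assumption).
  pose (K := K1 + K2). assert (HK : 0 <= K) by (unfold K; lra).
  assert (BD : forall t x u, Box t0 x0 u0 r (t, x, u) -> D (t, x, u)).
  { intros t x u B. apply B1. eapply Box_mono; [apply Rmin_l | exact B]. }
  assert (Bg : forall t x u, Box t0 x0 u0 r (t, x, u) -> bd2 K g t x u).
  { intros t x u B. apply bd2_mono with K1; [unfold K; lra |]. apply B1. eapply Box_mono; [apply Rmin_l | exact B]. }
  assert (Bh : forall t x u, Box t0 x0 u0 r (t, x, u) -> bd2 K h t x u).
  { intros t x u B. apply bd2_mono with K2; [unfold K; lra |]. apply B2. eapply Box_mono; [apply Rmin_r | exact B]. }
  clear B1 B2.
  (* [1 / 2 / (K + 1)] provides the contraction. The offset of [k] from [u0], the motion in [t] and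
     the motion in [x] contribute at most [r / 8] each, so [F] stays within [r / 2] of [u0], as
     [ode_param3] demands. *)
  pose (a := Rmin (r / 8) (Rmin (1 / 2 / (K + 1)) (r / 8 / (K + 1)))).
  assert (Ha : 0 < a) by (unfold a; repeat apply Rmin_glb_lt; repeat apply Rdiv_lt_0_compat; lra).
  assert (Ha8 : a <= r / 8) by apply Rmin_l.
  assert (HKa : K * a <= 1 / 2).
  { assert (h1 : a <= 1 / 2 / (K + 1)) by (eapply Rle_trans; [apply Rmin_r | apply Rmin_l]).
    assert (E : 1 / 2 / (K + 1) * (K + 1) = 1 / 2) by (field; lra). nra. }
  assert (HKr : K * a <= r / 8).
  { assert (h1 : a <= r / 8 / (K + 1)) by (eapply Rle_trans; [apply Rmin_r | apply Rmin_r]).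
    assert (E : r / 8 / (K + 1) * (K + 1) = r / 8) by (field; lra). nra. }
  (* The first two arguments are exchanged to make [t] the variable of integration; the flow serves
     only for the parameter value [x0]. *)
  destruct (ode_flow (fun x t u => h t x u) x0 t0 u0 r K a) as [Yh HYh]; try assumption; try lra.
  { intros x t u (b1 & b2 & b3). apply (bd2_swap K h), Bh. box. }
  pose (Y := Yh x0).
  assert (HY : forall k, Rabs (k - u0) < a -> Y k t0 = k /\
    forall s, Rabs (s - t0) < a -> Rabs (Y k s - k) <= K * Rabs (s - t0) /\
      is_derive (Y k) s (h s x0 (Y k s))).
  { intros k hk. apply HYh; [rewrite Rabs_sub_same; exact Hr | lra]. }
  assert (HYb : forall k s, Rabs (k - u0) < a -> Rabs (s - t0) < a -> Rabs (Y k s - u0) <= a + K * a).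
  { intros k s hk hs. destruct (HY k hk) as [_ H]. destruct (H s hs) as [H1 _].
    replace (Y k s - u0) with ((Y k s - k) + (k - u0)) by ring.
    triangle.
    assert (K * Rabs (s - t0) <= K * a) by (apply Rmult_le_compat_l; lra). lra. }
  destruct (ode_flow g t0 x0 u0 r K a) as [X HX]; try assumption; try lra.
  pose (F := fun t x k => X t (Y k t) x).
  assert (HF : forall t k, Rabs (t - t0) < a -> Rabs (k - u0) < a -> F t x0 k = Y k t /\
    forall x, Rabs (x - x0) < a -> Rabs (F t x k - Y k t) <= K * Rabs (x - x0) /\
      is_derive (fun s => F t s k) x (g t x (F t x k))).
  { intros t k ht hk. apply HX; [lra |]. specialize (HYb k t hk ht). lra. }
  assert (HF0 : forall t k, Rabs (t - t0) < a -> Rabs (k - u0) < a -> F t x0 k = Y k t).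
  { intros t k ht hk. apply HF; assumption. }
  assert (HFx : forall t x k, Box t0 x0 u0 a (t, x, k) -> is_derive (fun s => F t s k) x (g t x (F t x k))).
  { intros t x k (ht & hx & hk). exact (proj2 (proj2 (HF t k ht hk) x hx)). }
  assert (HFb : forall t x k, Box t0 x0 u0 a (t, x, k) -> Rabs (F t x k - u0) <= r / 2).
  { intros t x k (ht & hx & hk). pose proof (proj1 (proj2 (HF t k ht hk) x hx)) as T.
    specialize (HYb k t hk ht).
    replace (F t x k - u0) with ((F t x k - Y k t) + (Y k t - u0)) by ring.
    triangle.
    assert (K * Rabs (x - x0) <= K * a) by (apply Rmult_le_compat_l; lra). lra. }
  assert (HFr : forall t x k, Box t0 x0 u0 a (t, x, k) -> Box t0 x0 u0 r (t, x, F t x k)).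
  { intros t x k B. pose proof (HFb t x k B). destruct B as (ht & hx & hk). box. }
  assert (Bx0 : forall t k, Rabs (t - t0) < a -> Rabs (k - u0) < a -> Box t0 x0 u0 a (t, x0, k)).
  { intros t k ht hk. box. }
  assert (HFx0 : forall t k, Rabs (t - t0) < a -> Rabs (k - u0) < a ->
    is_derive (fun s => F s x0 k) t (h t x0 (F t x0 k))).
  { intros t k ht hk. apply (is_derive_ext_loc (Y k)).
    - apply locally1. exists (a - Rabs (t - t0)). split; [lra |]. intros s hs. symmetry. apply HF0; [| exact hk].
      apply (Rabs_shift _ t), hs.
    - rewrite HF0 by assumption. apply (HY k hk), ht. }
  (* By compatibility, [h] along [F] solves the variational equation of [g] in [t]. *)
  assert (HFt : forall t x k, Box t0 x0 u0 a (t, x, k) -> is_derive (fun s => F s x k) t (h t x (F t x k))).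
  { intros t x k (ht & hx & hk).
    apply (ode_param3 g t0 x0 u0 r K a t 1 t (a - Rabs (t - t0)) K (fun p s => F p s k) (fun s => h t s (F t s k)));
      try assumption; try lra.
    - intros p hp. replace (t + 1 * (p - t)) with p by ring. apply Rabs_shift in hp. lra.
    - intros p s hp hs. apply Rabs_shift in hp.
      replace (t + 1 * (p - t)) with p by ring.
      split; [apply HFb | apply HFx]; box.
    - intros s hs. assert (B : Box t0 x0 u0 a (t, s, k)) by (box).
      split; [| apply (Bh _ _ _ (HFr _ _ _ B))].
      pose proof (BD _ _ _ (HFr _ _ _ B)) as dB.
      pose proof (C1_chain D h (fun _ => t) (fun s => s) (fun s => F t s k) s 0 1 (g t s (F t s k))
        HD (Hh 1%nat) dB (@is_derive_const _ _ _ _) (@is_derive_id _ _) (HFx _ _ _ B)) as T.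
      rewrite Rmult_1_l, <- (Hcompat _ _ _ dB).
      replace (dx h t s (F t s k) + du h t s (F t s k) * g t s (F t s k)) with
        (dt h t s (F t s k) * 0 + dx h t s (F t s k) * 1 + du h t s (F t s k) * g t s (F t s k)) by ring.
      exact T.
    - apply HFx0; assumption. }
  assert (HFcx : forall t x k, Box t0 x0 u0 a (t, x, k) -> continuous (fun s => F t s k) x).
  { intros t x k B. apply (ex_derive_continuous (fun s => F t s k)). exists (g t x (F t x k)). apply HFx, B. }
  assert (HFct : forall t x k, Box t0 x0 u0 a (t, x, k) -> continuous (fun s => F s x k) t).
  { intros t x k B. apply (ex_derive_continuous (fun s => F s x k)). exists (h t x (F t x k)). apply HFt, B. }
  (* [E1] is the candidate for the derivative of [Y k t] in [k], with value 1 at [t0], and [E] the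
     one for [F], which starts from [E1] at [x0]. The factor [1] only matches the shape of
     [exp_linear_ode]. *)
  pose (E1 := fun t k => 1 * exp (RInt (fun s => du h s x0 (F s x0 k)) t0 t)).
  pose (E := fun t x k => E1 t k * exp (RInt (fun s => du g t s (F t s k)) x0 x)).
  assert (HE1 : forall t k, Rabs (t - t0) < a -> Rabs (k - u0) < a ->
    is_derive (fun s => E1 s k) t (du h t x0 (F t x0 k) * E1 t k) /\ Rabs (E1 t k) <= Rabs 1 * exp (K * a)).
  { intros t k ht hk. apply (exp_linear_ode (fun s => du h s x0 (F s x0 k)) t0 a K 1); try assumption.
    intros s hs. pose proof (HFr _ _ _ (Bx0 s k hs hk)) as B. split.
    - apply (cont3_curve (du h) (fun s => s) (fun _ => x0) (fun s => F s x0 k)).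
      + apply (Ck_cont D 0); [apply Ck_du, Hh | apply BD, B].
      + apply continuous_id.
      + apply continuous_const.
      + apply HFct, Bx0; assumption.
    - apply (bd2_1 _ _ _ _ _ (Bh _ _ _ B)). }
  assert (HE : forall t x k, Box t0 x0 u0 a (t, x, k) ->
    is_derive (fun s => E t s k) x (du g t x (F t x k) * E t x k) /\
    Rabs (E t x k) <= Rabs (E1 t k) * exp (K * a)).
  { intros t x k (ht & hx & hk).
    apply (exp_linear_ode (fun s => du g t s (F t s k)) x0 a K (E1 t k)); try assumption.
    intros s hs. assert (B0 : Box t0 x0 u0 a (t, s, k)) by (box).
    pose proof (HFr _ _ _ B0) as B. split.
    - apply (cont3_curve (du g) (fun _ => t) (fun s => s) (fun s => F t s k)).
      + apply (Ck_cont D 0); [apply Ck_du, Hg | apply BD, B].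
      + apply continuous_const.
      + apply continuous_id.
      + apply HFcx, B0.
    - apply (bd2_1 _ _ _ _ _ (Bg _ _ _ B)). }
  pose (N := exp (K * a)). assert (HN : 0 < N) by apply exp_pos.
  assert (HFk0 : forall t k, Rabs (t - t0) < a -> Rabs (k - u0) < a -> is_derive (fun p => F t x0 p) k (E1 t k)).
  { intros t k ht hk.
    apply (ode_param3 (fun p s y => h s p y) x0 t0 u0 r K a x0 0 k (a - Rabs (k - u0)) N
       (fun p s => F s x0 p) (fun s => E1 s k)); try assumption; try lra.
    - intros x s y (b1 & b2 & b3). apply (bd2_swap K h), Bh. box.
    - intros p hp. replace (x0 + 0 * (p - k) - x0) with 0 by ring. rewrite Rabs_R0; exact Hr.
    - intros p s hp hs. apply Rabs_shift in hp. replace (x0 + 0 * (p - k)) with x0 by ring. split.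
      + apply HFb, Bx0; assumption.
      + apply HFx0; assumption.
    - intros s hs. destruct (HE1 s k hs hk) as [T1 T2]. split.
      + rewrite Rmult_0_l, Rplus_0_l. exact T1.
      + rewrite Rabs_R1, Rmult_1_l in T2. exact T2.
    - replace (E1 t0 k) with 1.
      2: { unfold E1. rewrite RInt_point. unfold zero; simpl. rewrite exp_0. ring. }
      apply (is_derive_ext_loc (fun p => p)); [| apply @is_derive_id].
      apply locally1. exists (a - Rabs (k - u0)). split; [lra |]. intros p hp. apply Rabs_shift in hp.
      rewrite HF0; [| rewrite Rabs_sub_same; exact Ha | exact hp]. symmetry. apply (HY p hp). }
  assert (HFk : forall t x k, Box t0 x0 u0 a (t, x, k) -> is_derive (fun p => F t x p) k (E t x k)).
  { intros t x k (ht & hx & hk).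
    apply (ode_param3 g t0 x0 u0 r K a t 0 k (a - Rabs (k - u0)) (N * N)
       (fun p s => F t s p) (fun s => E t s k)); try assumption; try lra.
    - apply Rmult_le_pos; lra.
    - intros p hp. replace (t + 0 * (p - k) - t0) with (t - t0) by ring. lra.
    - intros p s hp hs. apply Rabs_shift in hp. replace (t + 0 * (p - k)) with t by ring.
      split; [apply HFb | apply HFx]; box.
    - intros s hs. assert (B : Box t0 x0 u0 a (t, s, k)) by (box).
      destruct (HE t s k B) as [T1 T2]. split.
      + rewrite Rmult_0_l, Rplus_0_l. exact T1.
      + destruct (HE1 t k ht hk) as [_ T3]. rewrite Rabs_R1, Rmult_1_l in T3.
        eapply Rle_trans; [exact T2 |]. apply Rmult_le_compat_r; [lra | exact T3].
    - replace (E t x0 k) with (E1 t k).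
      2: { unfold E. rewrite RInt_point. unfold zero; simpl. rewrite exp_0. ring. }
      apply HFk0; assumption. }
  exists F, a. split; [exact Ha |]. split; [| split].
  - intros t x k B. exact (conj (BD _ _ _ (HFr _ _ _ B)) (conj (HFt _ _ _ B) (HFx _ _ _ B))).
  - intros k hk. assert (h0 : Rabs (t0 - t0) < a) by (rewrite Rabs_sub_same; exact Ha).
    rewrite (HF0 t0 k h0 hk). apply (HY k hk).
  (* The three partial derivatives of [F] are expressed through [F] itself, so each step of the
     induction gains one derivative. *)
  - set (B := Box t0 x0 u0 a). assert (HB : open B) by apply open_Box.
    assert (HB' : open (Box x0 t0 u0 a)) by apply open_Box.
    induction n as [| n IH].
    + apply (bd1_Ck0 _ _ _ _ (K + N * N)).
      { assert (0 <= N * N) by (apply Rmult_le_pos; lra). lra. }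
      intros t x k b. assert (HNN : 0 <= N * N) by (apply Rmult_le_pos; lra).
      apply (is_d3_bd1 _ F (fun t x k => h t x (F t x k)) (fun t x k => g t x (F t x k)) E _ _ _ (conj (HFt _ _ _ b) (conj (HFx _ _ _ b) (HFk _ _ _ b)))).
      * destruct (Bh _ _ _ (HFr _ _ _ b)) as [T _]. lra.
      * destruct (Bg _ _ _ (HFr _ _ _ b)) as [T _]. lra.
      * destruct (HE _ _ _ b) as [_ T2]. destruct b as (b1 & b2 & b3).
        destruct (HE1 t k b1 b3) as [_ T3]. rewrite Rabs_R1, Rmult_1_l in T3.
        assert (T : Rabs (E1 t k) * exp (K * a) <= N * N) by (apply Rmult_le_compat_r; [lra | exact T3]).
        lra.
    + assert (HG : forall f, Ck n D f -> Ck n B (fun t x k => f t x (F t x k))).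
      { intros f Hf. apply (Ck_comp n B D f (fun t _ _ => t) (fun _ x _ => x) F); try assumption.
        - apply Ck_t, HB.
        - apply Ck_x, HB.
        - intros t x k b. apply BD, HFr, b. }
      (* [Ck_RInt] integrates in the middle variable, so the integral over [t] inside [E1] is
         handled with the first two variables exchanged. *)
      assert (HG0 : Ck n (Box x0 t0 u0 a) (fun x t k => du h t x0 (F t x0 k))).
      { apply (Ck_comp n (Box x0 t0 u0 a) B (fun t x k => du h t x (F t x k))
          (fun _ t _ => t) (fun _ _ _ => x0) (fun _ _ k => k)); try assumption.
        - apply HG, Ck_du, Hh.
        - apply Ck_x, HB'.
        - apply Ck_const, HB'.
        - apply Ck_u, HB'.
        - intros x t k (b1 & b2 & b3). apply Bx0; assumption. }
      apply (Ck_S_intro B HB n F (fun t x k => h t x (F t x k)) (fun t x k => g t x (F t x k)) E IH).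
      * intros t x k b. exact (conj (HFt _ _ _ b) (conj (HFx _ _ _ b) (HFk _ _ _ b))).
      * apply HG, Hh.
      * apply HG, Hg.
      * apply Ck_mult; [exact HB | |].
        -- apply Ck_mult; [exact HB | apply Ck_const, HB |]. apply Ck_exp; [exact HB |].
           apply (Ck_comp n B (Box x0 t0 u0 a)
             (fun x t k => RInt (fun s => du h s x0 (F s x0 k)) t0 t)
             (fun _ x _ => x) (fun t _ _ => t) (fun _ _ k => k)); try assumption.
           ++ apply (Ck_RInt x0 t0 u0 a Ha n (fun x t k => du h t x0 (F t x0 k))). exact HG0.
           ++ apply Ck_x, HB.
           ++ apply Ck_t, HB.
           ++ apply Ck_u, HB.
           ++ intros t x k (b1 & b2 & b3). box.
        -- apply Ck_exp; [exact HB |].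
           apply (Ck_RInt t0 x0 u0 a Ha n (fun t x k => du g t x (F t x k))). apply HG, Ck_du, Hg.
Qed.

(** * Analytic functions are smooth *)

Lemma ex_series_bounded (a b : nat -> R) :
  (forall n, Rabs (a n) <= b n) -> ex_series b -> ex_series a.
Proof. exact (ex_series_le (K := R_AbsRing) (V := R_CompleteNormedModule) a b). Qed.

Lemma ex_series_Rmult_l (c : R) (a : nat -> R) : ex_series a -> ex_series (fun n => c * a n).
Proof. exact (ex_series_scal (K := R_AbsRing) (V := R_NormedModule) c a). Qed.

Lemma Series_bounded (a b : nat -> R) :
  (forall n, Rabs (a n) <= b n) -> ex_series b -> Rabs (Series a) <= Series b.
Proof.
  intros H Hb.
  assert (Ha : ex_series (fun n => Rabs (a n))).
  { apply (ex_series_bounded _ b); [| exact Hb]. intros n. rewrite Rabs_Rabsolu. apply H. }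
  eapply Rle_trans; [apply Series_Rabs, Ha |]. apply Series_le; [| exact Hb].
  intros n. split; [apply Rabs_pos | apply H].
Qed.

Lemma Series_term_le (a : nat -> R) n : (forall n, 0 <= a n) -> ex_series a -> a n <= Series a.
Proof.
  intros H Ha. apply Rle_trans with (sum_n a n).
  - destruct n as [| n]; [rewrite sum_O; lra |].
    rewrite sum_Sn. unfold plus; simpl.
    assert (0 <= sum_n a n).
    { induction n as [| n IH]; [rewrite sum_O; apply H |]. rewrite sum_Sn. unfold plus; simpl.
      specialize (H (S n)). lra. }
    lra.
  - apply (is_lim_seq_incr_compare (sum_n a) (Series a)).
    + apply (Series_correct a Ha).
    + intros m. rewrite sum_Sn. unfold plus; simpl. specialize (H (S m)). lra.
Qed.

Definition coef_norm (a : nat -> nat -> R) (rho : R) (i : nat) : R :=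
  Series (fun j => Rabs (a i j) * rho ^ j).

(* Unlike [analytic2], this condition is visibly stable under termwise differentiation. *)
Definition summable2 (a : nat -> nat -> R) (r : R) : Prop :=
  forall rho, 0 < rho < r ->
    (forall i, ex_series (fun j => Rabs (a i j) * rho ^ j)) /\
    ex_series (fun i => coef_norm a rho i * rho ^ i).

(** The rows are summed first: a power series in [h] whose coefficients are power series in [k].
    This asymmetry is why the two partial derivatives are treated differently. *)
Definition psum2 (a : nat -> nat -> R) (h k : R) : R := PSeries (fun i => PSeries (a i) k) h.

Definition coef_dh (a : nat -> nat -> R) (i j : nat) : R := INR (S i) * a (S i) j.
Definition coef_dk (a : nat -> nat -> R) (i j : nat) : R := INR (S j) * a i (S j).

Lemma pow_abs_le (k rho : R) n : Rabs k <= rho -> Rabs (k ^ n) <= rho ^ n.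
Proof. intros H. rewrite <- RPow_abs. apply pow_incr. split; [apply Rabs_pos | exact H]. Qed.

Lemma coef_norm_pos a rho i : 0 < rho -> (forall i, ex_series (fun j => Rabs (a i j) * rho ^ j)) ->
  0 <= coef_norm a rho i.
Proof.
  intros H Ha. unfold coef_norm. apply Rle_trans with (Rabs (a i O) * rho ^ 0).
  - apply Rmult_le_pos; [apply Rabs_pos | apply pow_le; lra].
  - apply (Series_term_le (fun j => Rabs (a i j) * rho ^ j)); [| apply Ha].
    intros n. apply Rmult_le_pos; [apply Rabs_pos | apply pow_le; lra].
Qed.

Lemma coef_norm_mono a rho rho1 i : 0 < rho <= rho1 ->
  (forall i, ex_series (fun j => Rabs (a i j) * rho1 ^ j)) -> coef_norm a rho i <= coef_norm a rho1 i.
Proof.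
  intros H Ha. apply Series_le; [| apply Ha]. intros n. split.
  - apply Rmult_le_pos; [apply Rabs_pos | apply pow_le; lra].
  - apply Rmult_le_compat_l; [apply Rabs_pos | apply pow_incr; lra].
Qed.

Lemma inner_le a r rho k i : summable2 a r -> 0 < rho < r -> Rabs k <= rho ->
  Rabs (PSeries (a i) k) <= coef_norm a rho i.
Proof.
  intros Ha Hr Hk. apply Series_bounded; [| apply (Ha rho Hr)].
  intros j. rewrite Rabs_mult. apply Rmult_le_compat_l; [apply Rabs_pos | apply pow_abs_le, Hk].
Qed.

Lemma outer_le a r rho h k i : summable2 a r -> 0 < rho < r -> Rabs k <= rho -> Rabs h <= rho ->
  Rabs (PSeries (a i) k * h ^ i) <= coef_norm a rho i * rho ^ i.
Proof.
  intros Ha Hr Hk Hh. rewrite Rabs_mult. apply Rmult_le_compat; try apply Rabs_pos.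
  - apply (inner_le a r); assumption.
  - apply pow_abs_le, Hh.
Qed.

Lemma psum2_bound a r rho h k : summable2 a r -> 0 < rho < r -> Rabs k <= rho -> Rabs h <= rho ->
  Rabs (psum2 a h k) <= Series (fun i => coef_norm a rho i * rho ^ i).
Proof.
  intros Ha Hr Hk Hh. apply Series_bounded; [| apply (Ha rho Hr)].
  intros i. apply (outer_le a r); assumption.
Qed.

Lemma psum2_ex a r rho h k : summable2 a r -> 0 < rho < r -> Rabs k <= rho -> Rabs h <= rho ->
  ex_series (fun i => PSeries (a i) k * h ^ i).
Proof.
  intros Ha Hr Hk Hh. eapply ex_series_bounded; [| apply (Ha rho Hr)].
  intros i. apply (outer_le a r); assumption.
Qed.

(** Terms of a summable sequence are bounded, and boundedness at [rho] puts the radius of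
    convergence at [rho] or beyond, strictly above [Rabs h]. *)
Lemma CV_radius_gt (c : nat -> R) (rho h : R) (b : nat -> R) : Rabs h < rho ->
  (forall n, Rabs (c n) * rho ^ n <= b n) -> ex_series b -> Rbar_lt (Rabs h) (CV_radius c).
Proof.
  intros Hh Hc Hb. assert (0 < rho) by (pose proof (Rabs_pos h); lra).
  apply Rbar_lt_le_trans with rho; [exact Hh |].
  apply (proj1 (CV_radius_bounded c)). exists (Series b).
  intros n. rewrite Rabs_mult, (Rabs_pos_eq (rho ^ n)) by (apply pow_le; lra).
  eapply Rle_trans; [apply Hc |]. apply Series_term_le; [| exact Hb].
  intros m. eapply Rle_trans; [| apply Hc]. apply Rmult_le_pos; [apply Rabs_pos | apply pow_le; lra].
Qed.

(** The factor [S n] produced by differentiation is paid for by a larger radius. With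
    [rho1 = rho * (1 + d)], Bernoulli's inequality gives [(1 + d) ^ n >= 1 + n * d], and [1 + / d]
    times this is at least [n + 1]; dividing by [rho1] adjusts the exponent to [S n]. *)
Lemma succ_pow_le (rho rho1 : R) : 0 < rho < rho1 ->
  exists C, 0 <= C /\ forall n, INR (S n) * rho ^ n <= C * rho1 ^ (S n).
Proof.
  intros H. pose (d := rho1 / rho - 1).
  assert (Hd : 0 < d).
  { unfold d. assert (1 < rho1 / rho); [| lra]. apply Rmult_lt_reg_r with rho; [lra |].
    unfold Rdiv. rewrite Rmult_assoc, Rinv_l by lra. lra. }
  exists ((1 + / d) / rho1).
  assert (Hid : 0 < / d) by (apply Rinv_0_lt_compat, Hd).
  split.
  { apply Rmult_le_pos; [lra |]. left. apply Rinv_0_lt_compat. lra. }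
  intros n.
  replace ((1 + / d) / rho1 * rho1 ^ S n) with ((1 + / d) * rho1 ^ n) by (simpl; field; lra).
  replace (rho1 ^ n) with (rho ^ n * (1 + d) ^ n).
  2: { rewrite <- Rpow_mult_distr. f_equal. unfold d. field. lra. }
  pose proof (poly n d Hd) as Hp.
  assert (Hr : 0 < rho ^ n) by (apply pow_lt; lra).
  rewrite S_INR. pose proof (pos_INR n) as Hn.
  assert (E : (1 + / d) * (1 + INR n * d) = (INR n + 1) + (INR n * d + / d)) by (field; lra).
  assert (T : INR n + 1 <= (1 + / d) * (1 + d) ^ n).
  { apply Rle_trans with ((1 + / d) * (1 + INR n * d)); [| apply Rmult_le_compat_l; lra].
    rewrite E. assert (0 <= INR n * d) by (apply Rmult_le_pos; lra). lra. }
  replace ((1 + / d) * (rho ^ n * (1 + d) ^ n)) with (((1 + / d) * (1 + d) ^ n) * rho ^ n) by ring.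
  apply Rmult_le_compat_r; lra.
Qed.

(** Since [summable2] asks for every radius below [r], the loss of [succ_pow_le] is absorbed at the
    midpoint [rho1] between [rho] and [r]. *)
Lemma summable2_dh a r : summable2 a r -> summable2 (coef_dh a) r.
Proof.
  intros Ha rho Hr.
  assert (H1 : 0 < (rho + r) / 2 < r) by lra. set (rho1 := (rho + r) / 2) in *.
  assert (H01 : 0 < rho < rho1) by (unfold rho1; lra).
  destruct (succ_pow_le rho rho1 H01) as (C & HC & HCn).
  destruct (Ha rho Hr) as [A1 _]. destruct (Ha rho1 H1) as [B1 B2].
  assert (E : forall i j, Rabs (coef_dh a i j) * rho ^ j = INR (S i) * (Rabs (a (S i) j) * rho ^ j)).
  { intros i j. unfold coef_dh. rewrite Rabs_mult, (Rabs_pos_eq (INR (S i))) by apply pos_INR. ring. }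
  split.
  - intros i. apply (ex_series_ext (fun j => INR (S i) * (Rabs (a (S i) j) * rho ^ j))).
    + intros j. symmetry. apply E.
    + apply (ex_series_Rmult_l), A1.
  - assert (E2 : forall i, coef_norm (coef_dh a) rho i = INR (S i) * coef_norm a rho (S i)).
    { intros i. unfold coef_norm. rewrite <- Series_scal_l. apply Series_ext, E. }
    apply (ex_series_bounded _ (fun i => C * (coef_norm a rho1 (S i) * rho1 ^ (S i)))).
    + intros i. rewrite E2.
      pose proof (coef_norm_pos a rho (S i) (proj1 H01) A1) as P1.
      assert (P2 : coef_norm a rho (S i) <= coef_norm a rho1 (S i)).
      { apply coef_norm_mono; [lra | exact B1]. }
      rewrite Rabs_pos_eq.
      2: { apply Rmult_le_pos; [apply Rmult_le_pos; [apply pos_INR | exact P1] | apply pow_le; lra]. }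
      replace (INR (S i) * coef_norm a rho (S i) * rho ^ i) with (coef_norm a rho (S i) * (INR (S i) * rho ^ i)) by ring.
      replace (C * (coef_norm a rho1 (S i) * rho1 ^ S i)) with (coef_norm a rho1 (S i) * (C * rho1 ^ S i)) by ring.
      apply Rmult_le_compat; [exact P1 | | exact P2 | apply HCn].
      apply Rmult_le_pos; [apply pos_INR | apply pow_le; lra].
    + apply (ex_series_Rmult_l).
      apply (ex_series_incr_1 (fun i => coef_norm a rho1 i * rho1 ^ i)), B2.
Qed.

Lemma summable2_dk a r : summable2 a r -> summable2 (coef_dk a) r.
Proof.
  intros Ha rho Hr.
  assert (H1 : 0 < (rho + r) / 2 < r) by lra. set (rho1 := (rho + r) / 2) in *.
  assert (H01 : 0 < rho < rho1) by (unfold rho1; lra).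
  destruct (succ_pow_le rho rho1 H01) as (C & HC & HCn).
  destruct (Ha rho1 H1) as [B1 B2].
  assert (E : forall i j, Rabs (Rabs (coef_dk a i j) * rho ^ j) <= C * (Rabs (a i (S j)) * rho1 ^ (S j))).
  { intros i j. unfold coef_dk. rewrite !Rabs_mult, Rabs_Rabsolu.
    rewrite (Rabs_pos_eq (INR (S j))) by apply pos_INR.
    rewrite (Rabs_pos_eq (rho ^ j)) by (apply pow_le; lra). specialize (HCn j).
    pose proof (Rabs_pos (a i (S j))). rewrite Rabs_Rabsolu.
    replace (INR (S j) * Rabs (a i (S j)) * rho ^ j) with (Rabs (a i (S j)) * (INR (S j) * rho ^ j)) by ring.
    replace (C * (Rabs (a i (S j)) * rho1 ^ S j)) with (Rabs (a i (S j)) * (C * rho1 ^ S j)) by ring.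
    apply Rmult_le_compat_l; assumption. }
  assert (X : forall i, ex_series (fun j => C * (Rabs (a i (S j)) * rho1 ^ (S j)))).
  { intros i. apply (ex_series_Rmult_l).
    apply (ex_series_incr_1 (fun j => Rabs (a i j) * rho1 ^ j)), B1. }
  assert (A : forall i, ex_series (fun j => Rabs (coef_dk a i j) * rho ^ j)).
  { intros i. eapply ex_series_bounded; [apply E | apply X]. }
  split; [exact A |].
  apply (ex_series_bounded _ (fun i => C * (coef_norm a rho1 i * rho1 ^ i))).
  - intros i.
    pose proof (coef_norm_pos (coef_dk a) rho i (proj1 H01) A) as P1.
    rewrite Rabs_pos_eq by (apply Rmult_le_pos; [exact P1 | apply pow_le; lra]).
    rewrite <- Rmult_assoc. apply Rmult_le_compat; [exact P1 | apply pow_le; lra | | apply pow_incr; lra].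
    eapply Rle_trans; [apply Rle_abs |]. unfold coef_norm at 1.
    eapply Rle_trans; [apply (Series_bounded _ _ (E i) (X i)) |].
    rewrite Series_scal_l. apply Rmult_le_compat_l; [exact HC |].
    (* The shift of the index omits the term [j = 0], which is nonnegative. *)
    unfold coef_norm. rewrite (Series_incr_1 (fun j => Rabs (a i j) * rho1 ^ j)) by apply B1.
    pose proof (Rabs_pos (a i O)). simpl pow. lra.
  - apply (ex_series_Rmult_l), B2.
Qed.

(** * Termwise differentiation of double power series *)

Lemma between_max (h k r : R) : Rabs h < r -> Rabs k < r ->
  exists rho, 0 < rho < r /\ Rabs h < rho /\ Rabs k < rho.
Proof.
  intros Hh Hk. exists ((Rmax (Rabs h) (Rabs k) + r) / 2).
  pose proof (Rmax_l (Rabs h) (Rabs k)). pose proof (Rmax_r (Rabs h) (Rabs k)).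
  pose proof (Rmax_lub_lt _ _ _ Hh Hk). pose proof (Rabs_pos h). lra.
Qed.

Lemma psum2_dh a r h k : summable2 a r -> Rabs h < r -> Rabs k < r ->
  is_derive (fun h => psum2 a h k) h (psum2 (coef_dh a) h k).
Proof.
  intros Ha Hh Hk. destruct (between_max h k r Hh Hk) as (rho & Hr & Hh' & Hk').
  assert (E : psum2 (coef_dh a) h k = PSeries (PS_derive (fun i => PSeries (a i) k)) h).
  { apply PSeries_ext. intros i. unfold PS_derive, PSeries, coef_dh.
    rewrite <- Series_scal_l. apply Series_ext. intros j. ring. }
  rewrite E. apply (is_derive_PSeries (fun i => PSeries (a i) k)).
  apply (CV_radius_gt _ rho h (fun i => coef_norm a rho i * rho ^ i) Hh'); [| apply (Ha rho Hr)].
  intros n. apply Rmult_le_compat_r; [apply pow_le; lra |]. apply (inner_le a r); [assumption | lra | lra].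
Qed.

Lemma inner_derive a r i k : summable2 a r -> Rabs k < r ->
  is_derive (PSeries (a i)) k (PSeries (coef_dk a i) k).
Proof.
  intros Ha Hk. destruct (between_max k k r Hk Hk) as (rho & Hr & Hk' & _).
  apply (is_derive_PSeries (a i)).
  apply (CV_radius_gt _ rho k (fun j => Rabs (a i j) * rho ^ j) Hk'); [| apply (Ha rho Hr)].
  intros n. lra.
Qed.

(** Two applications of the mean value theorem. The constant is the norm of the twice differentiated
    row, hence independent of [k] and summable against [rho ^ i]. *)
Lemma inner_taylor a r rho i k k' : summable2 a r -> 0 < rho < r -> Rabs k < rho -> Rabs k' < rho ->
  Rabs (PSeries (a i) k' - PSeries (a i) k - PSeries (coef_dk a i) k * (k' - k)) <=
  coef_norm (coef_dk (coef_dk a)) rho i * (Rabs (k' - k) * Rabs (k' - k)).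
Proof.
  intros Ha Hr Hk Hk'.
  assert (Ha1 := summable2_dk a r Ha). assert (Ha2 := summable2_dk _ r Ha1).
  rewrite <- (Rminus_0_r k) in Hk. rewrite <- (Rminus_0_r k') in Hk'.
  assert (I : forall x y z, Rabs (x - 0) < rho -> Rabs (y - 0) < rho -> Rmin x y <= z <= Rmax x y ->
    Rabs z < rho).
  { intros x y z hx hy hz. rewrite <- (Rminus_0_r z). apply (between_ball x y); assumption. }
  destruct (mvt1 (PSeries (a i)) k k') as [z [Hz Ez]].
  { intros z hz. exists (PSeries (coef_dk a i) z). apply (inner_derive a r); [exact Ha |].
    apply Rlt_trans with rho; [| lra]. apply (I k k'); assumption. }
  assert (hz : Rabs z < rho) by (apply (I k k'); assumption).
  rewrite (is_derive_unique _ _ _ (inner_derive a r i z Ha ltac:(lra))) in Ez.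
  rewrite <- (Rminus_0_r z) in hz.
  destruct (mvt1 (PSeries (coef_dk a i)) k z) as [w [Hw Ew]].
  { intros w hw. exists (PSeries (coef_dk (coef_dk a) i) w). apply (inner_derive _ r); [exact Ha1 |].
    apply Rlt_trans with rho; [| lra]. apply (I k z); assumption. }
  assert (hw : Rabs w < rho) by (apply (I k z); assumption).
  rewrite (is_derive_unique _ _ _ (inner_derive _ r i w Ha1 ltac:(lra))) in Ew.
  rewrite Ez, <- Rmult_minus_distr_r, Ew, !Rabs_mult, Rmult_assoc.
  apply Rmult_le_compat; try apply Rabs_pos.
  - apply Rmult_le_pos; apply Rabs_pos.
  - apply (inner_le _ r); [exact Ha2 | exact Hr | lra].
  - apply Rmult_le_compat_r; [apply Rabs_pos | apply between_abs, Hz].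
Qed.

(** In [k] the sum is not a power series with constant coefficients, so it is differentiated row by
    row: the quadratic remainders of the rows add up to a quadratic remainder of the whole. *)
Lemma psum2_dk a r h k : summable2 a r -> Rabs h < r -> Rabs k < r ->
  is_derive (fun k => psum2 a h k) k (psum2 (coef_dk a) h k).
Proof.
  intros Ha Hh Hk. destruct (between_max h k r Hh Hk) as (rho & Hr & Hh' & Hk').
  assert (Ha1 := summable2_dk a r Ha). assert (Ha2 := summable2_dk _ r Ha1).
  apply (is_derive_quad _ k _ (Series (fun i => coef_norm (coef_dk (coef_dk a)) rho i * rho ^ i)) (rho - Rabs k)).
  { lra. }
  intros k' hk.
  assert (Hk2 : Rabs k' < rho).
  { replace k' with ((k' - k) + k) by ring. triangle; lra. }
  assert (X1 : ex_series (fun i => PSeries (a i) k' * h ^ i)) by (apply (psum2_ex a r rho); try assumption; lra).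
  assert (X2 : ex_series (fun i => PSeries (a i) k * h ^ i)) by (apply (psum2_ex a r rho); try assumption; lra).
  assert (X3 : ex_series (fun i => (k' - k) * (PSeries (coef_dk a i) k * h ^ i))).
  { apply (ex_series_Rmult_l).
    apply (psum2_ex _ r rho); try assumption; lra. }
  assert (E : psum2 a h k' - psum2 a h k - psum2 (coef_dk a) h k * (k' - k) =
    Series (fun i => (PSeries (a i) k' - PSeries (a i) k - PSeries (coef_dk a i) k * (k' - k)) * h ^ i)).
  { rewrite (Series_ext _ (fun i => (PSeries (a i) k' * h ^ i - PSeries (a i) k * h ^ i)
        - (k' - k) * (PSeries (coef_dk a i) k * h ^ i))) by (intros; ring).
    rewrite Series_minus; [| apply (ex_series_minus (K := R_AbsRing) (V := R_NormedModule)
      (fun i => PSeries (a i) k' * h ^ i) (fun i => PSeries (a i) k * h ^ i)); assumption | exact X3].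
    rewrite Series_minus by assumption. rewrite Series_scal_l. unfold psum2, PSeries at 1 3 5. ring. }
  rewrite E, <- Series_scal_r.
  apply Series_bounded.
  - intros i. rewrite Rabs_mult.
    replace (coef_norm (coef_dk (coef_dk a)) rho i * rho ^ i * (Rabs (k' - k) * Rabs (k' - k))) with
      (coef_norm (coef_dk (coef_dk a)) rho i * (Rabs (k' - k) * Rabs (k' - k)) * rho ^ i) by ring.
    apply Rmult_le_compat; try apply Rabs_pos.
    + apply (inner_taylor a r); assumption.
    + apply pow_abs_le. lra.
  - apply (ex_series_scal_r (Rabs (k' - k) * Rabs (k' - k))). apply (Ha2 rho Hr).
Qed.

Lemma psum2_Ck (t0 x0 u0 r : R) n a : 0 < r -> summable2 a r ->
  Ck n (Box t0 x0 u0 r) (fun t x _ => psum2 a (t - t0) (x - x0)).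
Proof.
  intros Hr. revert a.
  assert (Sh : forall a t x u, summable2 a r -> Box t0 x0 u0 r (t, x, u) ->
    is_d3 (fun t x _ => psum2 a (t - t0) (x - x0))
     (fun t x _ => psum2 (coef_dh a) (t - t0) (x - x0)) (fun t x _ => psum2 (coef_dk a) (t - t0) (x - x0))
     (fun _ _ _ => 0) t x u).
  { intros a t x u Ha (b1 & b2 & b3). split; [| split].
    - rewrite <- (Rmult_1_l (psum2 (coef_dh a) (t - t0) (x - x0))).
      apply (is_derive_comp (fun h => psum2 a h (x - x0)) (fun s => s - t0)).
      + apply (psum2_dh a r); assumption.
      + auto_derive; [exact I | reflexivity].
    - rewrite <- (Rmult_1_l (psum2 (coef_dk a) (t - t0) (x - x0))).
      apply (is_derive_comp (fun k => psum2 a (t - t0) k) (fun s => s - x0)).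
      + apply (psum2_dk a r); assumption.
      + auto_derive; [exact I | reflexivity].
    - apply @is_derive_const. }
  induction n as [| n IH]; intros a Ha.
  - apply Ck_0. intros t x u (b1 & b2 & b3).
    destruct (between_max _ _ _ b1 b2) as (rho & Hrho & h1 & h2).
    destruct (between_max _ _ _ b3 b3) as (rho' & Hrho' & h3 & _).
    (* The derivative sums need not be bounded up to radius [r], so continuity is proved in a
       smaller box. Its radius must also exceed [Rabs (u - u0)], since a box has the same radius in
       all directions. *)
    pose (m := Rmax rho rho').
    assert (Hm : 0 < m < r).
    { split; [eapply Rlt_le_trans; [apply Hrho | apply Rmax_l] | apply Rmax_lub_lt; [apply Hrho | apply Hrho']]. }
    assert (L1 : rho <= m) by apply Rmax_l. assert (L2 : rho' <= m) by apply Rmax_r.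
    pose (K1 := Series (fun i => coef_norm (coef_dh a) m i * m ^ i)).
    pose (K2 := Series (fun i => coef_norm (coef_dk a) m i * m ^ i)).
    assert (B1 : forall h k, Rabs h < m -> Rabs k < m -> Rabs (psum2 (coef_dh a) h k) <= K1).
    { intros h k hh hk. apply (psum2_bound _ r); [apply summable2_dh, Ha | exact Hm | lra | lra]. }
    assert (B2 : forall h k, Rabs h < m -> Rabs k < m -> Rabs (psum2 (coef_dk a) h k) <= K2).
    { intros h k hh hk. apply (psum2_bound _ r); [apply summable2_dk, Ha | exact Hm | lra | lra]. }
    assert (P1 : 0 <= K1).
    { apply Rle_trans with (Rabs (psum2 (coef_dh a) 0 0)); [apply Rabs_pos |]. apply B1; rewrite Rabs_R0; lra. }
    assert (P2 : 0 <= K2).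
    { apply Rle_trans with (Rabs (psum2 (coef_dk a) 0 0)); [apply Rabs_pos |]. apply B2; rewrite Rabs_R0; lra. }
    assert (Z : Ck 0 (Box t0 x0 u0 m) (fun t x _ => psum2 a (t - t0) (x - x0))).
    { apply (bd1_Ck0 _ _ _ _ (K1 + K2)); [lra |]. intros t' x' u' B.
      assert (B' : Box t0 x0 u0 r (t', x', u')) by (eapply Box_mono; [| exact B]; lra).
      destruct B as (c1 & c2 & c3). specialize (B1 _ _ c1 c2). specialize (B2 _ _ c1 c2).
      apply (is_d3_bd1 _ _ _ _ _ _ _ _ (Sh a t' x' u' Ha B')); [lra | lra | rewrite Rabs_R0; lra]. }
    apply (Ck_cont _ 0 _ t x u Z). box.
  - apply (Ck_S_intro _ (open_Box _ _ _ _) n _ _ _ _ (IH a Ha) (fun t x u => Sh a t x u Ha)).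
    + apply IH, summable2_dh, Ha.
    + apply IH, summable2_dk, Ha.
    + apply Ck_const, open_Box.
Qed.

Lemma analytic2_Ck (f : R -> R -> R) (t0 x0 : R) : analytic2 f t0 x0 ->
  exists r, 0 < r /\ forall u0 n, Ck n (Box t0 x0 u0 r) (fun t x _ => f t x).
Proof.
  intros (a & r & H).
  exists r. split; [apply cond_pos |].
  (* Absolute convergence at [h = k = rho] is precisely the condition for the radius [rho], up to
     moving the factor [rho ^ i] across the inner sum. *)
  assert (Ha : summable2 a r).
  { intros rho Hr.
    assert (Hrho : Rabs rho < r) by (rewrite Rabs_pos_eq; lra).
    destruct (H rho rho Hrho Hrho) as (H1 & H2 & _).
    assert (E : forall i j, Rabs (a i j * rho ^ i * rho ^ j) = rho ^ i * (Rabs (a i j) * rho ^ j)).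
    { intros i j. rewrite !Rabs_mult, (Rabs_pos_eq (rho ^ i)), (Rabs_pos_eq (rho ^ j)) by (apply pow_le; lra). ring. }
    split.
    - intros i. assert (Hp : 0 < rho ^ i) by (apply pow_lt; lra).
      apply (ex_series_ext (fun j => / rho ^ i * Rabs (a i j * rho ^ i * rho ^ j))).
      + intros j. rewrite E. match goal with |- ?x = ?y => change (@eq R x y) end. field. lra.
      + apply (ex_series_Rmult_l), H1.
    - apply (ex_series_ext (fun i => Series (fun j => Rabs (a i j * rho ^ i * rho ^ j)))); [| exact H2].
      intros i. unfold coef_norm. rewrite Rmult_comm, <- Series_scal_l. apply Series_ext, E. }
  intros u0 n.
  apply (Ck_ext _ (open_Box _ _ _ _) n (fun t x _ => psum2 a (t - t0) (x - x0))).
  - intros t x u (b1 & b2 & _). destruct (H (t - t0) (x - x0) b1 b2) as (_ & _ & H3).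
    replace (t0 + (t - t0)) with t in H3 by ring. replace (x0 + (x - x0)) with x in H3 by ring.
    rewrite <- (is_series_unique _ _ H3). unfold psum2, PSeries at 1. apply Series_ext. intros i.
    unfold PSeries. rewrite <- Series_scal_r. apply Series_ext. intros j. ring.
  - apply psum2_Ck; [apply cond_pos | exact Ha].
Qed.

Lemma analytic_coefficients (A B C : R -> R -> R) (t0 x0 : R) :
  analytic2 A t0 x0 -> analytic2 B t0 x0 -> analytic2 C t0 x0 ->
  exists r, 0 < r /\ forall u0 n, Ck n (Box t0 x0 u0 r) (fun t x _ => A t x) /\
    Ck n (Box t0 x0 u0 r) (fun t x _ => B t x) /\ Ck n (Box t0 x0 u0 r) (fun t x _ => C t x).
Proof.
  intros hA hB hC.
  destruct (analytic2_Ck A t0 x0 hA) as (r1 & R1 & A1).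
  destruct (analytic2_Ck B t0 x0 hB) as (r2 & R2 & B1).
  destruct (analytic2_Ck C t0 x0 hC) as (r3 & R3 & C1).
  exists (Rmin r1 (Rmin r2 r3)). split; [repeat apply Rmin_glb_lt; assumption |]. intros u0 n.
  split; [| split].
  - apply (Ck_mono n _ (Box t0 x0 u0 r1)); [| apply A1]. intros p. apply Box_mono, Rmin_l.
  - apply (Ck_mono n _ (Box t0 x0 u0 r2)); [| apply B1]. intros p. apply Box_mono.
    eapply Rle_trans; [apply Rmin_r | apply Rmin_l].
  - apply (Ck_mono n _ (Box t0 x0 u0 r3)); [| apply C1]. intros p. apply Box_mono.
    eapply Rle_trans; [apply Rmin_r | apply Rmin_r].
Qed.

(** * Prolongation of operators with zero coefficient of d/dt *)

(* The value of [u_t] forced by the equation when [u_x = g(t, x, u)]. *)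
Definition evol_rhs (A B C : R -> R -> R) (g : R -> R -> R -> R) (t x u : R) : R :=
  A t x * (dx g t x u + g t x u * du g t x u) + B t x * g t x u + C t x * u.

(* [D_t g - D_x h] on solutions of [u_x = g], [u_t = h]. *)
Definition compat_defect (A B C : R -> R -> R) (g : R -> R -> R -> R) (t x u : R) : R :=
  dt g t x u + evol_rhs A B C g t x u * du g t x u
  - (dx (evol_rhs A B C g) t x u + g t x u * du (evol_rhs A B C g) t x u).

Definition over (W : R * R * R -> Prop) (j : jet) : Prop := W (j ct, j cx, j cu).

Notation "f @@ j" := (f (j ct) (j cx) (j cu)) (at level 11, no associativity).

(** The total derivative [D_x f] of a function [f] of order zero. *)
Definition vfield1 (f : R -> R -> R -> R) (j : jet) : R :=
  dx f @@ j + j cux * du f @@ j.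

Lemma locally_over W j : open W -> over W j ->
  forall c, locally (j c) (fun s => over W (upd j c s)).
Proof.
  intros HW h c. destruct (open3_slices W _ _ _ HW h) as (l1 & l2 & l3).
  destruct c; try assumption; apply filter_forall; intros s; exact h.
Qed.

Ltac derive_by_hyps :=
  auto_derive; [repeat split; eexists; eassumption |
    repeat match goal with
    | H : is_derive ?f ?s ?l |- _ =>
        apply is_derive_unique in H; change (fun z : R => f z) with f; rewrite H; clear H
    end; ring].

Lemma vfield_derive (a b c d : R -> R) (s a' b' c' d' v : R) :
  is_derive a s a' -> is_derive b s b' -> is_derive c s c' -> is_derive d s d' ->
  is_derive (fun s => a s + v * b s - v * (c s + v * d s)) s (a' + v * b' - v * (c' + v * d')).
Proof.
  intros Ha Hb Hc Hd. derive_by_hyps.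
Qed.

Lemma minus_scaled_derive (a b : R -> R) (s a' b' v : R) : is_derive a s a' -> is_derive b s b' ->
  is_derive (fun s => a s - b s * v) s (a' - b' * v).
Proof.
  intros Ha Hb. apply (is_derive_minus (V := R_NormedModule) a (fun s => b s * v)); [exact Ha |].
  apply (is_derive_ext (fun s => v * b s)); [intros; apply Rmult_comm |].
  rewrite (Rmult_comm b'). apply is_derive_scal, Hb.
Qed.

(** Moving one jet coordinate a little keeps the base point in the open set [W], so formulas valid
    over [W] may be differentiated there. *)
Lemma pd_ext_over W j c F G : open W -> over W j -> (forall j', over W j' -> F j' = G j') ->
  pd c F j = pd c G j.
Proof.
  intros HW h E. apply Derive_ext_loc. generalize (locally_over W j HW h c).
  apply filter_imp. intros s. apply E.
Qed.

Ltac derive_Lop :=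
  apply is_derive_unique; unfold Lop, upd; simpl; auto_derive; [exact I | ring].

Section Prolongation.

Variables (A B C : R -> R -> R) (Q : operator) (W : R * R * R -> Prop).
Hypothesis HW : open W.
Hypothesis Htau : forall t x u, W (t, x, u) -> tau Q t x u = 0.
Hypothesis Hxi : Ck 2 W (xi Q).
Hypothesis Heta : Ck 2 W (eta Q).

Lemma tau_d3 t x u : W (t, x, u) ->
  dt (tau Q) t x u = 0 /\ dx (tau Q) t x u = 0 /\ du (tau Q) t x u = 0.
Proof.
  intros w. destruct (open3_slices W t x u HW w) as (l1 & l2 & l3).
  unfold dt, dx, du.
  split; [| split]; (rewrite (Derive_ext_loc _ (fun _ => 0)); [apply Derive_const |]).
  - generalize l1. apply filter_imp. intros s. apply Htau.
  - generalize l2. apply filter_imp. intros s. apply Htau.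
  - generalize l3. apply filter_imp. intros s. apply Htau.
Qed.

Lemma total_t_lift3 f j : total_t (lift3 f) j =
  dt f @@ j + j cut * du f @@ j.
Proof.
  unfold total_t.
  change (pd ct (lift3 f) j) with (dt f @@ j).
  change (pd cu (lift3 f) j) with (du f @@ j).
  change (pd cut (lift3 f) j) with (Derive (fun _ => f @@ j) (j cut)).
  change (pd cux (lift3 f) j) with (Derive (fun _ => f @@ j) (j cux)).
  rewrite !Derive_const. ring.
Qed.

Lemma total_x_lift3 f j : total_x (lift3 f) j = vfield1 f j.
Proof.
  unfold total_x, vfield1.
  change (pd cx (lift3 f) j) with (dx f @@ j).
  change (pd cu (lift3 f) j) with (du f @@ j).
  change (pd cut (lift3 f) j) with (Derive (fun _ => f @@ j) (j cut)).
  change (pd cux (lift3 f) j) with (Derive (fun _ => f @@ j) (j cux)).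
  rewrite !Derive_const. ring.
Qed.

Lemma eta_t_over j : over W j -> eta_t Q j =
  dt (eta Q) @@ j + j cut * du (eta Q) @@ j
  - j cux * (dt (xi Q) @@ j + j cut * du (xi Q) @@ j).
Proof.
  intros w. unfold eta_t. rewrite !total_t_lift3.
  destruct (tau_d3 _ _ _ w) as (-> & _ & ->). ring.
Qed.

Lemma eta_x_over j : over W j -> eta_x Q j = vfield1 (eta Q) j - j cux * vfield1 (xi Q) j.
Proof.
  intros w. unfold eta_x. rewrite !total_x_lift3. unfold vfield1 at 2.
  destruct (tau_d3 _ _ _ w) as (_ & -> & ->). ring.
Qed.

(** By [eta_x_over], [eta_x] is quadratic in [u_x] with coefficients depending on [(t, x, u)]. The
    first group of terms is [D_x] acting on these coefficients, the second is the derivative in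
    [u_x] times [u_xx]. *)
Lemma eta_xx_over j : over W j -> eta_xx Q j =
  (vfield1 (dx (eta Q)) j + j cux * vfield1 (du (eta Q)) j
    - j cux * (vfield1 (dx (xi Q)) j + j cux * vfield1 (du (xi Q)) j))
  + j cuxx * (du (eta Q) @@ j - dx (xi Q) @@ j
      - 2 * j cux * du (xi Q) @@ j)
  - j cuxx * vfield1 (xi Q) j.
Proof.
  intros w. unfold eta_xx. rewrite !total_x_lift3.
  replace (vfield1 (tau Q) j) with 0.
  2: { unfold vfield1. destruct (tau_d3 _ _ _ w) as (_ & -> & ->). ring. }
  unfold total_x.
  assert (E1 : pd cx (eta_x Q) j =
    dx (dx (eta Q)) @@ j + j cux * dx (du (eta Q)) @@ j
    - j cux * (dx (dx (xi Q)) @@ j + j cux * dx (du (xi Q)) @@ j)).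
  { rewrite (pd_ext_over W j cx _ _ HW w eta_x_over). apply is_derive_unique.
    apply (vfield_derive (fun s => dx (eta Q) (j ct) s (j cu)) (fun s => du (eta Q) (j ct) s (j cu))
      (fun s => dx (xi Q) (j ct) s (j cu)) (fun s => du (xi Q) (j ct) s (j cu)));
    refine (proj1 (proj2 (Ck_is_d3 W 0 _ _ _ _ _ w)));
    first [exact (Ck_dx W 1 _ Heta) | exact (Ck_du W 1 _ Heta) | exact (Ck_dx W 1 _ Hxi) | exact (Ck_du W 1 _ Hxi)]. }
  assert (E2 : pd cu (eta_x Q) j =
    du (dx (eta Q)) @@ j + j cux * du (du (eta Q)) @@ j
    - j cux * (du (dx (xi Q)) @@ j + j cux * du (du (xi Q)) @@ j)).
  { rewrite (pd_ext_over W j cu _ _ HW w eta_x_over). apply is_derive_unique.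
    apply (vfield_derive (fun s => dx (eta Q) (j ct) (j cx) s) (fun s => du (eta Q) (j ct) (j cx) s)
      (fun s => dx (xi Q) (j ct) (j cx) s) (fun s => du (xi Q) (j ct) (j cx) s));
    refine (proj2 (proj2 (Ck_is_d3 W 0 _ _ _ _ _ w)));
    first [exact (Ck_dx W 1 _ Heta) | exact (Ck_du W 1 _ Heta) | exact (Ck_dx W 1 _ Hxi) | exact (Ck_du W 1 _ Hxi)]. }
  assert (E3 : pd cut (eta_x Q) j = 0).
  { rewrite (pd_ext_over W j cut _ _ HW w eta_x_over). exact (Derive_const (vfield1 (eta Q) j - j cux * vfield1 (xi Q) j) (j cut)). }
  assert (E4 : pd cux (eta_x Q) j = du (eta Q) @@ j - dx (xi Q) @@ j
      - 2 * j cux * du (xi Q) @@ j).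
  { rewrite (pd_ext_over W j cux _ _ HW w eta_x_over).
    apply (is_derive_unique (fun s => (dx (eta Q) @@ j + s * du (eta Q) @@ j)
      - s * (dx (xi Q) @@ j + s * du (xi Q) @@ j))).
    auto_derive; [exact I | ring]. }
  rewrite E1, E2, E3, E4. unfold vfield1. ring.
Qed.

Lemma charact_over j : over W j ->
  charact Q j = eta Q @@ j - xi Q @@ j * j cux.
Proof.
  intros w. unfold charact, lift3. rewrite (Htau _ _ _ w). ring.
Qed.

Lemma pd_charact j : over W j ->
  pd ct (charact Q) j = dt (eta Q) @@ j - dt (xi Q) @@ j * j cux /\
  pd cx (charact Q) j = dx (eta Q) @@ j - dx (xi Q) @@ j * j cux /\
  pd cu (charact Q) j = du (eta Q) @@ j - du (xi Q) @@ j * j cux /\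
  pd cut (charact Q) j = 0 /\ pd cux (charact Q) j = - xi Q @@ j.
Proof.
  intros w.
  destruct (Ck_is_d3 W 1 _ _ _ _ Heta w) as (e1 & e2 & e3).
  destruct (Ck_is_d3 W 1 _ _ _ _ Hxi w) as (x1 & x2 & x3).
  rewrite !(pd_ext_over W j _ _ _ HW w charact_over).
  refine (conj (is_derive_unique _ _ _ (minus_scaled_derive _ _ _ _ _ (j cux) e1 x1))
    (conj (is_derive_unique _ _ _ (minus_scaled_derive _ _ _ _ _ (j cux) e2 x2))
    (conj (is_derive_unique _ _ _ (minus_scaled_derive _ _ _ _ _ (j cux) e3 x3))
    (conj (Derive_const (eta Q @@ j - xi Q @@ j * j cux) (j cut)) _)))).
  apply (is_derive_unique (fun s => eta Q @@ j - xi Q @@ j * s)). auto_derive; [exact I | ring].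
Qed.

Lemma total_t_charact j : over W j -> total_t (charact Q) j =
  dt (eta Q) @@ j - dt (xi Q) @@ j * j cux
  + j cut * (du (eta Q) @@ j - du (xi Q) @@ j * j cux) - j cutx * xi Q @@ j.
Proof.
  intros w. unfold total_t. destruct (pd_charact j w) as (-> & _ & -> & -> & ->). ring.
Qed.

Lemma total_x_charact j : over W j -> total_x (charact Q) j =
  dx (eta Q) @@ j - dx (xi Q) @@ j * j cux
  + j cux * (du (eta Q) @@ j - du (xi Q) @@ j * j cux) - j cuxx * xi Q @@ j.
Proof.
  intros w. unfold total_x. destruct (pd_charact j w) as (_ & -> & -> & -> & ->). ring.
Qed.

Lemma prolong2_over j : over W j ->
  ex_derive (fun s => A (j ct) s) (j cx) -> ex_derive (fun s => B (j ct) s) (j cx) ->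
  ex_derive (fun s => C (j ct) s) (j cx) ->
  prolong2 Q (Lop A B C) j =
  xi Q @@ j *
    (- (Derive (fun s => A (j ct) s) (j cx) * j cuxx) - Derive (fun s => B (j ct) s) (j cx) * j cux
     - Derive (fun s => C (j ct) s) (j cx) * j cu)
  - eta Q @@ j * C (j ct) (j cx)
  + eta_t Q j - B (j ct) (j cx) * eta_x Q j - A (j ct) (j cx) * eta_xx Q j.
Proof.
  intros w hA hB hC. unfold prolong2.
  assert (E1 : pd cx (Lop A B C) j = - (Derive (fun s => A (j ct) s) (j cx) * j cuxx)
    - Derive (fun s => B (j ct) s) (j cx) * j cux - Derive (fun s => C (j ct) s) (j cx) * j cu).
  { assert (P : forall (a b c : R -> R) s (v1 v2 v3 v4 : R), ex_derive a s -> ex_derive b s -> ex_derive c s ->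
      Derive (fun s => v1 - a s * v2 - b s * v3 - c s * v4) s =
      - (Derive a s * v2) - Derive b s * v3 - Derive c s * v4).
    { intros a b c s v1 v2 v3 v4 ha hb hc. apply is_derive_unique. auto_derive.
      - box.
      - change (fun x : R => a x) with a. change (fun x : R => b x) with b. change (fun x : R => c x) with c. ring. }
    exact (P (fun s => A (j ct) s) (fun s => B (j ct) s) (fun s => C (j ct) s) (j cx)
      (j cut) (j cuxx) (j cux) (j cu) hA hB hC). }
  assert (E2 : pd cu (Lop A B C) j = - C (j ct) (j cx)) by derive_Lop.
  assert (E3 : pd cut (Lop A B C) j = 1) by derive_Lop.
  assert (E4 : pd cux (Lop A B C) j = - B (j ct) (j cx)) by derive_Lop.
  assert (E5 : pd cuxx (Lop A B C) j = - A (j ct) (j cx)) by derive_Lop.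
  assert (E6 : pd cutt (Lop A B C) j = 0) by exact (Derive_const (Lop A B C j) (j cutt)).
  assert (E7 : pd cutx (Lop A B C) j = 0) by exact (Derive_const (Lop A B C j) (j cutx)).
  rewrite E1, E2, E3, E4, E5, E6, E7.
  change (lift3 (tau Q) j) with (tau Q @@ j). rewrite (Htau _ _ _ w).
  unfold lift3. ring.
Qed.

End Prolongation.

(** * The determining equation *)

Lemma d3_ext (W : R * R * R -> Prop) (f k : R -> R -> R -> R) (t x u : R) : open W -> W (t, x, u) ->
  (forall t x u, W (t, x, u) -> f t x u = k t x u) ->
  dt f t x u = dt k t x u /\ dx f t x u = dx k t x u /\ du f t x u = du k t x u.
Proof.
  intros HW w E. destruct (open3_slices W t x u HW w) as (l1 & l2 & l3).
  split; [| split]; apply Derive_ext_loc.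
  - generalize l1. apply filter_imp. intros s. apply E.
  - generalize l2. apply filter_imp. intros s. apply E.
  - generalize l3. apply filter_imp. intros s. apply E.
Qed.

Lemma d3_mult (W : R * R * R -> Prop) (f a b : R -> R -> R -> R) (t x u : R) : open W -> Ck 1 W a -> Ck 1 W b ->
  (forall t x u, W (t, x, u) -> f t x u = a t x u * b t x u) -> W (t, x, u) ->
  dt f t x u = dt a t x u * b t x u + a t x u * dt b t x u /\
  dx f t x u = dx a t x u * b t x u + a t x u * dx b t x u /\
  du f t x u = du a t x u * b t x u + a t x u * du b t x u.
Proof.
  intros HW Ha Hb E w.
  destruct (d3_ext W f (fun t x u => a t x u * b t x u) t x u HW w E) as (-> & -> & ->).
  destruct (Ck_is_d3 W 0 a t x u Ha w) as (a1 & a2 & a3).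
  destruct (Ck_is_d3 W 0 b t x u Hb w) as (b1 & b2 & b3).
  exact (conj (is_derive_unique _ _ _ (is_derive_mult _ _ _ _ _ a1 b1 Rmult_comm))
    (conj (is_derive_unique _ _ _ (is_derive_mult _ _ _ _ _ a2 b2 Rmult_comm))
      (is_derive_unique _ _ _ (is_derive_mult _ _ _ _ _ a3 b3 Rmult_comm)))).
Qed.

Lemma d3_plus (W : R * R * R -> Prop) (f a b : R -> R -> R -> R) (t x u : R) : open W -> Ck 1 W a -> Ck 1 W b ->
  (forall t x u, W (t, x, u) -> f t x u = a t x u + b t x u) -> W (t, x, u) ->
  dt f t x u = dt a t x u + dt b t x u /\
  dx f t x u = dx a t x u + dx b t x u /\
  du f t x u = du a t x u + du b t x u.
Proof.
  intros HW Ha Hb E w.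
  destruct (d3_ext W f (fun t x u => a t x u + b t x u) t x u HW w E) as (-> & -> & ->).
  destruct (Ck_is_d3 W 0 a t x u Ha w) as (a1 & a2 & a3).
  destruct (Ck_is_d3 W 0 b t x u Hb w) as (b1 & b2 & b3).
  exact (conj (is_derive_unique _ _ _ (is_derive_plus (V := R_NormedModule) _ _ _ _ _ a1 b1))
    (conj (is_derive_unique _ _ _ (is_derive_plus (V := R_NormedModule) _ _ _ _ _ a2 b2))
      (is_derive_unique _ _ _ (is_derive_plus (V := R_NormedModule) _ _ _ _ _ a3 b3)))).
Qed.

(** Mixed derivatives are recorded in both orders, so the determining equation is obtained by pure
    algebra, without exchanging derivatives. *)
Lemma d3_mult2 (W : R * R * R -> Prop) (f a b : R -> R -> R -> R) (t x u : R) : open W -> Ck 2 W a -> Ck 2 W b ->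
  (forall t x u, W (t, x, u) -> f t x u = a t x u * b t x u) -> W (t, x, u) ->
  dx (dx f) t x u = dx (dx a) t x u * b t x u + 2 * (dx a t x u * dx b t x u) + a t x u * dx (dx b) t x u /\
  du (dx f) t x u = du (dx a) t x u * b t x u + dx a t x u * du b t x u
    + (du a t x u * dx b t x u + a t x u * du (dx b) t x u) /\
  dx (du f) t x u = dx (du a) t x u * b t x u + du a t x u * dx b t x u
    + (dx a t x u * du b t x u + a t x u * dx (du b) t x u) /\
  du (du f) t x u = du (du a) t x u * b t x u + 2 * (du a t x u * du b t x u) + a t x u * du (du b) t x u.
Proof.
  intros HW Ha Hb E w.
  assert (Ha1 := Ck_pred W 1 a Ha). assert (Hb1 := Ck_pred W 1 b Hb).
  assert (Hax := Ck_dx W 1 a Ha). assert (Hau := Ck_du W 1 a Ha).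
  assert (Hbx := Ck_dx W 1 b Hb). assert (Hbu := Ck_du W 1 b Hb).
  assert (Ex : forall t x u, W (t, x, u) -> dx f t x u = dx a t x u * b t x u + a t x u * dx b t x u).
  { intros t' x' u' w'. apply (d3_mult W f a b t' x' u' HW Ha1 Hb1 E w'). }
  assert (Eu : forall t x u, W (t, x, u) -> du f t x u = du a t x u * b t x u + a t x u * du b t x u).
  { intros t' x' u' w'. apply (d3_mult W f a b t' x' u' HW Ha1 Hb1 E w'). }
  destruct (d3_plus W (dx f) (fun t x u => dx a t x u * b t x u) (fun t x u => a t x u * dx b t x u) t x u HW (Ck_mult W HW 1 _ _ Hax Hb1) (Ck_mult W HW 1 _ _ Ha1 Hbx) Ex w)
    as (_ & F1 & F2).
  destruct (d3_plus W (du f) (fun t x u => du a t x u * b t x u) (fun t x u => a t x u * du b t x u) t x u HW (Ck_mult W HW 1 _ _ Hau Hb1) (Ck_mult W HW 1 _ _ Ha1 Hbu) Eu w)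
    as (_ & F3 & F4).
  destruct (d3_mult W (fun t x u => dx a t x u * b t x u) (dx a) (b)
    t x u HW Hax Hb1 (fun _ _ _ _ => eq_refl) w) as (_ & G1 & G2).
  destruct (d3_mult W (fun t x u => a t x u * dx b t x u) (a) (dx b)
    t x u HW Ha1 Hbx (fun _ _ _ _ => eq_refl) w) as (_ & G3 & G4).
  destruct (d3_mult W (fun t x u => du a t x u * b t x u) (du a) (b)
    t x u HW Hau Hb1 (fun _ _ _ _ => eq_refl) w) as (_ & G5 & G6).
  destruct (d3_mult W (fun t x u => a t x u * du b t x u) (a) (du b)
    t x u HW Ha1 Hbu (fun _ _ _ _ => eq_refl) w) as (_ & G7 & G8).
  rewrite F1, F2, F3, F4, G1, G2, G3, G4, G5, G6, G7, G8.
  repeat split; ring.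
Qed.

Lemma evol_rhs_Ck (A B C : R -> R -> R) (n : nat) (W : R * R * R -> Prop) (g : R -> R -> R -> R) : open W -> Ck n W (fun t x _ => A t x) -> Ck n W (fun t x _ => B t x) ->
  Ck n W (fun t x _ => C t x) -> Ck (S n) W g -> Ck n W (evol_rhs A B C g).
Proof.
  intros HW HA HB HC Hg. assert (Hg' := Ck_pred W n g Hg).
  unfold evol_rhs.
  apply Ck_plus; [exact HW | apply Ck_plus; [exact HW | |] |].
  - apply (Ck_mult W HW n (fun t x _ => A t x)); [exact HA |].
    apply Ck_plus; [exact HW | apply Ck_dx, Hg |].
    apply Ck_mult; [exact HW | exact Hg' | apply Ck_du, Hg].
  - apply (Ck_mult W HW n (fun t x _ => B t x)); assumption.
  - apply (Ck_mult W HW n (fun t x _ => C t x)); [exact HC | apply Ck_u, HW].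
Qed.

Lemma evol_rhs_d3 (A B C : R -> R -> R) (W : R * R * R -> Prop) (g : R -> R -> R -> R) (t x u : R) : open W -> Ck 1 W (fun t x _ => A t x) -> Ck 1 W (fun t x _ => B t x) ->
  Ck 1 W (fun t x _ => C t x) -> Ck 2 W g -> W (t, x, u) ->
  dx (evol_rhs A B C g) t x u =
    Derive (fun s => A t s) x * (dx g t x u + g t x u * du g t x u)
    + A t x * (dx (dx g) t x u + (dx g t x u * du g t x u + g t x u * dx (du g) t x u))
    + (Derive (fun s => B t s) x * g t x u + B t x * dx g t x u) + Derive (fun s => C t s) x * u /\
  du (evol_rhs A B C g) t x u =
    A t x * (du (dx g) t x u + (du g t x u * du g t x u + g t x u * du (du g) t x u))
    + B t x * du g t x u + C t x.
Proof.
  intros HW HA HB HC Hg w.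
  destruct (Ck_is_d3 W 0 _ t x u HA w) as (_ & A2 & _).
  destruct (Ck_is_d3 W 0 _ t x u HB w) as (_ & B2 & _).
  destruct (Ck_is_d3 W 0 _ t x u HC w) as (_ & C2 & _).
  destruct (Ck_is_d3 W 1 _ t x u Hg w) as (_ & g2 & g3).
  destruct (Ck_is_d3 W 0 _ t x u (Ck_dx W 1 g Hg) w) as (_ & gx2 & gx3).
  destruct (Ck_is_d3 W 0 _ t x u (Ck_du W 1 g Hg) w) as (_ & gu2 & gu3).
  split.
  - assert (P : forall (a p q r b c : R -> R) s v a' p' q' r' b' c', is_derive a s a' -> is_derive p s p' ->
      is_derive q s q' -> is_derive r s r' -> is_derive b s b' -> is_derive c s c' ->
      Derive (fun s => a s * (p s + q s * r s) + b s * q s + c s * v) s =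
      a' * (p s + q s * r s) + a s * (p' + (q' * r s + q s * r')) + (b' * q s + b s * q') + c' * v).
    { intros a p q r b c s v a' p' q' r' b' c' Ha Hp Hq Hr Hb Hc.
      apply is_derive_unique. derive_by_hyps. }
    exact (P (fun s => A t s) (fun s => dx g t s u) (fun s => g t s u) (fun s => du g t s u)
      (fun s => B t s) (fun s => C t s) x u _ _ _ _ _ _ A2 gx2 g2 gu2 B2 C2).
  - assert (P : forall (p q r : R -> R) s a b c p' q' r', is_derive p s p' ->
      is_derive q s q' -> is_derive r s r' ->
      Derive (fun s => a * (p s + q s * r s) + b * q s + c * s) s =
      a * (p' + (q' * r s + q s * r')) + b * q' + c).
    { intros p q r s a b c p' q' r' Hp Hq Hr.
      apply is_derive_unique. derive_by_hyps. }
    exact (P (fun s => dx g t x s) (fun s => g t x s) (fun s => du g t x s) u (A t x) (B t x) (C t x)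
       _ _ _ gx3 g3 gu3).
Qed.

(** On [W] the operator is [xi] times [d/dx + g d/du], so [g] depends only on its equivalence class.
    Writing [rf_slope] as a product reduces all derivatives of [eta] to the product rule. The
    reduction criterion is deliberately absent: the form serves to derive it as well as to exploit
    it. *)
Record reduced_form (A B C : R -> R -> R) (Q : operator) (W : R * R * R -> Prop) (g : R -> R -> R -> R) : Prop := {
  rf_open : open W;
  rf_A : forall n, Ck n W (fun t x _ => A t x);
  rf_B : forall n, Ck n W (fun t x _ => B t x);
  rf_C : forall n, Ck n W (fun t x _ => C t x);
  rf_g : forall n, Ck n W g;
  rf_xi : forall n, Ck n W (xi Q);
  rf_eta : forall n, Ck n W (eta Q);
  rf_tau0 : forall t x u, W (t, x, u) -> tau Q t x u = 0;
  rf_xi0 : forall t x u, W (t, x, u) -> xi Q t x u <> 0;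
  rf_slope : forall t x u, W (t, x, u) -> eta Q t x u = xi Q t x u * g t x u }.

Arguments rf_open {_ _ _ _ _ _} _.
Arguments rf_tau0 {_ _ _ _ _ _} _.
Arguments rf_xi0 {_ _ _ _ _ _} _.
Arguments rf_slope {_ _ _ _ _ _} _.

(** After cancelling [xi], the invariance condition, its [x]-derivative and the equation express
    [u_x], [u_xx] and [u_t] through [(t, x, u)]. Once they are substituted, all derivatives of [xi]
    cancel, as they must for a criterion unaffected by multipliers. *)
Lemma prolong2_on_manifold A B C Q W g j : reduced_form A B C Q W g -> over W j ->
  Lop A B C j = 0 -> charact Q j = 0 -> total_x (charact Q) j = 0 ->
  prolong2 Q (Lop A B C) j = xi Q @@ j * compat_defect A B C g @@ j.
Proof.
  intros [HW HA HB HC Hg Hxi Heta Htau Hxi0 Hs] w E1 E2 E3.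
  pose proof (Hxi0 _ _ _ w) as X0.
  destruct (Ck_is_d3 W 0 _ _ _ _ (HA 1%nat) w) as (_ & A2 & _).
  destruct (Ck_is_d3 W 0 _ _ _ _ (HB 1%nat) w) as (_ & B2 & _).
  destruct (Ck_is_d3 W 0 _ _ _ _ (HC 1%nat) w) as (_ & C2 & _).
  rewrite (prolong2_over A B C Q W Htau j w (ex_intro _ _ A2) (ex_intro _ _ B2) (ex_intro _ _ C2)).
  rewrite (eta_t_over Q W HW Htau j w), (eta_x_over Q W HW Htau j w).
  rewrite (eta_xx_over Q W HW Htau (Hxi 2%nat) (Heta 2%nat) j w).
  rewrite (charact_over Q W Htau j w) in E2.
  rewrite (total_x_charact Q W HW Htau (Hxi 2%nat) (Heta 2%nat) j w) in E3.
  unfold compat_defect.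
  destruct (evol_rhs_d3 A B C W g _ _ _ HW (HA 1%nat) (HB 1%nat) (HC 1%nat) (Hg 2%nat) w) as [-> ->].
  unfold vfield1, Lop, evol_rhs in *.
  destruct (d3_mult W _ _ _ _ _ _ HW (Hxi 1%nat) (Hg 1%nat) Hs w) as (D1 & D2 & D3).
  destruct (d3_mult2 W _ _ _ _ _ _ HW (Hxi 2%nat) (Hg 2%nat) Hs w) as (D4 & D5 & D6 & D7).
  rewrite D1, D2, D3, D4, D5, D6, D7. rewrite D2, D3 in E3. rewrite (Hs _ _ _ w) in *.
  set (X := xi Q @@ j) in *. set (G := g @@ j) in *.
  assert (F2 : j cux = G).
  { apply (Rmult_eq_reg_l X); [| exact X0]. lra. }
  rewrite F2 in *.
  assert (F3 : j cuxx = dx g @@ j + G * du g @@ j).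
  { apply (Rmult_eq_reg_l X); [| exact X0]. lra. }
  rewrite F3 in *.
  assert (F1 : j cut = A (j ct) (j cx) * (dx g @@ j + G * du g @@ j)
    + B (j ct) (j cx) * G + C (j ct) (j cx) * j cu) by lra.
  rewrite F1. ring.
Qed.

(** The jet that a common solution of [u_x = g] and [u_t = evol_rhs] through [(t, x, u)] would have.
    The value of [u_tt] is set to 0; the four equations of the manifold leave it free. *)
Definition invariant_jet (A B C : R -> R -> R) (g : R -> R -> R -> R) (t x u : R) : jet := fun c =>
  match c with
  | ct => t
  | cx => x
  | cu => u
  | cut => evol_rhs A B C g t x u
  | cux => g t x u
  | cutt => 0
  | cutx => dt g t x u + evol_rhs A B C g t x u * du g t x u
  | cuxx => dx g t x u + g t x u * du g t x u
  end.

Lemma invariant_jet_on_manifold A B C Q W g t x u : reduced_form A B C Q W g -> W (t, x, u) ->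
  let j := invariant_jet A B C g t x u in
  Lop A B C j = 0 /\ charact Q j = 0 /\ total_t (charact Q) j = 0 /\ total_x (charact Q) j = 0.
Proof.
  intros [HW HA HB HC Hg Hxi Heta Htau Hxi0 Hs] w j.
  assert (w' : over W j) by exact w.
  rewrite (charact_over Q W Htau j w'), (total_x_charact Q W HW Htau (Hxi 2%nat) (Heta 2%nat) j w'),
    (total_t_charact Q W HW Htau (Hxi 2%nat) (Heta 2%nat) j w').
  destruct (d3_mult W _ _ _ _ _ _ HW (Hxi 1%nat) (Hg 1%nat) Hs w) as (D1 & D2 & D3).
  unfold j; simpl. rewrite D1, D2, D3, (Hs _ _ _ w).
  unfold Lop; simpl. unfold evol_rhs. repeat split; ring.
Qed.

(** [invariant_jet] lies on the manifold above every point of [W], so the criterion can be evaluated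
    there; the factor [xi] is then cancelled. *)
Lemma reduction_compat A B C Q W g t0 x0 u0 : reduced_form A B C Q W g -> W (t0, x0, u0) ->
  reduction_operator A B C t0 x0 u0 Q ->
  locally (t0, x0, u0) (fun '(t, x, u) => compat_defect A B C g t x u = 0).
Proof.
  intros R w (_ & _ & _ & _ & H).
  generalize (filter_and _ _ (rf_open R _ w) H). apply filter_imp.
  intros [[t x] u] [w' H'].
  destruct (invariant_jet_on_manifold A B C Q W g t x u R w') as (J1 & J2 & J3 & J4).
  pose proof (H' (invariant_jet A B C g t x u) eq_refl eq_refl eq_refl J1 J2 J3 J4) as P.
  apply (eq_trans (eq_sym (prolong2_on_manifold A B C Q W g _ R w' J1 J2 J4))) in P.
  apply Rmult_integral in P. destruct P as [P | P]; [| exact P].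
  exfalso. exact (rf_xi0 R _ _ _ w' P).
Qed.

Lemma compat_reduction A B C Q W g t0 x0 u0 : reduced_form A B C Q W g -> W (t0, x0, u0) ->
  (forall n, Ck n W (tau Q)) ->
  (forall t x u, W (t, x, u) -> compat_defect A B C g t x u = 0) ->
  reduction_operator A B C t0 x0 u0 Q.
Proof.
  intros R w Ht H. destruct R as [HW HA HB HC Hg Hxi Heta Htau Hxi0 Hs] eqn:ER.
  refine (conj _ (conj _ (conj _ (conj _ _)))).
  - exists W. auto.
  - exists W. auto.
  - exists W. auto.
  - intros E. apply (Hxi0 _ _ _ w). congruence.
  - generalize (HW _ w). apply filter_imp. intros [[t x] u] w' j jt jx ju J1 J2 J3 J4.
    assert (wj : over W j) by (unfold over; rewrite jt, jx, ju; exact w').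
    rewrite (prolong2_on_manifold A B C Q W g j R wj J1 J2 J4), (H _ _ _ wj). ring.
Qed.

Lemma smooth3_Box (f : R -> R -> R -> R) (a b c : R) : smooth3 f (a, b, c) ->
  exists e, 0 < e /\ forall n, Ck n (Box a b c e) f.
Proof.
  intros (D & HD & d & H). destruct (open3 D a b c HD d) as [e [He K]].
  exists e. split; [exact He |]. intros n. apply (Ck_mono n _ D); [| apply H].
  intros [[t x] u]. apply K.
Qed.

Lemma reduction_reduced_form A B C Q t0 x0 u0 :
  analytic2 A t0 x0 -> analytic2 B t0 x0 -> analytic2 C t0 x0 ->
  reduction_operator A B C t0 x0 u0 Q -> zero_tau t0 x0 u0 Q ->
  exists W, W (t0, x0, u0) /\ reduced_form A B C Q W (fun t x u => eta Q t x u / xi Q t x u).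
Proof.
  intros hA hB hC (_ & Sx & Se & Hn & _) Hz.
  destruct (analytic_coefficients A B C t0 x0 hA hB hC) as (r1 & R1 & A1).
  destruct (smooth3_Box _ _ _ _ Sx) as (r4 & R4 & X1).
  destruct (smooth3_Box _ _ _ _ Se) as (r5 & R5 & E1).
  destruct (proj1 (locally3 _ _ _ _) Hz) as (r6 & R6 & Z1).
  (* As [tau] vanishes at the base point, nontriviality of [(tau, xi)] falls on [xi]; continuity
     extends this to a box. *)
  assert (X0 : xi Q t0 x0 u0 <> 0).
  { intros E. apply Hn. rewrite E. f_equal. apply Z1; rewrite Rabs_sub_same; exact R6. }
  assert (Cx : cont3 (xi Q) t0 x0 u0).
  { apply (Ck_cont _ 0 _ _ _ _ (X1 O)). apply Box_center, R4. }
  destruct (cont3_elim Cx _ (Rabs_pos_lt _ X0)) as (r7 & R7 & N1).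
  pose (r := Rmin r1 (Rmin (Rmin r4 r5) (Rmin r6 r7))).
  assert (Hr : 0 < r) by (unfold r; repeat apply Rmin_glb_lt; assumption).
  assert (L : r <= r1 /\ r <= r4 /\ r <= r5 /\ r <= r6 /\ r <= r7).
  { unfold r. unfold Rmin. repeat destruct Rle_dec; lra. }
  destruct L as (L1 & L4 & L5 & L6 & L7).
  assert (M : forall n f e, r <= e -> Ck n (Box t0 x0 u0 e) f -> Ck n (Box t0 x0 u0 r) f).
  { intros n f e He. apply Ck_mono. intros p. apply Box_mono, He. }
  assert (N : forall t x u, Box t0 x0 u0 r (t, x, u) -> xi Q t x u <> 0).
  { intros t x u (b1 & b2 & b3) E. specialize (N1 t x u). rewrite E in N1.
    replace (0 - xi Q t0 x0 u0) with (- xi Q t0 x0 u0) in N1 by ring. rewrite Rabs_Ropp in N1. lra. }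
  exists (Box t0 x0 u0 r). split; [apply Box_center, Hr |].
  constructor; try assumption.
  - apply open_Box.
  - intros n. exact (M _ _ _ L1 (proj1 (A1 u0 n))).
  - intros n. exact (M _ _ _ L1 (proj1 (proj2 (A1 u0 n)))).
  - intros n. exact (M _ _ _ L1 (proj2 (proj2 (A1 u0 n)))).
  - intros n. apply Ck_div; [apply open_Box | exact (M _ _ _ L5 (E1 n)) | exact (M _ _ _ L4 (X1 n)) | exact N].
  - intros n. exact (M _ _ _ L4 (X1 n)).
  - intros n. exact (M _ _ _ L5 (E1 n)).
  - intros t x u (b1 & b2 & b3). apply Z1; lra.
  - intros t x u b. field. apply N, b.
Qed.

(** * Invariant solutions *)

Definition flow_at (W : R * R * R -> Prop) (g h : R -> R -> R -> R) (v : R -> R -> R) (t x : R) : Prop :=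
  W (t, x, v t x) /\
  is_derive (fun s => v s x) t (h t x (v t x)) /\
  is_derive (fun y => v t y) x (g t x (v t x)).

Lemma locally2_slices (P : R * R -> Prop) (t x : R) : locally (t, x) P ->
  P (t, x) /\ locally t (fun s => P (s, x)) /\ locally x (fun y => P (t, y)).
Proof.
  intros H. split; [exact (locally_singleton _ _ H) |].
  apply locally2 in H. destruct H as [e [He K]].
  split; apply locally1; exists e; (split; [exact He |]); intros s hs; apply K; try exact hs;
    rewrite Rabs_sub_same; exact He.
Qed.

Lemma slope_derive (W : R * R * R -> Prop) (g : R -> R -> R -> R) (v : R -> R -> R) (t x : R) :
  open W -> Ck 1 W g -> W (t, x, v t x) -> is_derive (fun y => v t y) x (g t x (v t x)) ->
  locally x (fun y => is_derive (fun z => v t z) y (g t y (v t y))) ->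
  Derive_n (fun y => v t y) 2 x = dx g t x (v t x) + g t x (v t x) * du g t x (v t x).
Proof.
  intros HW Hg w Hv Hl.
  change (Derive_n (fun y => v t y) 2 x) with (Derive (fun y => Derive (fun z => v t z) y) x).
  rewrite (Derive_ext_loc _ (fun y => g t y (v t y))).
  - etransitivity; [exact (is_derive_unique _ _ _ (C1_chain W g (fun _ => t) (fun y => y) (fun y => v t y)
      x 0 1 _ HW Hg w (@is_derive_const _ _ _ _) (@is_derive_id _ _) Hv)) | cbv beta; ring].
  - generalize Hl. apply filter_imp. intros y. apply is_derive_unique.
Qed.

(** Invariance gives [u_x = g] near the point, differentiation in [x] gives [u_xx], and the equation
    then yields [u_t]. Hypotheses on a neighbourhood are what allows this differentiation. *)
Lemma invariant_solution_flow A B C Q W g (v : R -> R -> R) (t x : R) : reduced_form A B C Q W g ->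
  locally (t, x) (fun '(t, x) => W (t, x, v t x) /\ ex_derive (fun s => v s x) t /\
    ex_derive (fun y => v t y) x /\ Lop A B C (jet_of v t x) = 0 /\ charact Q (jet_of v t x) = 0) ->
  flow_at W g (evol_rhs A B C g) v t x.
Proof.
  intros R H.
  assert (S : forall t x, W (t, x, v t x) /\ ex_derive (fun s => v s x) t /\
    ex_derive (fun y => v t y) x /\ Lop A B C (jet_of v t x) = 0 /\ charact Q (jet_of v t x) = 0 ->
    is_derive (fun y => v t y) x (g t x (v t x))).
  { clear t x H. intros t x (w & _ & ex & _ & c).
    rewrite (charact_over Q W (rf_tau0 R) (jet_of v t x) w) in c. simpl in c.
    rewrite (rf_slope R _ _ _ w) in c. pose proof (rf_xi0 R _ _ _ w) as X0.
    assert (E : Derive (fun y => v t y) x = g t x (v t x)).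
    { apply (Rmult_eq_reg_l (xi Q t x (v t x))); [| exact X0]. lra. }
    rewrite <- E. apply Derive_correct, ex. }
  destruct (locally2_slices _ _ _ H) as (H0 & _ & Hx). cbv beta iota in H0, Hx.
  pose proof (S t x H0) as Sx. destruct H0 as (w & et & _ & l & _).
  split; [exact w | split; [| exact Sx]].
  assert (E2 : jet_of v t x cuxx = dx g t x (v t x) + g t x (v t x) * du g t x (v t x)).
  { apply (slope_derive W g); try assumption.
    - apply R.
    - apply R.
    - generalize Hx. apply filter_imp. intros y. apply S. }
  unfold Lop in l. rewrite E2 in l. simpl in l.
  assert (Ex : Derive (fun y => v t y) x = g t x (v t x)) by exact (is_derive_unique _ _ _ Sx).
  rewrite Ex in l.
  assert (E : evol_rhs A B C g t x (v t x) = Derive (fun s => v s x) t) by (unfold evol_rhs; lra).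
  rewrite E. apply Derive_correct, et.
Qed.

Lemma flow_invariant_solution A B C Q W g (v : R -> R -> R) (t x : R) : reduced_form A B C Q W g ->
  locally (t, x) (fun '(t, x) => flow_at W g (evol_rhs A B C g) v t x) ->
  Lop A B C (jet_of v t x) = 0 /\ charact Q (jet_of v t x) = 0.
Proof.
  intros R H. destruct (locally2_slices _ _ _ H) as ((w & Ht & Hx) & _ & Hl).
  assert (E2 : jet_of v t x cuxx = dx g t x (v t x) + g t x (v t x) * du g t x (v t x)).
  { apply (slope_derive W g); try assumption.
    - apply R.
    - apply R.
    - generalize Hl. apply filter_imp. intros y (_ & _ & K). exact K. }
  assert (Ex : Derive (fun y => v t y) x = g t x (v t x)) by exact (is_derive_unique _ _ _ Hx).
  assert (Et : Derive (fun s => v s x) t = evol_rhs A B C g t x (v t x)) by exact (is_derive_unique _ _ _ Ht).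
  split.
  - unfold Lop. rewrite E2. simpl. rewrite Et, Ex. unfold evol_rhs. ring.
  - rewrite (charact_over Q W (rf_tau0 R) (jet_of v t x) w). simpl.
    rewrite Ex, (rf_slope R _ _ _ w). ring.
Qed.

(** The first clause of [family_of_invariant_solutions]; by [members_invariant_all] it entails the
    second one for solution families. *)
Definition members_invariant (Q : operator) (F : one_param_family) (t0 x0 : R) : Prop :=
  locally (t0, x0, fam_k0 F) (fun '(t, x, k) => charact Q (jet_of (fun s y => F s y k) t x) = 0).

Lemma family_flow A B C Q W g (F : one_param_family) (t0 x0 u0 : R) : reduced_form A B C Q W g ->
  W (t0, x0, u0) -> solution_family A B C t0 x0 u0 F -> members_invariant Q F t0 x0 ->
  exists b, 0 < b /\ (forall n, Ck n (Box t0 x0 (fam_k0 F) b) F) /\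
    forall t x k, Box t0 x0 (fam_k0 F) b (t, x, k) ->
      flow_at W g (evol_rhs A B C g) (fun s y => F s y k) t x.
Proof.
  intros R w (SF & E0 & _ & HS) HI.
  destruct (smooth3_Box _ _ _ _ SF) as (b1 & P1 & C1).
  destruct (proj1 (locally3 _ _ _ _) HS) as (b2 & P2 & S2).
  destruct (proj1 (locally3 _ _ _ _) HI) as (b3 & P3 & S3).
  destruct (open3 _ _ _ _ (rf_open R) w) as (e & He & We).
  assert (CF : cont3 F t0 x0 (fam_k0 F)) by (apply (Ck_cont _ 0 _ _ _ _ (C1 O)), Box_center, P1).
  destruct (cont3_elim CF e He) as (b4 & P4 & S4).
  pose (b := Rmin (Rmin b1 b2) (Rmin (Rmin b3 e) b4)).
  assert (Hb : 0 < b) by (unfold b; repeat apply Rmin_glb_lt; assumption).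
  assert (L : b <= b1 /\ b <= b2 /\ b <= b3 /\ b <= e /\ b <= b4).
  { unfold b, Rmin. repeat destruct Rle_dec; lra. }
  destruct L as (L1 & L2 & L3 & L4 & L5).
  exists b. split; [exact Hb |]. split.
  - intros n. apply (Ck_mono n _ (Box t0 x0 (fam_k0 F) b1)); [| apply C1].
    intros p. apply Box_mono, L1.
  - intros t x k HB. apply (invariant_solution_flow A B C Q W g (fun s y => F s y k) t x R).
    destruct (open3 _ _ _ _ (open_Box _ _ _ _) HB) as (r & Hr & Kr).
    apply locally2. exists r. split; [exact Hr |]. intros s y hs hy.
    assert (HB' : Box t0 x0 (fam_k0 F) b (s, y, k)).
    { apply Kr. box. }
    assert (HB1 : Box t0 x0 (fam_k0 F) b1 (s, y, k)) by (eapply Box_mono; [exact L1 | exact HB']).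
    destruct (Ck_ex _ 0 _ _ _ _ (C1 1%nat) HB1) as (e1 & e2 & _).
    destruct HB' as (h1 & h2 & h3).
    refine (conj _ (conj e1 (conj e2 (conj _ _)))).
    + apply We. repeat split; try lra. rewrite <- E0. apply S4; lra.
    + apply (S2 s y k); lra.
    + apply (S3 s y k); lra.
Qed.

(** A family viewed as a change of coordinates between [(t, x, k)] and [(t, x, u)], with inverse
    [Phi]. It straightens the graphs of solutions to lines of constant [k]. *)
Record family_chart (W : R * R * R -> Prop) (g h F : R -> R -> R -> R) (t0 x0 u0 k0 : R)
    (Phi : R -> R -> R -> R) (e b : R) : Prop := {
  fc_e : 0 < e;
  fc_b : 0 < b;
  fc_flow : forall t x k, Box t0 x0 k0 b (t, x, k) -> flow_at W g h (fun s y => F s y k) t x;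
  fc_du : forall t x k, Box t0 x0 k0 b (t, x, k) -> du F t x k <> 0;
  fc_inj : forall t x k k', Box t0 x0 k0 b (t, x, k) -> Box t0 x0 k0 b (t, x, k') ->
    F t x k = F t x k' -> k = k';
  fc_Phi : forall t x u, Box t0 x0 u0 e (t, x, u) ->
    Box t0 x0 k0 b (t, x, Phi t x u) /\ F t x (Phi t x u) = u;
  fc_Ck : forall n, Ck n (Box t0 x0 u0 e) Phi;
  fc_d3 : forall t x u, Box t0 x0 u0 e (t, x, u) ->
    implicit_d3 F Phi t x u }.

Arguments fc_e {_ _ _ _ _ _ _ _ _ _ _} _.
Arguments fc_flow {_ _ _ _ _ _ _ _ _ _ _} _.
Arguments fc_du {_ _ _ _ _ _ _ _ _ _ _} _.
Arguments fc_inj {_ _ _ _ _ _ _ _ _ _ _} _.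
Arguments fc_Phi {_ _ _ _ _ _ _ _ _ _ _} _.
Arguments fc_Ck {_ _ _ _ _ _ _ _ _ _ _} _.
Arguments fc_d3 {_ _ _ _ _ _ _ _ _ _ _} _.

Lemma family_chart_ex A B C Q W g (F : one_param_family) (t0 x0 u0 : R) : reduced_form A B C Q W g ->
  W (t0, x0, u0) -> solution_family A B C t0 x0 u0 F -> members_invariant Q F t0 x0 ->
  exists Phi e b, family_chart W g (evol_rhs A B C g) F t0 x0 u0 (fam_k0 F) Phi e b.
Proof.
  intros R w HS HI. destruct (family_flow A B C Q W g F t0 x0 u0 R w HS HI) as (b0 & Hb0 & CF & Fl).
  destruct HS as (_ & E0 & Hk & _).
  destruct (implicit_function F t0 x0 (fam_k0 F) u0 (Box t0 x0 (fam_k0 F) b0) (open_Box _ _ _ _)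
    (Box_center _ _ _ _ Hb0) CF E0 Hk) as (Phi & e & b & He & Hb & Hsub & Hdu & Hinj & HPhi & HCk & Hd3).
  exists Phi, e, b. constructor; try assumption.
  - intros t x k HB. apply Fl, Hsub, HB.
Qed.

(** * The parameter of a family as a first integral *)

Section Chart.

Variables (W : R * R * R -> Prop) (g h F Phi : R -> R -> R -> R) (t0 x0 u0 k0 e b : R).
Hypothesis Ch : family_chart W g h F t0 x0 u0 k0 Phi e b.

Lemma chart_inverse t x k : Box t0 x0 k0 b (t, x, k) -> Box t0 x0 u0 e (t, x, F t x k) ->
  Phi t x (F t x k) = k.
Proof.
  intros B1 B2. destruct (fc_Phi Ch _ _ _ B2) as [B3 E].
  exact (fc_inj Ch t x _ _ B3 B1 E).
Qed.

Lemma chart_center : F t0 x0 k0 = u0 -> Phi t0 x0 u0 = k0.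
Proof.
  intros E. rewrite <- E at 1. apply chart_inverse.
  - apply Box_center, Ch.
  - rewrite E. apply Box_center, Ch.
Qed.

Lemma chart_near :
  F t0 x0 k0 = u0 ->
  forall eps, 0 < eps -> exists d, 0 < d /\ d <= e /\ forall t x u, Box t0 x0 u0 d (t, x, u) ->
    Rabs (Phi t x u - k0) < eps.
Proof.
  intros E eps Heps.
  assert (Cp : cont3 Phi t0 x0 u0).
  { apply (Ck_cont _ 0 _ _ _ _ (fc_Ck Ch O)), Box_center, Ch. }
  destruct (cont3_elim Cp eps Heps) as (d & Hd & K).
  exists (Rmin d e). split; [apply Rmin_glb_lt; [exact Hd | apply Ch] |]. split; [apply Rmin_r |].
  intros t x u (h1 & h2 & h3). split_Rmin.
  rewrite (chart_center E) in K. apply K; tauto.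
Qed.

(* Both [F(., ., k)] and [v] solve [u_x = g], [u_t = h], for which [Phi] is a first integral. *)
Lemma chart_first_integral (v : R -> R -> R) (t1 x1 r : R) : 0 < r ->
  (forall t x, Rabs (t - t1) < r -> Rabs (x - x1) < r ->
     flow_at W g h v t x /\ Box t0 x0 u0 e (t, x, v t x)) ->
  forall t x, Rabs (t - t1) < r -> Rabs (x - x1) < r -> v t x = F t x (Phi t1 x1 (v t1 x1)).
Proof.
  intros Hr H.
  assert (Hc : Rabs (t1 - t1) < r /\ Rabs (x1 - x1) < r) by (rewrite !Rabs_sub_same; tauto).
  assert (D : forall t x, Rabs (t - t1) < r -> Rabs (x - x1) < r ->
    is_derive (fun s => Phi s x (v s x)) t 0 /\ is_derive (fun y => Phi t y (v t y)) x 0).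
  { intros t x ht hx. destruct (H t x ht hx) as ((w & Vt & Vx) & B).
    destruct (fc_Phi Ch _ _ _ B) as [B' E].
    pose proof (fc_du Ch _ _ _ B') as N.
    destruct (fc_flow Ch _ _ _ B') as (_ & Ft & Fx). cbv beta in Ft, Fx.
    rewrite E in Ft, Fx.
    assert (Et : dt F t x (Phi t x (v t x)) = h t x (v t x)) by exact (is_derive_unique _ _ _ Ft).
    assert (Ex : dx F t x (Phi t x (v t x)) = g t x (v t x)) by exact (is_derive_unique _ _ _ Fx).
    destruct (is_d3_unique (fc_d3 Ch _ _ _ B)) as (P1 & P2 & P3).
    pose proof (fc_Ck Ch 1%nat) as C1.
    split.
    - pose proof (C1_chain _ Phi (fun s => s) (fun _ => x) (fun s => v s x) t 1 0 _ (open_Box _ _ _ _) C1 B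
        (@is_derive_id _ _) (@is_derive_const _ _ _ _) Vt) as T.
      cbv beta in T. rewrite P1, P2, P3, Et in T.
      replace 0 with (- h t x (v t x) / du F t x (Phi t x (v t x)) * 1 +
        - dx F t x (Phi t x (v t x)) / du F t x (Phi t x (v t x)) * 0 +
        / du F t x (Phi t x (v t x)) * h t x (v t x)) by (field; exact N).
      exact T.
    - pose proof (C1_chain _ Phi (fun _ => t) (fun y => y) (fun y => v t y) x 0 1 _ (open_Box _ _ _ _) C1 B
        (@is_derive_const _ _ _ _) (@is_derive_id _ _) Vx) as T.
      cbv beta in T. rewrite P1, P2, P3, Ex in T.
      replace 0 with (- dt F t x (Phi t x (v t x)) / du F t x (Phi t x (v t x)) * 0 +
        - g t x (v t x) / du F t x (Phi t x (v t x)) * 1 +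
        / du F t x (Phi t x (v t x)) * g t x (v t x)) by (field; exact N).
      exact T. }
  intros t x ht hx.
  assert (K : Phi t x (v t x) = Phi t1 x1 (v t1 x1)).
  (* Constancy is propagated along an L-shaped path: in [x] at fixed [t1], and in [t] at fixed
     [x]. *)
  { pose proof (mvt_bound (fun s => Phi s x (v s x)) (fun _ => 0) t1 r 0
      (fun s hs => proj1 (D s x hs hx)) (fun _ _ => Req_le _ _ Rabs_R0) t1 t (proj1 Hc) ht) as T1.
    pose proof (mvt_bound (fun y => Phi t1 y (v t1 y)) (fun _ => 0) x1 r 0
      (fun y hy => proj2 (D t1 y (proj1 Hc) hy)) (fun _ _ => Req_le _ _ Rabs_R0) x1 x (proj2 Hc) hx) as T2.
    cbv beta in T1, T2. rewrite Rmult_0_l in T1, T2.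
    assert (Z : forall z, Rabs z <= 0 -> z = 0).
    { intros z hz. destruct (Req_dec z 0) as [z0 | z0]; [exact z0 |].
      pose proof (Rabs_pos_lt z z0). lra. }
    apply Z in T1. apply Z in T2. lra. }
  rewrite <- K. symmetry. apply (fc_Phi Ch _ _ _ (proj2 (H t x ht hx))).
Qed.

End Chart.

Arguments chart_center {_ _ _ _ _ _ _ _ _ _ _} _.
Arguments chart_near {_ _ _ _ _ _ _ _ _ _ _} _.
Arguments chart_first_integral {_ _ _ _ _ _ _ _ _ _ _} _.

(** An invariant solution through [(t1, x1, u1)] solves the same first-order system as the members,
    so it is the member with parameter [Phi t1 x1 u1]. Continuity of [Phi] brings this parameter
    within [eps] of [fam_k0 F]. *)
Lemma members_invariant_all A B C Q W g (F : one_param_family) (t0 x0 u0 : R) :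
  reduced_form A B C Q W g -> W (t0, x0, u0) -> solution_family A B C t0 x0 u0 F ->
  (family_of_invariant_solutions A B C t0 x0 u0 Q F <-> members_invariant Q F t0 x0).
Proof.
  intros R w HS. split; [intros [H _]; exact H |]. intros HI. split; [exact HI |].
  destruct (family_chart_ex A B C Q W g F t0 x0 u0 R w HS HI) as (Phi & e & b & Ch).
  destruct HS as (_ & E0 & _).
  intros eps.
  destruct (chart_near Ch E0 eps (cond_pos eps)) as (d & Hd & Hde & K).
  destruct (open3 _ _ _ _ (rf_open R) w) as (r & Hr & Wr).
  apply locally3. exists (Rmin d r). split; [apply Rmin_glb_lt; assumption |].
  intros t1 x1 u1 h1 h2 h3 u Eu Su HL.
  assert (B1 : Box t0 x0 u0 (Rmin d r) (t1, x1, u1)) by (box).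
  assert (Bd : forall p, Box t0 x0 u0 (Rmin d r) p -> Box t0 x0 u0 d p).
  { intros p. apply Box_mono, Rmin_l. }
  exists (Phi t1 x1 u1). split; [apply K, Bd, B1 |].
  destruct (open3 _ _ _ _ (open_Box _ _ _ _) B1) as (s & Hs & Ks).
  destruct (smooth3_Box _ _ _ _ Su) as (q & Hq & Cq).
  (* [smooth2] is smoothness of the lifted function at third coordinate 0, hence the dummy [0]. *)
  assert (Cu : cont3 (fun t x _ => u t x) t1 x1 0).
  { apply (Ck_cont _ 0 _ _ _ _ (Cq O)), Box_center, Hq. }
  destruct (cont3_elim Cu s Hs) as (q' & Hq' & Kq').
  destruct (proj1 (locally2 _ _ _) HL) as (l & Hl & Kl).
  pose (m := Rmin (Rmin s q) (Rmin q' l)).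
  assert (Hm : 0 < m) by (unfold m; repeat apply Rmin_glb_lt; assumption).
  assert (L : m <= s /\ m <= q /\ m <= q' /\ m <= l) by (unfold m, Rmin; repeat destruct Rle_dec; lra).
  destruct L as (L1 & L2 & L3 & L4).
  assert (T : forall t x, Rabs (t - t1) < m -> Rabs (x - x1) < m ->
    W (t, x, u t x) /\ Box t0 x0 u0 e (t, x, u t x) /\ ex_derive (fun s => u s x) t /\
    ex_derive (fun y => u t y) x /\ Lop A B C (jet_of u t x) = 0 /\ charact Q (jet_of u t x) = 0).
  { intros t x ht hx.
    assert (Z : Box t0 x0 u0 (Rmin d r) (t, x, u t x)).
    { apply Ks. repeat split; try lra. rewrite <- Eu. apply (Kq' t x 0); try lra.
      rewrite Rabs_sub_same; exact Hq'. }
    assert (Zq : Box t1 x1 0 q (t, x, 0)) by (box).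
    destruct (Ck_ex _ 0 _ _ _ _ (Cq 1%nat) Zq) as (e1 & e2 & _).
    destruct (Kl t x ltac:(lra) ltac:(lra)) as [l1 l2].
    refine (conj _ (conj _ (conj e1 (conj e2 (conj l1 l2))))).
    - destruct Z as (z1 & z2 & z3). split_Rmin.
      apply Wr. box.
    - apply (Box_mono _ _ _ (Rmin d r)); [| exact Z]. apply Rle_trans with d; [apply Rmin_l | exact Hde]. }
  apply locally2. exists m. split; [exact Hm |]. intros t x ht hx. rewrite <- Eu.
  apply (chart_first_integral Ch u t1 x1 m Hm); try assumption.
  clear t x ht hx. intros t x ht hx. split; [| apply (T t x ht hx)].
  apply (invariant_solution_flow A B C Q W g u t x R).
  apply locally2. exists (Rmin (m - Rabs (t - t1)) (m - Rabs (x - x1))).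
  split; [apply Rmin_glb_lt; lra |]. intros t' x' h1' h2'. apply lt_Rmin in h1'. apply lt_Rmin in h2'.
  destruct (T t' x') as (T1 & _ & T2).
  - apply (Rabs_shift _ t), h1'.
  - apply (Rabs_shift _ x), h2'.
  - exact (conj T1 T2).
Qed.

(** * The correspondence *)

(** Links the iterated one-variable derivatives in [smooth1] to the classes [Ck]. *)
Lemma Derive_n_du (f : R -> R -> R -> R) (n : nat) (t x s : R) :
  Derive_n (fun s => f t x s) n s = Nat.iter n du f t x s.
Proof.
  revert s. induction n as [| n IH]; intros s; [reflexivity |].
  simpl. unfold du at 1. apply Derive_ext, IH.
Qed.

Lemma Ck_iter_du (D : R * R * R -> Prop) (f : R -> R -> R -> R) n m :
  Ck (n + m) D f -> Ck m D (Nat.iter n du f).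
Proof.
  revert m. induction n as [| n IH]; intros m H; [exact H |].
  simpl. apply Ck_du, IH. replace (n + S m)%nat with (S n + m)%nat by lia. exact H.
Qed.

Lemma Ck_ex_derive_n (D : R * R * R -> Prop) (f : R -> R -> R -> R) t x u n :
  (forall n, Ck n D f) -> D (t, x, u) -> ex_derive_n (fun s => f t x s) n u.
Proof.
  intros H d. destruct n as [| n]; [exact I |].
  simpl. apply (ex_derive_ext (fun s => Nat.iter n du f t x s)).
  - intros s. symmetry. apply Derive_n_du.
  - exact (proj2 (proj2 (Ck_ex D 0 _ t x u (Ck_iter_du D f n 1 (H _)) d))).
Qed.

Lemma Ck_schwarz (D : R * R * R -> Prop) (f : R -> R -> R -> R) (t x u : R) :
  open D -> Ck 2 D f -> D (t, x, u) -> dt (dx f) t x u = dx (dt f) t x u.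
Proof.
  intros HD Hf d. apply (Schwarz (fun s y => f s y u)).
  - destruct (open3 D t x u HD d) as (e & He & K).
    exists (mkposreal e He). intros s y hs hy.
    assert (d' : D (s, y, u)) by (apply K; box).
    exact (conj (proj1 (Ck_ex D 1 f s y u Hf d')) (conj (proj1 (proj2 (Ck_ex D 1 f s y u Hf d')))
      (conj (proj1 (Ck_ex D 0 _ s y u (Ck_dx D 1 f Hf) d'))
         (proj1 (proj2 (Ck_ex D 0 _ s y u (Ck_dt D 1 f Hf) d')))))).
  - exact (proj1 (cont3_cont2 (dt (dx f)) t x u (Ck_cont D 0 _ t x u (Ck_dt D 0 _ (Ck_dx D 1 f Hf)) d))).
  - exact (proj1 (cont3_cont2 (dx (dt f)) t x u (Ck_cont D 0 _ t x u (Ck_dx D 0 _ (Ck_dt D 1 f Hf)) d))).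
Qed.

(** At distance [h] from [k0] the linear part moves [z] by [Rabs c * h] and the remainder takes back
    at most half of it, so the values at the two ends enclose every [y] within [Rabs c * h / 2] of
    [z k0]. *)
Lemma local_surjective (z : R -> R) (k0 : R) :
  locally k0 (fun k => ex_derive z k) -> Derive z k0 <> 0 ->
  forall e, 0 < e -> exists d, 0 < d /\ forall y, Rabs (y - z k0) < d ->
    exists k, Rabs (k - k0) < e /\ z k = y.
Proof.
  intros Hz Hc e He. set (c := Derive z k0) in *.
  destruct (proj1 (locally1 _ _) Hz) as (r & Hr & Kr).
  assert (D0 : is_derive z k0 c).
  { apply Derive_correct, Kr. rewrite Rabs_sub_same; exact Hr. }
  pose proof (Rabs_pos_lt c Hc) as Hc'. assert (Hc2 : 0 < Rabs c / 2) by lra.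
  destruct (proj1 (is_derive_eps _ _ _) D0 _ Hc2) as (q & Hq & Kq).
  pose (m := Rmin q (Rmin e r)). assert (Hm : 0 < m) by (unfold m; repeat apply Rmin_glb_lt; assumption).
  assert (L : m <= q /\ m <= e /\ m <= r) by (unfold m, Rmin; repeat destruct Rle_dec; lra).
  destruct L as (L1 & L2 & L3). pose (h := m / 2). assert (Hh : 0 < h < m) by (unfold h; lra).
  assert (Ec : Rabs c * Rabs c = c * c) by (rewrite <- Rabs_mult; apply Rabs_pos_eq; nra).
  exists (Rabs c * h / 2). split; [assert (0 < Rabs c * h) by (apply Rmult_lt_0_compat; lra); lra |].
  intros y hy.
  assert (Hy : Rabs (c * (y - z k0)) < c * c * h / 2).
  { rewrite Rabs_mult. apply Rmult_lt_compat_l with (r := Rabs c) in hy; [| exact Hc'].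
    replace (c * c * h / 2) with (Rabs c * Rabs c * h / 2) by (rewrite Ec; reflexivity). lra. }
  apply Rabs_def2 in Hy.
  assert (T : forall s, Rabs (s - k0) = h -> Rabs (c * (z s - z k0 - c * (s - k0))) <= c * c * h / 2).
  { intros s hs. rewrite Rabs_mult. specialize (Kq s). rewrite hs in Kq. specialize (Kq ltac:(lra)).
    apply Rmult_le_compat_l with (r := Rabs c) in Kq; [| lra].
    replace (c * c * h / 2) with (Rabs c * Rabs c * h / 2) by (rewrite Ec; reflexivity). lra. }
  destruct (IVT_interv (fun k => c * (z k - y)) (k0 - h) (k0 + h)) as [k [Hk Ek]].
  - intros s hs. apply continuity_pt_filterlim. apply (ex_derive_continuous (fun k => c * (z k - y))).
    assert (X : ex_derive z s) by (apply Kr; apply Rabs_def1; lra).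
    auto_derive. exact X.
  - lra.
  - specialize (T (k0 - h)). replace (k0 - h - k0) with (- h) in T by ring.
    rewrite Rabs_Ropp, Rabs_pos_eq in T by lra. specialize (T eq_refl).
    apply Rabs_le_between in T. nra.
  - specialize (T (k0 + h)). replace (k0 + h - k0) with h in T by ring.
    rewrite Rabs_pos_eq in T by lra. specialize (T eq_refl).
    apply Rabs_le_between in T. nra.
  - exists k. split; [apply Rabs_def1; lra |].
    apply Rmult_integral in Ek. destruct Ek; [contradiction | lra].
Qed.

Lemma charact_jet_ext (Q : operator) (v w : R -> R -> R) (t x : R) :
  locally (t, x) (fun '(t, x) => v t x = w t x) ->
  charact Q (jet_of v t x) = charact Q (jet_of w t x).
Proof.
  intros H. destruct (locally2_slices _ _ _ H) as (E & Et & Ex). cbv beta iota in E, Et, Ex.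
  unfold charact, lift3. simpl. rewrite E.
  assert (Dt : Derive (fun s => v s x) t = Derive (fun s => w s x) t) by exact (Derive_ext_loc _ _ _ Et).
  assert (Dx : Derive (fun y => v t y) x = Derive (fun y => w t y) x) by exact (Derive_ext_loc _ _ _ Ex).
  rewrite Dt, Dx. reflexivity.
Qed.

(** Between two invariant families the reparameterization is [k |-> Phi t0 x0 (F t0 x0 k)], with
    [Phi] the first integral of [F']: it names the member of [F'] that meets [F t0 x0 k] at the base
    point. Conversely, local surjectivity of [zeta] makes every member of [F'] near [fam_k0 F'] a
    member of [F]. *)
Lemma invariant_family_equiv A B C Q W g (F F' : one_param_family) (t0 x0 u0 : R) :
  reduced_form A B C Q W g -> W (t0, x0, u0) ->
  solution_family A B C t0 x0 u0 F -> solution_family A B C t0 x0 u0 F' ->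
  members_invariant Q F t0 x0 ->
  (members_invariant Q F' t0 x0 <-> family_equiv t0 x0 F F').
Proof.
  intros R w HS HS' HI. split.
  - intros HI'.
    destruct (family_chart_ex A B C Q W g F' t0 x0 u0 R w HS' HI') as (Phi & e & b' & Ch).
    destruct (family_flow A B C Q W g F t0 x0 u0 R w HS HI) as (b & Hb & CF & Fl).
    destruct HS as (_ & E0 & Hk & _). destruct HS' as (_ & E0' & _).
    set (k0 := fam_k0 F) in *. set (k0' := fam_k0 F') in *.
    pose proof (fc_e Ch) as He.
    assert (C0 : cont3 F t0 x0 k0) by (apply (Ck_cont _ 0 _ _ _ _ (CF O)), Box_center, Hb).
    destruct (cont3_elim C0 e He) as (d & Hd & Kd).
    pose (r := Rmin d (Rmin b e)). assert (Hr : 0 < r) by (unfold r; repeat apply Rmin_glb_lt; assumption).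
    assert (L : r <= d /\ r <= b /\ r <= e) by (unfold r, Rmin; repeat destruct Rle_dec; lra).
    destruct L as (L1 & L2 & L3).
    assert (HB : forall t x k, Box t0 x0 k0 r (t, x, k) -> Box t0 x0 u0 e (t, x, F t x k)).
    { intros t x k (h1 & h2 & h3). repeat split; try lra. rewrite <- E0. apply Kd; lra. }
    assert (HBb : forall p, Box t0 x0 k0 r p -> Box t0 x0 k0 b p) by (intros p; apply Box_mono, L2).
    pose proof (Box_center t0 x0 k0 r Hr) as Bc.
    (* The smoothness of [zeta] is that of a function of three variables restricted to the line over
       [(t0, x0)]. *)
    assert (CZ : forall n, Ck n (Box t0 x0 k0 r) (fun t x k => Phi t x (F t x k))).
    { intros n. apply (Ck_comp n (Box t0 x0 k0 r) (Box t0 x0 u0 e) Phi (fun t _ _ => t) (fun _ x _ => x) F);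
        try apply open_Box.
      - apply Ch.
      - apply Ck_t, open_Box.
      - apply Ck_x, open_Box.
      - exact (Ck_mono n _ _ _ HBb (CF n)).
      - exact HB. }
    exists (fun k => Phi t0 x0 (F t0 x0 k)). fold k0 k0'. refine (conj _ (conj _ (conj _ _))).
    + apply locally1. exists r. split; [exact Hr |]. intros k hk n.
      apply (Ck_ex_derive_n (Box t0 x0 k0 r) (fun t x k => Phi t x (F t x k))); [exact CZ |].
      box.
    + rewrite E0. apply (chart_center Ch E0').
    + pose proof (proj2 (proj2 (Ck_ex _ 0 _ _ _ _ (CF 1%nat) (HBb _ Bc)))) as DF.
      pose proof (C1_chain _ Phi (fun _ => t0) (fun _ => x0) (fun k => F t0 x0 k) k0 0 0 _ (open_Box _ _ _ _)
        (fc_Ck Ch 1%nat) (HB _ _ _ Bc) (@is_derive_const _ _ _ _) (@is_derive_const _ _ _ _)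
        (Derive_correct _ _ DF)) as T. cbv beta in T.
      assert (E : Derive (fun k => Phi t0 x0 (F t0 x0 k)) k0 =
        dt Phi t0 x0 (F t0 x0 k0) * 0 + dx Phi t0 x0 (F t0 x0 k0) * 0
        + du Phi t0 x0 (F t0 x0 k0) * Derive (fun k => F t0 x0 k) k0) by exact (is_derive_unique _ _ _ T).
      rewrite E, !Rmult_0_r, !Rplus_0_l.
      destruct (is_d3_unique (fc_d3 Ch _ _ _ (HB _ _ _ Bc))) as (_ & _ & P3).
      rewrite P3. apply Rmult_integral_contrapositive. split; [| exact Hk].
      apply Rinv_neq_0_compat. apply (fc_du Ch).
      apply (fc_Phi Ch), HB, Bc.
    + apply locally3. exists r. split; [exact Hr |]. intros t x k ht hx hk. symmetry.
      apply (chart_first_integral Ch (fun t x => F t x k) t0 x0 r Hr); try assumption.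
      clear t x ht hx. intros t x ht hx.
      assert (B1 : Box t0 x0 k0 r (t, x, k)) by (box).
      split; [apply Fl, HBb, B1 | apply HB, B1].
  - intros (z & Sz & Ez & Dz & Hz).
    destruct (proj1 (locally3 _ _ _ _) Hz) as (e1 & He1 & K1).
    destruct (proj1 (locally3 _ _ _ _) HI) as (e2 & He2 & K2).
    assert (Hm : 0 < Rmin e1 e2) by (apply Rmin_glb_lt; assumption).
    destruct (local_surjective z (fam_k0 F)) with (e := Rmin e1 e2) as (d & Hd & Kd); try assumption.
    { exact (filter_imp _ _ (fun k H => H 1%nat) Sz). }
    rewrite Ez in Kd.
    apply locally3. exists (Rmin d (Rmin e1 e2)). split; [apply Rmin_glb_lt; assumption |].
    intros t x k' h1 h2 h3.
    split_Rmin.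
    destruct (Kd k' ltac:(assumption)) as (k & hk & <-). split_Rmin.
    rewrite (charact_jet_ext Q _ (fun s y => F s y k)); [apply (K2 t x k); tauto |].
    apply locally2. exists (Rmin (e1 - Rabs (t - t0)) (e1 - Rabs (x - x0))).
    split; [apply Rmin_glb_lt; lra |]. intros s y hs hy. apply lt_Rmin in hs. apply lt_Rmin in hy.
    apply (K1 s y k); [apply (Rabs_shift _ t), hs | apply (Rabs_shift _ x), hy | tauto].
Qed.

(** * From operators to families and back *)

Lemma reduced_form_mono A B C Q (W W' : R * R * R -> Prop) g : open W' -> (forall p, W' p -> W p) ->
  reduced_form A B C Q W g -> reduced_form A B C Q W' g.
Proof.
  intros HW' S [HW HA HB HC Hg Hxi Heta Htau Hxi0 Hs].
  constructor; auto; intros n; apply (Ck_mono n _ W); auto.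
Qed.

Lemma reduction_operator_family A B C Q W g (t0 x0 u0 : R) : reduced_form A B C Q W g ->
  W (t0, x0, u0) -> reduction_operator A B C t0 x0 u0 Q ->
  exists F : one_param_family, solution_family A B C t0 x0 u0 F /\ members_invariant Q F t0 x0.
Proof.
  intros R0 w0 HQ.
  destruct (proj1 (locally3 _ _ _ _) (filter_and _ _ (rf_open R0 _ w0)
    (reduction_compat A B C Q W g t0 x0 u0 R0 w0 HQ))) as (r & Hr & Kr).
  assert (R : reduced_form A B C Q (Box t0 x0 u0 r) g).
  { apply (reduced_form_mono A B C Q W); [apply open_Box | | exact R0].
    intros [[t x] u] (h1 & h2 & h3). apply (Kr t x u); assumption. }
  pose proof (Box_center t0 x0 u0 r Hr) as w.
  destruct R as [HW HA HB HC Hg Hxi Heta Htau Hxi0 Hs] eqn:ER.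
  destruct (frobenius g (evol_rhs A B C g) t0 x0 u0 (Box t0 x0 u0 r) HW w Hg) as (F & a & Ha & Fl & F0 & CF).
  - intros n. apply evol_rhs_Ck; auto.
  - intros t x u (h1 & h2 & h3). destruct (Kr t x u h1 h2 h3) as [_ E].
    unfold compat_defect in E. lra.
  - assert (Inv : forall t x k, Box t0 x0 u0 a (t, x, k) ->
      Lop A B C (jet_of (fun s y => F s y k) t x) = 0 /\ charact Q (jet_of (fun s y => F s y k) t x) = 0).
    { intros t x k b. apply (flow_invariant_solution A B C Q (Box t0 x0 u0 r) g (fun s y => F s y k) t x R).
      destruct (open3 _ _ _ _ (open_Box _ _ _ _) b) as (q & Hq & Kq).
      apply locally2. exists q. split; [exact Hq |]. intros s y hs hy. apply Fl, Kq.
      box. }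
    (* The parameter is the value at [(t0, x0)], so its base value is [u0] and the derivative of [F]
       in [k] there equals 1. *)
    exists (Family u0 F). split; [refine (conj _ (conj _ (conj _ _))) |]; simpl.
    + exists (Box t0 x0 u0 a). split; [apply open_Box | split; [apply Box_center, Ha | exact CF]].
    + apply F0. rewrite Rabs_sub_same; exact Ha.
    + rewrite (Derive_ext_loc _ (fun k => k)).
      * rewrite Derive_id. exact R1_neq_R0.
      * apply locally1. exists a. split; [exact Ha |]. exact F0.
    + apply locally3. exists a. split; [exact Ha |]. intros t x k h1 h2 h3.
      apply (Inv t x k). box.
    + apply locally3. exists a. split; [exact Ha |]. intros t x k h1 h2 h3.
      apply (Inv t x k). box.
Qed.

(** The last two clauses allow comparison with any other operator: [g] is the slope along the
    members, and every point near [(t0, x0, u0)] lies on a member whose parameter is close to the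
    base value. *)
Lemma solution_family_operator A B C (t0 x0 u0 : R) (F : one_param_family) :
  analytic2 A t0 x0 -> analytic2 B t0 x0 -> analytic2 C t0 x0 ->
  solution_family A B C t0 x0 u0 F ->
  exists (Q : operator) (g : R -> R -> R -> R),
    reduction_operator A B C t0 x0 u0 Q /\
    (forall t x u, tau Q t x u = 0 /\ xi Q t x u = 1 /\ eta Q t x u = g t x u) /\
    locally (t0, x0, fam_k0 F) (fun '(t, x, k) => g t x (F t x k) = dx F t x k) /\
    forall eps, 0 < eps -> locally (t0, x0, u0) (fun '(t, x, u) =>
      exists k, Rabs (k - fam_k0 F) < eps /\ F t x k = u /\ g t x u = dx F t x k).
Proof.
  intros hA hB hC (SF & E0 & Hk & HS). set (k0 := fam_k0 F) in *.
  destruct (analytic_coefficients A B C t0 x0 hA hB hC) as (r1 & R1 & A1).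
  destruct (smooth3_Box _ _ _ _ SF) as (s1 & S1 & F1).
  destruct (proj1 (locally3 _ _ _ _) HS) as (s2 & S2 & L2).
  pose (s := Rmin s1 s2). assert (Hs : 0 < s) by (apply Rmin_glb_lt; assumption).
  assert (Ls1 : s <= s1) by apply Rmin_l. assert (Ls2 : s <= s2) by apply Rmin_r.
  assert (CFs : forall n, Ck n (Box t0 x0 k0 s) F).
  { intros n. apply (Ck_mono n _ (Box t0 x0 k0 s1)); [intros p; apply Box_mono, Ls1 | apply F1]. }
  destruct (implicit_function F t0 x0 k0 u0 (Box t0 x0 k0 s) (open_Box _ _ _ _)
    (Box_center _ _ _ _ Hs) CFs E0 Hk) as (Phi & e & b & He & Hb & Hsub & _ & Hinj & HPhi & HCk & _).
  assert (CF : forall n, Ck n (Box t0 x0 k0 b) F) by (intros n; exact (Ck_mono n _ _ _ Hsub (CFs n))).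
  pose (g := fun t x u => dx F t x (Phi t x u)).
  pose (r := Rmin r1 e).
  assert (Hr : 0 < r) by (apply Rmin_glb_lt; assumption).
  assert (Q1 : r <= r1) by apply Rmin_l. assert (Q4 : r <= e) by apply Rmin_r.
  pose (W := Box t0 x0 u0 r). assert (HW : open W) by apply open_Box.
  assert (Wr : forall p, W p -> Box t0 x0 u0 r1 p) by (intros p; apply Box_mono, Q1).
  assert (We : forall p, W p -> Box t0 x0 u0 e p) by (intros p; apply Box_mono, Q4).
  pose proof (Box_center t0 x0 u0 r Hr : W (t0, x0, u0)) as w0.
  assert (Cg : forall n, Ck n W g).
  { intros n. apply (Ck_comp n W (Box t0 x0 k0 b) (dx F) (fun t _ _ => t) (fun _ x _ => x) Phi); try exact HW.
    - apply open_Box.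
    - apply Ck_dx, CF.
    - apply Ck_t, HW.
    - apply Ck_x, HW.
    - exact (Ck_mono n _ _ _ We (HCk n)).
    - intros t x u w. apply HPhi, We, w. }
  assert (Inv : forall t x k, Box t0 x0 k0 b (t, x, k) -> W (t, x, F t x k) -> Phi t x (F t x k) = k).
  { intros t x k Bk w. destruct (HPhi _ _ _ (We _ w)) as [Bk' E]. exact (Hinj t x _ _ Bk' Bk E). }
  assert (Hc : Phi t0 x0 u0 = k0).
  { rewrite <- E0 at 1. apply Inv; [apply Box_center, Hb |]. rewrite E0. exact w0. }
  pose (Q := Operator (fun _ _ _ => 0) (fun _ _ _ => 1) g).
  assert (R : reduced_form A B C Q W g).
  { constructor; simpl; intros.
    - exact HW.
    - exact (Ck_mono n _ _ _ Wr (proj1 (A1 u0 n))).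
    - exact (Ck_mono n _ _ _ Wr (proj1 (proj2 (A1 u0 n)))).
    - exact (Ck_mono n _ _ _ Wr (proj2 (proj2 (A1 u0 n)))).
    - apply Cg.
    - apply Ck_const, HW.
    - apply Cg.
    - reflexivity.
    - exact R1_neq_R0.
    - ring. }
  assert (Compat : forall t x u, W (t, x, u) -> compat_defect A B C g t x u = 0).
  { intros t x u w. destruct (HPhi _ _ _ (We _ w)) as [Bk Ek]. set (k := Phi t x u) in *.
    (* With the member through [(t, x, u)] fixed, the derivatives below need its graph to stay in
       [W] and its parameter in the chart at all nearby [(s, y)]. *)
    assert (N : locally (t, x) (fun '(s, y) => Box t0 x0 k0 b (s, y, k) /\ W (s, y, F s y k))).
    { destruct (open3 _ _ _ _ (open_Box _ _ _ _) Bk) as (q1 & P1 & K1).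
      destruct (open3 _ _ _ _ HW w) as (q2 & P2 & K2).
      destruct (cont3_elim (Ck_cont _ 0 _ _ _ _ (CF O) Bk) q2 P2) as (q3 & P3 & K3).
      apply locally2. exists (Rmin q1 (Rmin q2 q3)). split; [repeat apply Rmin_glb_lt; assumption |].
      intros s' y h1 h2. apply lt_Rmin in h1. apply lt_Rmin in h2. destruct h1 as [h1 i1]. destruct h2 as [h2 i2].
      apply lt_Rmin in i1. apply lt_Rmin in i2. split.
      - apply K1. box.
      - apply K2. repeat split; try tauto. rewrite <- Ek.
        apply K3; try tauto. rewrite Rabs_sub_same; exact P3. }
    assert (Fl : locally (t, x) (fun '(s, y) => flow_at W g (evol_rhs A B C g) (fun s y => F s y k) s y)).
    { generalize (locally_locally _ _ N). apply filter_imp. intros [s1' y1] N1.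
      apply (invariant_solution_flow A B C Q W g (fun s y => F s y k) s1' y1 R).
      generalize N1. apply filter_imp. intros [s2' y2] [B2 w2].
      destruct (Ck_ex _ 0 _ _ _ _ (CF 1%nat) B2) as (e1 & e2 & _).
      refine (conj w2 (conj e1 (conj e2 (conj _ _)))).
      - destruct (Hsub _ B2) as (j1 & j2 & j3). apply (L2 s2' y2 k); fold k0; lra.
      - unfold charact, lift3. simpl. unfold g. rewrite (Inv _ _ _ B2 w2). unfold dx. ring. }
    destruct (locally2_slices _ _ _ Fl) as ((_ & Ft & Fx) & Flt & Flx). cbv beta iota in Ft, Fx, Flt, Flx.
    rewrite Ek in Ft, Fx.
    assert (w' : W (t, x, F t x k)) by (rewrite Ek; exact w).
    assert (Ch : forall n, Ck n W (evol_rhs A B C g)).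
    { intros n. apply evol_rhs_Ck; apply R. }
    assert (T1 : dt (dx F) t x k = dt g t x u + du g t x u * evol_rhs A B C g t x u).
    { unfold dt at 1. rewrite (Derive_ext_loc _ (fun s => g s x (F s x k))).
      - pose proof (C1_chain W g (fun s => s) (fun _ => x) (fun s => F s x k) t 1 0 _ HW (Cg 1%nat) w'
          (@is_derive_id _ _) (@is_derive_const _ _ _ _) Ft) as T. cbv beta in T. rewrite Ek in T.
        etransitivity; [exact (is_derive_unique _ _ _ T) | ring].
      - generalize Flt. apply filter_imp. intros s' (_ & _ & Z). exact (is_derive_unique _ _ _ Z). }
    assert (T2 : dx (dt F) t x k = dx (evol_rhs A B C g) t x u + du (evol_rhs A B C g) t x u * g t x u).
    { unfold dx at 1. rewrite (Derive_ext_loc _ (fun y => evol_rhs A B C g t y (F t y k))).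
      - pose proof (C1_chain W (evol_rhs A B C g) (fun _ => t) (fun y => y) (fun y => F t y k) x 0 1 _ HW
          (Ch 1%nat) w' (@is_derive_const _ _ _ _) (@is_derive_id _ _) Fx) as T. cbv beta in T. rewrite Ek in T.
        etransitivity; [exact (is_derive_unique _ _ _ T) | ring].
      - generalize Flx. apply filter_imp. intros y (_ & Z & _). exact (is_derive_unique _ _ _ Z). }
    pose proof (Ck_schwarz _ F t x k (open_Box _ _ _ _) (CF 2%nat) Bk) as Sc.
    unfold compat_defect. lra. }
  exists Q, g. refine (conj _ (conj _ (conj _ _))).
  - apply (compat_reduction A B C Q W g t0 x0 u0 R w0); [| exact Compat].
    intros n. exact (Ck_const W HW n 0).
  - intros t x u. repeat split; reflexivity.
  - destruct (cont3_elim (Ck_cont _ 0 _ _ _ _ (CF O) (Box_center _ _ _ _ Hb)) r Hr)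
      as (q & Pq & Kq).
    apply locally3. exists (Rmin q (Rmin r b)). split; [repeat apply Rmin_glb_lt; assumption |].
    intros t x k h1 h2 h3. split_Rmin.
    unfold g. rewrite Inv; [reflexivity | |].
    + box.
    + repeat split; try tauto. rewrite <- E0. apply Kq; assumption.
  - intros eps Heps.
    destruct (cont3_elim (Ck_cont _ 0 _ _ _ _ (HCk O) (Box_center _ _ _ _ He)) eps Heps)
      as (q & Pq & Kq).
    apply locally3. exists (Rmin q e). split; [apply Rmin_glb_lt; assumption |].
    intros t x u h1 h2 h3. split_Rmin.
    exists (Phi t x u). refine (conj _ (conj _ eq_refl)).
    + rewrite <- Hc. apply Kq; tauto.
    + apply HPhi. box.
Qed.

(* The families corresponding to a given operator form exactly one equivalence
   class, and so do the operators corresponding to a given family: the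
   correspondence is a bijection between equivalence classes. *)
Theorem theorem3 (A B C : R -> R -> R) (t0 x0 u0 : R)
  (hA : analytic2 A t0 x0) (hB : analytic2 B t0 x0) (hC : analytic2 C t0 x0)
  (hA0 : A t0 x0 <> 0) :
  (forall Q : operator,
     reduction_operator A B C t0 x0 u0 Q -> zero_tau t0 x0 u0 Q ->
     exists F : one_param_family, solution_family A B C t0 x0 u0 F /\
       forall F' : one_param_family, solution_family A B C t0 x0 u0 F' ->
         (family_of_invariant_solutions A B C t0 x0 u0 Q F' <-> family_equiv t0 x0 F F'))
  /\
  (forall F : one_param_family,
     solution_family A B C t0 x0 u0 F ->
     exists Q : operator,
       reduction_operator A B C t0 x0 u0 Q /\ zero_tau t0 x0 u0 Q /\
       forall Q' : operator,
         reduction_operator A B C t0 x0 u0 Q' -> zero_tau t0 x0 u0 Q' ->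
         (family_of_invariant_solutions A B C t0 x0 u0 Q' F <-> operator_equiv t0 x0 u0 Q Q')).
Proof.
  split.
  - intros Q HQ Hz.
    destruct (reduction_reduced_form A B C Q t0 x0 u0 hA hB hC HQ Hz) as (W & w & R).
    destruct (reduction_operator_family A B C Q W _ t0 x0 u0 R w HQ) as (F & HS & HI).
    exists F. split; [exact HS |]. intros F' HS'.
    rewrite (members_invariant_all A B C Q W _ F' t0 x0 u0 R w HS').
    exact (invariant_family_equiv A B C Q W _ F F' t0 x0 u0 R w HS HS' HI).
  - intros F HS.
    destruct (solution_family_operator A B C t0 x0 u0 F hA hB hC HS) as (Q & g & HQ & Eq & G1 & G2).
    exists Q. split; [exact HQ |]. split.
    { unfold zero_tau. apply filter_forall. intros [[t x] u]. apply Eq. }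
    intros Q' HQ' Hz'.
    destruct (reduction_reduced_form A B C Q' t0 x0 u0 hA hB hC HQ' Hz') as (W & w & R).
    rewrite (members_invariant_all A B C Q' W _ F t0 x0 u0 R w HS).
    pose proof HS as (_ & E0 & _ & _).
    split.
    (* [Q] has [xi = 1], which leaves [xi Q'] as the only possible multiplier. Invariance of the
       member through each point gives [eta Q' = xi Q' * g] there. *)
    + intros HI. exists (xi Q'). split; [apply HQ' |]. split; [apply (rf_xi0 R _ _ _ w) |].
      destruct (proj1 (locally3 _ _ _ _) HI) as (e & He & Ke).
      assert (N : locally (t0, x0, u0) (fun '(t, x, u) => Rabs (t - t0) < e /\ Rabs (x - x0) < e)).
      { apply locally3. exists e. split; [exact He |]. tauto. }
      generalize (filter_and _ _ (rf_open R _ w) (filter_and _ _ N (G2 e He))).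
      apply filter_imp. intros [[t x] u] (w' & (h1 & h2) & k & hk & EF & Eg).
      destruct (Eq t x u) as (-> & -> & ->).
      pose proof (rf_tau0 R _ _ _ w') as Z. rewrite Z.
      specialize (Ke t x k h1 h2 hk). unfold charact, lift3 in Ke. simpl in Ke.
      rewrite EF, Z in Ke. rewrite Eg. unfold dx.
      refine (conj _ (conj _ _)); lra.
    (* Along the members, the characteristic of [Q'] is [l] times that of [Q], which vanishes
       because [g] is their slope. *)
    + intros (l & _ & _ & Hl).
      destruct (proj1 (locally3 _ _ _ _) Hl) as (e & He & Ke).
      assert (CF : cont3 F t0 x0 (fam_k0 F)).
      { destruct HS as ((D & _ & d & CD) & _). apply (Ck_cont D 0 _ _ _ _ (CD O) d). }
      destruct (cont3_elim CF e He) as (q & Pq & Kq). rewrite E0 in Kq.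
      assert (N : locally (t0, x0, fam_k0 F) (fun '(t, x, k) =>
        Rabs (t - t0) < e /\ Rabs (x - x0) < e /\ Rabs (F t x k - u0) < e)).
      { apply locally3. exists (Rmin q e). split; [apply Rmin_glb_lt; assumption |]. intros t x k h1 h2 h3.
        split_Rmin.
        refine (conj _ (conj _ (Kq t x k _ _ _))); tauto. }
      generalize (filter_and _ _ N G1). unfold members_invariant. apply filter_imp. intros [[t x] k] ((h1 & h2 & h3) & Eg).
      destruct (Ke t x (F t x k) h1 h2 h3) as (K1 & K2 & K3).
      destruct (Eq t x (F t x k)) as (Eq1 & Eq2 & Eq3).
      rewrite Eq1 in K1. rewrite Eq2 in K2. rewrite Eq3, Eg in K3. unfold dx in K3.
      unfold charact, lift3. simpl. rewrite K1, K2, K3. ring.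
Qed.
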